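(* Let $X$ be a smooth algebraic variety of dimension $n>1$ over an algebraically closed field $k$ of characteristic $p\ge 0$. If $\mathcal F$ is a codimension $q$ foliation on $X$ whose singular set has codimension at least $q+2$, then $$c_1(N_{\mathcal F})^{q+1}=0\quad\text{in } H^{q+1}(X,\Omega_X^{q+1}).$$
   Context: A foliation $\mathcal F$ on a smooth variety $X$ is given by a saturated coherent subsheaf $T_{\mathcal F}\subset T_X$ closed under the Lie bracket; its codimension is $q=\dim X-\mathrm{rank}\,T_{\mathcal F}$. Its singular set $\mathrm{Sing}(\mathcal F)$ is the locus where $T_X/T_{\mathcal F}$ is not locally free. The normal sheaf is $N_{\mathcal F}=(T_X/T_{\mathcal F})^{**}$, and $c_1(N_{\mathcal F})$ denotes the first Chern class in $H^1(X,\Omega^1_X)$ of the line bundle $\det N_{\mathcal F}=(\wedge^q N_{\mathcal F})^{**}$, where for a line bundle $L$, $c_1(L)$ is the image of the class of $L$ under $H^1(X,\mathcal O_X^* )\to H^1(X,\Omega^1_X)$ induced by $f\mapsto df/f$. The power is taken with respect to the cup product in $\bigoplus_s H^s(X,\Omega^s_X)$. *)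

(* Defs.v *)
From HB Require Import structures.
From mathcomp Require Import all_boot all_order all_algebra.
From mathcomp Require Import all_classical.
From mathcomp Require Import topology ring.

Set Implicit Arguments.
Unset Strict Implicit.
Unset Printing Implicit Defensive.

Import GRing.Theory.

Local Open Scope classical_set_scope.
Local Open Scope ring_scope.

(** * Commutative algebra inside a field

    All rings below are subrings of a field [K], and all modules are
    submodules of [K]-vector spaces, both given as [set]s. *)

Section Subrings.
Variable K : fieldType.
Implicit Types (R P : set K) (d : nat).

Definition prime_ideal R P : Prop :=
  [/\ P `<=` R, P 0 & ~ P 1] /\
  [/\ forall a b, P a -> P b -> P (a + b),
      forall a b, R a -> P b -> P (a * b)
    & forall a b, R a -> R b -> P (a * b) -> P a \/ P b].

Definition unit_in R (a : K) : Prop := [/\ R a, a != 0 & R a^-1].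

Definition nonunits R : set K := [set a | R a /\ ~ unit_in R a].

Definition prime_chain R d : Prop :=
  exists P : nat -> set K,
    (forall i, (i <= d)%N -> prime_ideal R (P i)) /\
    (forall i, (i < d)%N -> P i `<` P i.+1).

Definition krull_dim R d : Prop := prime_chain R d /\ ~ prime_chain R d.+1.

(** For a (Noetherian) local ring [R]: the maximal ideal, i.e. the set of
    non-units, is generated by [dim R] elements. *)
Definition regular_local R : Prop :=
  exists d, krull_dim R d /\
    exists t : 'I_d -> K, (forall i, nonunits R (t i)) /\
      forall a, nonunits R a ->
        exists c : 'I_d -> K, (forall i, R (c i)) /\ a = \sum_i c i * t i.

End Subrings.

Section Algebras.
Variables (k : closedFieldType) (K : fieldType) (iota : {rmorphism k -> K}).
Implicit Types A S : set K.

Definition subalgebra A : Prop :=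
  [/\ forall c, A (iota c),
      forall a b, A a -> A b -> A (a - b)
    & forall a b, A a -> A b -> A (a * b)].

Definition generated_by S A : Prop :=
  [/\ subalgebra A, S `<=` A
    & forall B, subalgebra B -> S `<=` B -> A `<=` B].

Definition fin_gen_algebra A : Prop :=
  exists m (a : 'I_m -> K), generated_by (range a) A.

End Algebras.

(** * Varieties *)

Section Opens.
Variable X : topologicalType.

Definition irreducible (Y : set X) : Prop :=
  Y !=set0 /\ forall U V, open U -> open V ->
    Y `&` U !=set0 -> Y `&` V !=set0 -> Y `&` U `&` V !=set0.

Definition irr_chain (c : nat) (Z : nat -> set X) : Prop :=
  (forall i, (i <= c)%N -> closed (Z i) /\ irreducible (Z i)) /\
  (forall i, (i < c)%N -> Z i `<` Z i.+1).

Definition dimension (n : nat) : Prop :=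
  (exists Z, irr_chain n Z) /\ ~ (exists Z, irr_chain n.+1 Z).

(** In particular the empty set has codimension at least [c] for all [c]. *)
Definition codim_ge (S : set X) (c : nat) : Prop :=
  forall Y, closed Y -> irreducible Y -> Y `<=` S ->
    exists Z, irr_chain c Z /\ Z 0%N = Y.

Variables (K : fieldType) (stalk : X -> set K).

Definition sections (U : set X) : set K :=
  [set f | forall x, U x -> stalk x f].

(** The prime ideal of [sections U] corresponding to the point [x] of [U]. *)
Definition prime_at (U : set X) (x : X) : set K :=
  [set a | sections U a /\ ~ unit_in (stalk x) a].

(** [x |-> prime_at U x] identifies the locally ringed space [U] with
    [Spec A], where [A := sections U] is a finitely generated algebra with
    fraction field [K]. *)
Definition affine (k : closedFieldType) (iota : {rmorphism k -> K})
    (U : set X) : Prop :=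
  let A := sections U in
  [/\ open U,
      fin_gen_algebra iota A
    & forall f, exists a b, [/\ A a, A b, b != 0 & f = a / b]] /\
  [/\ forall x, U x -> prime_ideal A (prime_at U x),
      forall x y, U x -> U y -> prime_at U x = prime_at U y -> x = y,
      forall P, prime_ideal A P -> exists2 x, U x & prime_at U x = P,
      forall x, U x -> stalk x =
        [set f | exists a b, [/\ A a, A b, ~ prime_at U x b & f = a / b]]
    & forall V, V `<=` U -> (open V <->
        forall x, V x -> exists f, [/\ A f, ~ prime_at U x f
          & [set y | U y /\ ~ prime_at U y f] `<=` V])].

End Opens.

(** An integral separated scheme of finite type over [k].  Since the scheme is
    integral, its local rings are given as subrings of its function field, and
    the ring of sections over a nonempty open set is the intersection of the
    local rings at the points of that set.  The points are all scheme points,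
    the generic point included.  Separatedness is expressed on affine open
    sets [U], [V]: [U `&` V] is affine, and its ring is generated by the rings
    of [U] and [V]; i.e. the diagonal is a closed immersion. *)
Record variety (k : closedFieldType) := Variety {
  points :> topologicalType;
  function_field : fieldType;
  scalars : {rmorphism k -> function_field};
  stalk : points -> set function_field;
  stalk_subalgebra : forall x, subalgebra scalars (stalk x);
  variety_irreducible : irreducible [set: points];
  variety_finite_type : exists m (U : 'I_m -> set points),
    (forall i, affine stalk scalars (U i)) /\ forall x, exists i, U i x;
  variety_separated : forall U V : set points,
    affine stalk scalars U -> affine stalk scalars V ->
    affine stalk scalars (U `&` V) /\
    generated_by scalars (sections stalk U `|` sections stalk V)
      (sections stalk (U `&` V))
}.

Arguments function_field {k} X : rename.
Arguments scalars {k} X : rename.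
Arguments stalk {k} X x : rename.

Definition smooth (k : closedFieldType) (X : variety k) : Prop :=
  forall x : X, regular_local (stalk X x).

(** * Derivations of the function field *)

Section Derivations.
Variables (k : closedFieldType) (K : fieldType) (iota : {rmorphism k -> K}).

Definition is_derivation : {pred K -> K^o} := fun D =>
  `[< [/\ forall a b, D (a + b) = D a + D b,
          forall a b, D (a * b) = a * D b + b * D a
        & forall c, D (iota c) = 0] >].

Lemma is_derivation_submod : submod_closed is_derivation.
Proof.
split=> [|a D E /asboolP[D1 D2 D3] /asboolP[E1 E2 E3]]; apply/asboolP; split.
- by move=> a b; rewrite -[LHS]/(0 : K) -[RHS]/(0 + 0 : K) addr0.
- by move=> a b; rewrite -[LHS]/(0 : K) -[RHS]/(a * 0 + b * 0 : K) !mulr0 addr0.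
- by [].
- move=> b c; rewrite -[LHS]/(a * D (b + c) + E (b + c) : K) D1 E1 mulrDr.
  by rewrite addrACA.
- move=> b c; rewrite -[LHS]/(a * D (b * c) + E (b * c) : K) D2 E2.
  rewrite -[RHS]/(b * (a * D c + E c) + c * (a * D b + E b) : K).
  by rewrite !mulrDr !(mulrCA a) addrACA.
- move=> c; rewrite -[LHS]/(a * D (iota c) + E (iota c) : K) D3 E3.
  by rewrite mulr0 addr0.
Qed.

HB.instance Definition _ :=
  GRing.isSubmodClosed.Build K (K -> K^o) is_derivation is_derivation_submod.

Record derivation := Derivation {
  der_fun :> K -> K^o; der_funP : der_fun \in is_derivation }.

HB.instance Definition _ := [isSub for der_fun].
HB.instance Definition _ := [Choice of derivation by <:].
HB.instance Definition _ := [SubChoice_isSubLmodule of derivation by <:].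

Lemma lie_subproof (D E : derivation) :
  (fun f => D (E f) - E (D f) : K^o) \in is_derivation.
Proof.
case: D E => [D /asboolP[D1 D2 D3]] [E /asboolP[E1 E2 E3]] /=.
have D0 : D 0 = 0 by rewrite -(rmorph0 iota) D3 rmorph0.
have E0 : E 0 = 0 by rewrite -(rmorph0 iota) E3 rmorph0.
apply/asboolP; split=> [a b|a b|c].
- by rewrite D1 E1 D1 E1 opprD addrACA.
- rewrite E2 D2 D1 E1 !D2 !E2 -[LHS]/(_ - _ : K) -[RHS]/(_ + _ : K).
  by rewrite !mulrBr !opprD; ring.
- by rewrite E3 D3 D0 E0 subr0.
Qed.

Definition lie_bracket (D E : derivation) : derivation :=
  Derivation (lie_subproof D E).

End Derivations.

Section Modules.
Variable K : fieldType.
Implicit Types (R : set K) (E : lmodType K).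

(** The images of [e] form a basis of [M / N] over [R]; here [M], [N] are
    [R]-submodules of [E] with [N] contained in [M]. *)
Definition basis_mod R E (M N : set E) (m : nat) (e : 'I_m -> E) : Prop :=
  (forall i, M (e i)) /\
  forall v, M v -> exists! a : 'I_m -> K,
    (forall i, R (a i)) /\ N (v - \sum_i a i *: e i).

(** [Hom_R(M, R)], for [M] an [R]-submodule that spans the [K]-vector space
    [E], where [K] is the fraction field of [R]. *)
Definition dual R E (M : set E) : set (E -> K^o) :=
  [set phi : E -> K^o | linear phi /\ forall v, M v -> R (phi v)].

End Modules.

(** * Tangent sheaf and foliations

    Coherent torsion-free sheaves are given by their stalks, inside their
    generic fibre; that of [T_X] is the space of derivations of the function
    field. *)

Section Foliations.
Variables (k : closedFieldType) (X : variety k).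

Notation K := (function_field X).
Notation Der := (derivation (scalars X)).

Definition tangent (x : X) : set Der :=
  [set D | forall f, stalk X x f -> stalk X x (D f)].

(** [fol_coherent]: the stalks [fol x] are those of an O_X-submodule of [T_X]
    that is locally generated by finitely many sections; since [X] is
    Noetherian, such submodules are exactly the coherent ones.
    [fol_saturated]: the quotient [T_X / T_F] is torsion-free. *)
Record foliation := Foliation {
  fol :> X -> set Der;
  fol_tangent : forall x, fol x `<=` tangent x;
  fol_coherent : forall x : X, exists U : set X, [/\ open U, U x
    & exists m (e : 'I_m -> Der), forall y, U y -> fol y =
        [set D | exists a : 'I_m -> K,
          (forall i, stalk X y (a i)) /\ D = \sum_i a i *: e i]];
  fol_saturated : forall x a D,
    stalk X x a -> a != 0 -> tangent x D -> fol x (a *: D) -> fol x D;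
  fol_lie : forall x D E, fol x D -> fol x E -> fol x (lie_bracket D E)
}.

Variable F : foliation.

Definition generic_fibre : set Der :=
  [set D | exists x a, a != 0 /\ F x (a *: D)].

Definition fol_rank (r : nat) : Prop :=
  exists e : 'I_r -> Der, basis_mod setT generic_fibre [set 0] e.

Definition fol_codim (q : nat) : Prop :=
  exists n r, [/\ dimension X n, fol_rank r & (r + q)%N = n].

Definition quotient_locally_free_at (x : X) : Prop :=
  exists U : set X, [/\ open U, U x
    & exists m (e : 'I_m -> Der), forall y, U y ->
        basis_mod (stalk X y) (tangent y) (F y) e].

Definition singular_set : set X := [set x | ~ quotient_locally_free_at x].

(** * The line bundle [det N_F] *)

(** The stalk of [(T_X / T_F)^*]. *)
Definition conormal (x : X) : set (Der -> K^o) :=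
  [set al | dual (stalk X x) (tangent x) al /\ forall D, F x D -> al D = 0].

(** The inverse image, under [Der -> Der / generic_fibre], of the stalk of
    [N_F = (T_X / T_F)^**]. *)
Definition normal (x : X) : set Der :=
  [set D | forall al, conormal x al -> stalk X x (al D)].

Definition form (s : nat) := ('I_s -> Der) -> K^o.

Definition upd s (D : 'I_s -> Der) (i : 'I_s) (E : Der) : 'I_s -> Der :=
  fun j => if j == i then E else D j.

(** Alternating multilinear [q]-forms on the [K]-vector space
    [Der / generic_fibre], the generic fibre of [N_F]. *)
Definition is_alt_form (q : nat) : {pred form q} := fun w =>
  `[< [/\ forall D i a E E',
            w (upd D i (a *: E + E')) = a *: w (upd D i E) + w (upd D i E'),
          forall D i j, i != j -> D i = D j -> w D = 0
        & forall D i, generic_fibre (D i) -> w D = 0] >].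

Lemma is_alt_form_submod q : submod_closed (@is_alt_form q).
Proof.
split=> [|a v w /asboolP[v1 v2 v3] /asboolP[w1 w2 w3]]; apply/asboolP; split.
- move=> D i a E E'; rewrite -[LHS]/(0 : K) -[RHS]/(a * 0 + 0 : K).
  by rewrite mulr0 addr0.
- by [].
- by [].
- move=> D i b E E'; rewrite -[LHS]/(a * v _ + w _ : K) v1 w1.
  rewrite -[RHS]/(b * (a * v _ + w _) + (a * v _ + w _) : K).
  by rewrite !mulrDr (mulrCA a) addrACA.
- move=> D i j ij Dij; rewrite -[LHS]/(a * v _ + w _ : K).
  by rewrite (v2 _ _ _ ij) ?(w2 _ _ _ ij) // mulr0 addr0.
- move=> D i Di; rewrite -[LHS]/(a * v _ + w _ : K).
  by rewrite (v3 _ _ Di) (w3 _ _ Di) mulr0 addr0.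
Qed.

HB.instance Definition _ q := GRing.isSubmodClosed.Build K (form q)
  (@is_alt_form q) (@is_alt_form_submod q).

Record alt_form (q : nat) := AltForm {
  alt_fun : form q; alt_funP : alt_fun \in @is_alt_form q }.

HB.instance Definition _ q := [isSub for @alt_fun q].
HB.instance Definition _ q := [Choice of alt_form q by <:].
HB.instance Definition _ q := [SubChoice_isSubLmodule of alt_form q by <:].

(** The stalk of [(wedge^q N_F)^*]: alternating forms on the stalk of [N_F]
    with values in the local ring. *)
Definition dual_det_normal (q : nat) (x : X) : set (alt_form q) :=
  [set w : alt_form q | forall D, (forall i, normal x (D i)) -> stalk X x (alt_fun w D)].

(** The stalk of [(wedge^q N_F)^**]. *)
Definition det_normal (q : nat) (x : X) : set (alt_form q -> K^o) :=
  dual (stalk X x) (@dual_det_normal q x).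

End Foliations.

Arguments det_normal {k X} F q x.

(** * Differential forms and Hodge cohomology *)

Section Hodge.
Variables (k : closedFieldType) (X : variety k).

Notation K := (function_field X).
Notation Der := (derivation (scalars X)).

Definition wedge s (al : 'I_s -> Der -> K) : form X s :=
  fun D => \det (\matrix_(i, j) al i (D j)).

Definition differential (f : K) : Der -> K := fun D => D f.

Definition dlog (g : K) : Der -> K := fun D => D g / g.

(** The image of the stalk of [Omega^s_X] in the space of alternating
    [s]-forms on [Der], which is [Omega^s_{K/k}]: the submodule generated by
    the forms [d f_1 /\ ... /\ d f_s].  As [Omega^s_X] is locally free for
    smooth [X], it is isomorphic to its image. *)
Definition Omega_stalk (s : nat) (x : X) : set (form X s) :=
  [set w | exists m (a : 'I_m -> K) (f : 'I_m -> 'I_s -> K),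
    [/\ forall j, stalk X x (a j),
        forall j l, stalk X x (f j l)
      & w = \sum_j a j *: wedge (fun l => differential (f j l))]].

Definition Omega (s : nat) (U : set X) : set (form X s) :=
  [set w | forall x, U x -> Omega_stalk x w].

(** As [X] is irreducible, all finite intersections of the members of a cover
    are nonempty; this is needed for [Omega] to give the sections over them. *)
Definition open_cover (I : Type) (U : I -> set X) : Prop :=
  (forall i, open (U i) /\ U i !=set0) /\ forall x, exists i, U i x.

(** Cech [s]-cochains of [Omega^t]; that the values lie in [Omega^t] is
    required separately. *)
Definition cochain (I : Type) (s t : nat) := ('I_s.+1 -> I) -> form X t.

Definition regular_cochain I (U : I -> set X) s t (c : cochain I s t) : Prop :=
  forall i, Omega (\bigcap_(a in [set: 'I_s.+1]) U (i a)) (c i).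

Definition cech_d I s t (c : cochain I s t) : cochain I s.+1 t :=
  fun i => \sum_(a < s.+2) (-1) ^+ a *: c (fun b => i (lift a b)).

Definition coboundary I (U : I -> set X) s t (c : cochain I s.+1 t) : Prop :=
  exists b : cochain I s t, regular_cochain U b /\ c = cech_d b.

(** The cocycle [c] on the cover [U] represents zero in
    [H^{s+1}(X, Omega^t)], the colimit over all open covers of the Cech
    cohomology groups. *)
Definition zero_in_cohomology I (U : I -> set X) s t (c : cochain I s.+1 t) :
    Prop :=
  exists (J : Type) (V : J -> set X) (tau : J -> I),
    [/\ open_cover V, forall j, V j `<=` U (tau j)
      & coboundary V (fun i => c (fun a => tau (i a)) : form X t)].

(** The [m]-fold cup product of a 1-cochain with values in [Omega^1]:
    [i |-> c(i_0,i_1) /\ c(i_1,i_2) /\ ... /\ c(i_{m-1},i_m)], iterating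
    [(c, c') |-> c(i_0,...,i_s) /\ c'(i_s,...,i_{s+t})]. *)
Definition cup_power I (c : cochain I 1 1) (m : nat) : cochain I m m :=
  fun i => wedge (fun (a : 'I_m) D =>
    c (fun v : 'I_2 => i (inord (a + v)%N)) (fun=> D)).

(** [e] generates over [U] the invertible sheaf with stalks [L x]. *)
Definition local_generator (E : lmodType K) (L : X -> set E) (U : set X)
    (e : E) : Prop :=
  e != 0 /\
  forall x, U x -> L x = [set v | exists2 a, stalk X x a & v = a *: e].

(** [c] is the cocycle [dlog g_ij], where [e_j = g_ij e_i] and [e_i] is a
    generator over [U_i] of the invertible sheaf with stalks [L x].  The
    opposite convention for [g_ij] only changes the sign of the class. *)
Definition represents_c1 (E : lmodType K) (L : X -> set E) I (U : I -> set X)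
    (c : cochain I 1 1) : Prop :=
  exists e : I -> E, (forall i, local_generator L (U i) (e i)) /\
    forall i : 'I_2 -> I, exists g : K,
      [/\ g != 0, e (i 1) = g *: e (i 0) & c i = fun D => dlog g (D 0)].

End Hodge.

Arguments cup_power {k X I} c m i.

(* Main.v *)
(** Away from its singular set the foliation has a Bott connection: writing
    [T_X / T_F] in a local frame, the trace of [D, e_j] modulo [T_F] extends to a
    regular 1-form which differs from [dlog] of a transition function of
    [det N_F] by a form vanishing on [T_F].  Hence [dlog g_ij] is cohomologous
    there to a cocycle of 1-forms killing [T_F], any [q + 1] of which have zero
    wedge product, and [c_1(N_F)^(q+1)] is the coboundary of an explicit cochain.

    The class extends by zero over the singular set since its points have regular
    local rings of dimension at least [q + 2].  On an affine open set [W], let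
    [c] be a Cech cocycle of a sum of copies of [O_X] for affine open sets that
    cover [W] off the singular set.  If [c] were not a coboundary, some
    multiple of it would have as annihilator the prime of a point [y], which is
    singular; the generators of the maximal ideal at [y], a regular sequence,
    kill the multiple, and dividing by them one after the other moves its class
    down to degree [-1], where it vanishes.  The affine open sets meeting the
    singular set are then added to the cover one at a time. *)
From HB Require Import structures.
From mathcomp Require Import all_boot all_order perm all_algebra.
From mathcomp Require Import all_classical.
From mathcomp Require Import topology ring zify.
Require Import Defs.

Set Implicit Arguments.
Unset Strict Implicit.
Unset Printing Implicit Defensive.

Import GRing.Theory.

Local Open Scope classical_set_scope.
Local Open Scope ring_scope.

(** * Noetherian subrings *)

(** Extension over the singular set is an injectivity: local cohomology of [Omega^(q+1)] supported
    there vanishes below degree [q + 2], so a class of degree [q + 1] is zero once it is zero off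
    that set. This is the origin of the bound [q + 2]. A single nonzero rational [q]-form [w] on
    [Der / generic_fibre] serves as reference for all local generators of [det N_F]. It makes
    [dlog g_ij] a difference [eta_j - eta_i] of rational forms; with [th_j] the Bott form and
    [mu_j = eta_j + th_j], the differences of the [mu_j] kill [T_F]. The powers built from [eta] and
    from [mu] are then compared by one formal homotopy, valid for every multi-additive function. The
    characteristic is arbitrary, so local coordinates come neither from separability nor from a
    flow: parameters at a rational point generate the differentials by Nakayama's lemma, and a count
    of independent derivations makes them a basis. The derivations are a basis of the generic fibre
    together with [q] vectors on which [w] is nonzero. Cochains are indexed by lists, so that the
    augmented complex and the insertion of an index need no special treatment. *)

Section Ideals.
Variable T : comNzRingType.
Implicit Types (R I J S : set T).

Definition subring R : Prop :=
  [/\ R 1, forall a b, R a -> R b -> R (a - b)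
    & forall a b, R a -> R b -> R (a * b)].

Definition ideal R I : Prop :=
  [/\ I `<=` R, I 0, forall a b, I a -> I b -> I (a + b)
    & forall a b, R a -> I b -> I (a * b)].

(** The maximal condition is taken as primitive because primes, associated primes and finite covers
    below are all found as, or from, maximal members of a family of ideals. *)
Definition noetherian R : Prop :=
  forall F : set (set T), F !=set0 -> (forall I, F I -> ideal R I) ->
  exists2 I, F I & forall J, F J -> I `<=` J -> J `<=` I.

Definition adjoin R I (x : T) : set T :=
  [set a | exists b r, [/\ I b, R r & a = b + r * x]].

Lemma subring0 R : subring R -> R 0.
Proof. by case=> R1 RB _; rewrite -(subrr 1); apply: RB. Qed.

Lemma subringN R a : subring R -> R a -> R (- a).
Proof. by move=> sR Ra; rewrite -sub0r; case: (sR) => _ RB _; apply: RB => //; apply: subring0. Qed.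

Lemma subringD R a b : subring R -> R a -> R b -> R (a + b).
Proof.
move=> sR Ra Rb; rewrite -(opprK b); case: (sR) => _ RB _; apply: RB => //.
exact: subringN.
Qed.

Lemma subringM R a b : subring R -> R a -> R b -> R (a * b).
Proof. by case=> _ _; apply. Qed.

Lemma subringX R a n : subring R -> R a -> R (a ^+ n).
Proof.
move=> sR Ra; elim: n => [|n IHn]; first by rewrite expr0; case: sR.
by rewrite exprS; apply: subringM.
Qed.

Lemma subring_sum R (I : Type) (r : seq I) (P : pred I) (f : I -> T) :
  subring R -> (forall i, P i -> R (f i)) -> R (\sum_(i <- r | P i) f i).
Proof.
move=> sR Rf; elim/big_rec: _ => [|i x Pi Rx]; first exact: subring0.
by apply: subringD => //; apply: Rf.
Qed.

Lemma idealN R I a : subring R -> ideal R I -> I a -> I (- a).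
Proof.
move=> sR [_ _ _ IM] Ia; rewrite -mulN1r; apply: IM => //.
by apply: subringN => //; case: sR.
Qed.

Lemma idealB R I a b : subring R -> ideal R I -> I a -> I b -> I (a - b).
Proof. by move=> sR iI Ia Ib; case: (iI) => _ _ ID _; apply: ID => //; apply: (idealN sR). Qed.

Lemma ideal_sum R I (J : Type) (r : seq J) (P : pred J) (f : J -> T) :
  ideal R I -> (forall i, P i -> I (f i)) -> I (\sum_(i <- r | P i) f i).
Proof.
move=> [_ I0 ID _] If; elim/big_rec: _ => [|i x Pi Ix]; first exact: I0.
by apply: ID => //; apply: If.
Qed.

Lemma sub_adjoin R I x : subring R -> I `<=` adjoin R I x.
Proof. by move=> sR a Ia; exists a, 0; rewrite mul0r addr0; split=> //; apply: subring0. Qed.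

Lemma adjoinP R I x : subring R -> ideal R I -> R x ->
  [/\ ideal R (adjoin R I x), I `<=` adjoin R I x & adjoin R I x x].
Proof.
move=> sR [IR I0 ID IM] Rx; have R0 := subring0 sR; have [R1 _ RM] := sR; split.
- split.
  + by move=> _ [b [r [Ib Rr ->]]]; apply: subringD => //; auto.
  + by exists 0, 0; rewrite mul0r addr0.
  + move=> _ _ [b [r [Ib Rr ->]]] [b' [r' [Ib' Rr' ->]]].
    exists (b + b'), (r + r'); split; [exact: ID|exact: subringD|].
    by rewrite mulrDl addrACA.
  + move=> a _ Ra [b [r [Ib Rr ->]]]; exists (a * b), (a * r).
    by split; [exact: IM|exact: RM|rewrite mulrDr mulrA].
- by move=> a Ia; exists a, 0; rewrite mul0r addr0.
- by exists 0, 1; rewrite mul1r add0r.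
Qed.

Lemma adjoin_sub R I J x : ideal R J -> I `<=` J -> J x -> adjoin R I x `<=` J.
Proof. by case=> _ _ JD JM IJ Jx _ [b [r [Ib Rr ->]]]; apply: JD; auto. Qed.

Lemma noetherian_ideal_maximal R (P : set T -> Prop) : noetherian R ->
  (exists2 I, ideal R I & P I) ->
  exists I, [/\ ideal R I, P I &
    forall J, ideal R J -> P J -> I `<=` J -> J `<=` I].
Proof.
move=> nR [I0 iI0 PI0].
have [||I [iI PI] maxI] := nR [set I | ideal R I /\ P I].
- by exists I0.
- by move=> I [].
- by exists I; split=> // J iJ PJ; apply: maxI.
Qed.

(** A maximal finitely generated ideal inside [I] is [I] itself, since adjoining one more element of
    [I] keeps it finitely generated. *)
Lemma noetherian_fin_gen R I : subring R -> noetherian R -> ideal R I ->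
  exists m (g : 'I_m -> T), (forall i, I (g i)) /\
    forall a, I a -> exists c : 'I_m -> T,
      (forall i, R (c i)) /\ a = \sum_i c i * g i.
Proof.
move=> sR nR iI.
pose fg J := J `<=` I /\ exists m (g : 'I_m -> T), (forall i, J (g i)) /\
    forall a, J a -> exists c : 'I_m -> T,
      (forall i, R (c i)) /\ a = \sum_i c i * g i.
have R0 := subring0 sR.
have [|J [iJ [JI [m [g [Jg genJ]]]] maxJ]] :=
    @noetherian_ideal_maximal R fg nR.
  exists [set 0]; last split.
  - split=> // [_ ->//|_ _ -> ->|a _ _ ->]; first by rewrite addr0.
    by rewrite mulr0.
  - by move=> _ ->; case: iI.
  - exists 0, (fun=> 0); split=> // a ->; exists (fun=> 0); split=> //.
    by rewrite big_ord0.
have IR : I `<=` R by case: iI.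
exists m, g; split=> [i|a Ia]; first by apply/JI/Jg.
have [iJa JJa Jaa] := adjoinP sR iJ (IR _ Ia).
apply/genJ/(maxJ _ iJa) => //; split; first exact: adjoin_sub.
exists m.+1, (fun i => if unlift ord_max i is Some j then g j else a); split.
  by move=> i; case: (unliftP ord_max i) => [j|] _ //; apply/JJa/Jg.
move=> _ [b [r [/genJ[c [Rc ->]] Rr ->]]].
exists (fun i => if unlift ord_max i is Some j then c j else r); split.
  by move=> i; case: (unliftP ord_max i).
rewrite big_ord_recr /= unlift_none; congr (_ + _); apply: eq_bigr => i _.
suff -> : widen_ord (leqnSn m) i = lift ord_max i by rewrite liftK.
by apply: val_inj; rewrite /= /bump leqNgt ltn_ord.
Qed.

End Ideals.

Lemma noetherian_image (T' T : comNzRingType) (f : {rmorphism T' -> T}) :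
  noetherian [set: T'] -> noetherian (range f).
Proof.
move=> nT F [I0 FI0] iF.
have [||_ [I FI <-] maxI] := nT [set f @^-1` I | I in F].
- by exists (f @^-1` I0), I0.
- move=> _ [I /iF[IR I0' ID IM] <-]; split=> //= [|a b Ia Ib|a b _ Ib].
  + by rewrite rmorph0.
  + by rewrite rmorphD; apply: ID.
  + by rewrite rmorphM; apply: IM => //; exists a.
exists I => // J FJ IJ y Jy; have [JR _ _ _] := iF _ FJ.
have [x _ fx] := JR _ Jy; move: Jy; rewrite -fx.
apply: (maxI (f @^-1` J)); first by exists J.
by move=> z /IJ.
Qed.

Section FieldIdeals.
Variable F : fieldType.

Lemma noetherian_field : noetherian [set: F].
Proof.
move=> G [I GI] iG; case: (pselect (exists2 J, G J & J 1)) => [[J GJ J1]|no1].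
  exists J => // J' _ _ x _; have [_ _ _ JM] := iG _ GJ.
  by rewrite -(mulr1 x); apply: JM.
exists I => // J GJ _ x Jx; case: (eqVneq x 0) => [->|x0].
  by case: (iG _ GI).
case: no1; exists J => //; have [_ _ _ JM] := iG _ GJ.
by rewrite -(mulVf x0); apply: JM.
Qed.

End FieldIdeals.

(** * Hilbert's basis theorem *)

Section HilbertBasis.
Variable T : comNzRingType.

Let lead_ideal (I : set {poly T}) n : set T :=
  [set r | exists p : {poly T}, [/\ I p, (size p <= n.+1)%N & p`_n = r]].

Let lead_idealP I n : ideal [set: {poly T}] I -> ideal setT (lead_ideal I n).
Proof.
move=> [_ I0 ID IM]; split=> //.
- by exists 0; split=> //; rewrite ?size_poly0 ?coef0.
- move=> _ _ [p [Ip sp <-]] [p' [Ip' sp' <-]]; exists (p + p').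
  split; [exact: ID| |by rewrite coefD].
  by rewrite (leq_trans (size_polyD _ _)) // geq_max sp.
- move=> a _ _ [p [Ip sp <-]]; exists (a%:P * p).
  split; [exact: IM| |by rewrite coefCM].
  by rewrite mul_polyC (leq_trans (size_scale_leq _ _)).
Qed.

Let lead_ideal_mono I n m : ideal [set: {poly T}] I -> (n <= m)%N ->
  lead_ideal I n `<=` lead_ideal I m.
Proof.
move=> [_ I0 ID IM] nm _ [p [Ip sp <-]]; exists ('X^(m - n) * p).
split; [exact: IM| |].
  apply: (leq_trans (size_polyMleq _ _)); rewrite size_polyXn /=.
  by rewrite (leq_trans (leq_add (leqnn _) sp)) // addnS subnK.
by rewrite mulrC coefMXn ltnNge leq_subr subKn.
Qed.

(** Subtracting an element of [I] with the same leading coefficient lowers the degree of an element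
    of [J]. *)
Let lead_ideal_inj I J : ideal [set: {poly T}] I -> ideal setT J ->
  I `<=` J -> (forall n, lead_ideal J n `<=` lead_ideal I n) -> J `<=` I.
Proof.
move=> iI iJ IJ leadJI p; have [_ I0 ID IM] := iI.
have [m] := ubnP (size p); elim: m p => // m IHm p sp Jp.
case: (posnP (size p)) => [/eqP|p0]; first by rewrite size_poly_eq0 => /eqP->.
have [|p' [Ip' sp' eqp]] := leadJI (size p).-1 p`_(size p).-1.
  by exists p; rewrite prednK.
have sring : subring [set: {poly T}] by [].
rewrite -(subrK p' p); apply: ID => //; apply: IHm; last first.
  by apply: (idealB sring iJ) => //; apply: IJ.
apply: (@leq_trans (size p)); last by rewrite -ltnS.
rewrite -(prednK p0) ltnS; apply/leq_sizeP => j; rewrite leq_eqVlt.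
case/predU1P=> [<-|lt_j]; first by rewrite coefB eqp subrr.
rewrite coefB !nth_default ?subrr //.
  by apply: leq_trans lt_j; rewrite (leq_trans sp') // prednK.
by rewrite prednK in lt_j.
Qed.

(** A leading-coefficient ideal that is maximal over all members of [F] and all degrees settles the
    degrees from [n] on. The finitely many degrees below [n] are made maximal one after the
    other. *)
Lemma hilbert_basis : noetherian [set: T] -> noetherian [set: {poly T}].
Proof.
move=> nT F [I0 FI0] iF.
have [||L [I1 FI1 [n ->]] maxL] :=
    nT [set L | exists2 I, F I & exists n, L = lead_ideal I n].
- by exists (lead_ideal I0 0), I0 => //; exists 0%N.
- by move=> _ [I /iF iI [n ->]]; apply: lead_idealP.
(* The degrees are treated downwards from [n - 1]. Enlarging the ideal for a new degree keeps the
   earlier ones maximal, because maximality is claimed only against ideals above the current one. *)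
have step m : exists I, [/\ F I, I1 `<=` I & forall J, F J -> I `<=` J ->
    forall j, (n - m <= j < n)%N -> lead_ideal J j `<=` lead_ideal I j].
  elim: m => [|m [I [FI II1 maxI]]].
    exists I1; split=> // J _ _ j; rewrite subn0 => /andP[h1 h2].
    by move: (leq_trans h2 h1); rewrite ltnn.
  have [||_ [I' [FI' II' ->]] maxI'] := nT [set L | exists I', [/\ F I',
      I `<=` I' & L = lead_ideal I' (n - m.+1)]].
  + by exists (lead_ideal I (n - m.+1)), I; split.
  + by move=> L' [I' [/iF iI' _ ->]]; apply: lead_idealP.
  exists I'; split=> // [x /II1/II'//|J FJ I'J j /andP[]].
  rewrite leq_eqVlt => /predU1P[<- _|lt_j ltjn].
    apply: (maxI' (lead_ideal J (n - m.+1))).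
      by exists J; split=> // x /II'/I'J.
    by move=> r [p [Ip sp eqr]]; exists p; split=> //; apply: I'J.
  have IJ : I `<=` J by move=> x /II'/I'J.
  have jin : (n - m <= j < n)%N by rewrite ltjn andbT; move: lt_j; lia.
  move=> r /(maxI _ FJ IJ j jin)[p [Ip sp eqr]].
  by exists p; split=> //; apply: II'.
have [I [FI II1 maxI]] := step n.
exists I => // J FJ IJ; apply: lead_ideal_inj => //; [exact: iF|exact: iF|].
move=> j; case: (ltnP j n) => [ltjn|lenj].
  by apply: maxI => //; rewrite subnn ltjn.
have II1n : lead_ideal I1 n `<=` lead_ideal I n.
  by move=> _ [p [Ip sp <-]]; exists p; split=> //; apply: II1.
apply: (subset_trans _ (subset_trans II1n (lead_ideal_mono (iF _ FI) lenj))).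
apply: maxL; first by exists J => //; exists j.
apply: (subset_trans II1n).
apply: (subset_trans (lead_ideal_mono (iF _ FI) lenj)).
by move=> _ [p [Ip sp <-]]; exists p; split=> //; apply: IJ.
Qed.

End HilbertBasis.

(** * Local algebra inside a field *)

Section LocalAlgebra.
Variable K : fieldType.
Implicit Types (R P Q I J S M : set K) (x a b : K) (t : seq K).

Lemma prime_ideal_ideal R P : prime_ideal R P -> ideal R P.
Proof. by case=> [[PR P0 _] [PD PM _]]; split. Qed.

Lemma prime_ideal1 R P : prime_ideal R P -> ~ P 1.
Proof. by case=> [[]]. Qed.

Lemma prime_idealM R P a b : prime_ideal R P -> R a -> R b -> P (a * b) ->
  P a \/ P b.
Proof. by case=> [_ [_ _]]; apply. Qed.

Lemma prime_ideal_unit R P a : prime_ideal R P -> P a -> ~ unit_in R a.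
Proof.
move=> pP Pa [Ra a0 Rai]; apply: (prime_ideal1 pP).
by rewrite -(mulVf a0); case: pP => _ [_ PM _]; apply: PM.
Qed.

Lemma prime_sub_nonunits R P : prime_ideal R P -> P `<=` nonunits R.
Proof.
move=> pP a Pa; split; last exact: prime_ideal_unit pP Pa.
by case: pP => [[PR _ _] _]; apply: PR.
Qed.

Definition mult_set R S : Prop :=
  [/\ S `<=` R, S 1, ~ S 0 & forall a b, S a -> S b -> S (a * b)].

Lemma mult_setN0 R S a : mult_set R S -> S a -> a != 0.
Proof. by move=> [_ _ S0 _] Sa; apply/eqP => a0; apply: S0; rewrite -a0. Qed.

Lemma prime_mult_set R P : subring R -> prime_ideal R P ->
  mult_set R (R `\` P).
Proof.
move=> [R1 RB RM] pP; split=> [a []//||[]|a b [Ra Pa] [Rb Pb]].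
- by split=> //; apply: prime_ideal1 pP.
- by case: pP => [[]].
- by split; [exact: RM|move=> /(prime_idealM pP Ra Rb)[]].
Qed.

(** An ideal maximal among those above [I] that avoid [S] is prime: if [a] and [b] were outside it,
    [S] would meet both ideals obtained by adjoining them, and the product of the two elements met
    would lie in the ideal as soon as [a * b] does. *)
Lemma prime_avoiding R S I : subring R -> noetherian R -> mult_set R S ->
  ideal R I -> (forall a, I a -> ~ S a) ->
  exists P, [/\ prime_ideal R P, I `<=` P & forall a, P a -> ~ S a].
Proof.
move=> sR nR [SR S1 S0 SM] iI IS.
have [|P [iP [IP PS] maxP]] := @noetherian_ideal_maximal K R
    (fun P => I `<=` P /\ forall a, P a -> ~ S a) nR; first by exists I => //; split.
exists P; split=> //; have [PR P0 PD PM] := iP; split; first split=> //.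
  by move=> /PS; apply.
split=> // a b Ra Rb Pab.
have meet c : R c -> ~ P c -> exists s r, [/\ S s, R r & P (s - r * c)].
  move=> Rc Pc; apply: contrapT => noS.
  have [iPc PPc Pcc] := adjoinP sR iP Rc.
  apply/Pc/(maxP _ iPc) => //; split=> [z /IP/PPc//|].
  move=> _ [p [r [Pp Rr ->]]] Ss; apply: noS; exists (p + r * c), r.
  by split=> //; rewrite addrK.
apply: contrapT => /not_orP[Pa Pb].
have [s [r [Ss Rr Psa]]] := meet _ Ra Pa.
have [s' [r' [Ss' Rr' Psb]]] := meet _ Rb Pb.
apply: (PS (s * s')); last exact: SM.
have -> : s * s' = s' * (s - r * a) + (r * a) * (s' - r' * b) +
    (r * r') * (a * b) by ring.
apply/PD; last by apply/PM => //; apply: subringM.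
by apply/PD; apply/PM; auto; apply: subringM.
Qed.

(** A maximal one among the annihilators of nonzero elements of [R / I] is prime: when [b * g] is
    outside [I], its annihilator contains that of [g] and so equals it. *)
Lemma associated_prime R I : subring R -> noetherian R -> ideal R I -> ~ I 1 ->
  exists g, [/\ R g, ~ I g & prime_ideal R [set a | R a /\ I (a * g)]].
Proof.
move=> sR nR iI I1; have [IR I0 ID IM] := iI; have [R1 RB RM] := sR.
have iann g : R g -> ideal R [set a | R a /\ I (a * g)].
  move=> Rg; split=> [a []//||a b [Ra Ia] [Rb Ib]|a b Ra [Rb Ib]] /=.
  - by rewrite mul0r; split=> //; apply: subring0.
  - by rewrite mulrDl; split; [exact: subringD|exact: ID].
  - by rewrite -mulrA; split; [exact: RM|exact: IM].
have [|P [_ [g [Rg Ig ->]] maxP]] := @noetherian_ideal_maximal K R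
    (fun P => exists g, [/\ R g, ~ I g & P = [set a | R a /\ I (a * g)]]) nR.
  by exists [set a | R a /\ I (a * 1)]; [exact: iann|exists 1].
exists g; split=> //; have [PR P0 PD PM] := iann _ Rg.
split; first by split=> //= -[_]; rewrite mul1r.
split=> // a b Ra Rb [_ Iabg].
case: (pselect (I (b * g))) => [Ibg|Ibg]; first by right.
left; have Rbg := RM _ _ Rb Rg.
apply: (maxP [set a | R a /\ I (a * (b * g))]); first exact: iann.
- by exists (b * g).
- by move=> c [Rc Icg]; split=> //; rewrite mulrCA; apply: IM.
- by split=> //; rewrite mulrA.
Qed.

(** ** Fractions *)

(** The localization of [M] at [S], realized inside [K]; modules without torsion need no quotient
    construction. *)
Definition frac S M : set K := [set a | exists2 s, S s & M (s * a)].

Lemma frac_sub R S M : mult_set R S -> M `<=` frac S M.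
Proof. by move=> [_ S1 _ _] a Ma; exists 1 => //; rewrite mul1r. Qed.

Lemma subring_frac R S : subring R -> mult_set R S -> subring (frac S R).
Proof.
move=> sR mS; have [SR S1 S0 SM] := mS; split.
- by apply: (frac_sub mS); case: sR.
- move=> a b [s Ss Rsa] [s' Ss' Rsb]; exists (s * s'); first exact: SM.
  have -> : s * s' * (a - b) = s' * (s * a) - s * (s' * b) by ring.
  by case: (sR) => _ RB RM; apply: RB; apply: RM; auto.
- move=> a b [s Ss Rsa] [s' Ss' Rsb]; exists (s * s'); first exact: SM.
  by rewrite mulrACA; apply: subringM.
Qed.

Lemma ideal_frac R S I : subring R -> mult_set R S -> ideal R I ->
  ideal (frac S R) (frac S I).
Proof.
move=> sR mS [IR I0 ID IM]; have [SR S1 S0 SM] := mS; split.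
- by move=> a [s Ss /IR Rsa]; exists s.
- by exists 1; rewrite ?mulr0.
- move=> a b [s Ss Rsa] [s' Ss' Rsb]; exists (s * s'); first exact: SM.
  have -> : s * s' * (a + b) = s' * (s * a) + s * (s' * b) by ring.
  by apply: ID; apply: IM; auto.
- move=> a b [s Ss Rsa] [s' Ss' Isb]; exists (s * s'); first exact: SM.
  by rewrite mulrACA; apply: IM.
Qed.

Lemma ideal_contract R R' I : R `<=` R' -> subring R -> ideal R' I ->
  ideal R (I `&` R).
Proof.
move=> RR' sR [IR I0 ID IM]; split=> [a []//||a b [Ia Ra] [Ib Rb]|].
- by split=> //; apply: subring0.
- by split; [exact: ID|exact: subringD].
- by move=> a b Ra [Ib Rb]; split; [apply: IM; auto|exact: subringM].
Qed.

Lemma frac_contract R S I : subring R -> mult_set R S -> ideal (frac S R) I ->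
  I = frac S (I `&` R).
Proof.
move=> sR mS [IR I0 ID IM]; have [SR S1 S0 SM] := mS.
apply/seteqP; split=> [a Ia|a [s Ss [Isa Rsa]]].
  have [s Ss Rsa] := IR _ Ia; exists s => //; split=> //.
  by apply: IM => //; apply/(frac_sub mS)/SR.
rewrite -(mulKf (mult_setN0 mS Ss) a); apply: IM => //.
by exists s => //; rewrite divff ?(mult_setN0 mS Ss) //; case: sR.
Qed.

Lemma noetherian_frac R S : subring R -> mult_set R S -> noetherian R ->
  noetherian (frac S R).
Proof.
move=> sR mS nR F [I0 FI0] iF.
have [||_ [I FI <-] maxI] := nR [set I `&` R | I in F].
- by exists (I0 `&` R), I0.
- by move=> _ [I /iF iI <-]; apply: ideal_contract iI => //; apply: (frac_sub mS).
exists I => // J FJ IJ.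
rewrite (frac_contract sR mS (iF _ FI)) (frac_contract sR mS (iF _ FJ)).
move=> a [s Ss Jsa]; exists s => //; apply: maxI Jsa; first by exists J.
by move=> b [/IJ Jb Rb].
Qed.

Lemma prime_contract R R' P : R `<=` R' -> subring R -> prime_ideal R' P ->
  prime_ideal R (P `&` R).
Proof.
move=> RR' sR pP; have iP := prime_ideal_ideal pP.
have [PR P0 PD PM] := ideal_contract RR' sR iP; split; first split=> //.
  by move=> [/(prime_ideal1 pP)].
split=> // a b Ra Rb [Pab _].
by case: (prime_idealM pP (RR' _ Ra) (RR' _ Rb) Pab); [left|right].
Qed.

Lemma prime_frac R S P : subring R -> mult_set R S -> prime_ideal R P ->
  (forall a, P a -> ~ S a) -> prime_ideal (frac S R) (frac S P).
Proof.
move=> sR mS pP PS; have [SR S1 S0 SM] := mS.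
have [PR P0 PD PM] := ideal_frac sR mS (prime_ideal_ideal pP).
split; first split=> //; first by move=> [s Ss]; rewrite mulr1 => /PS.
split=> // a b [s Ss Rsa] [s' Ss' Rsb] [u Su Puab].
have : P (u * ((s * a) * (s' * b))).
  have -> : u * (s * a * (s' * b)) = (s * s') * (u * (a * b)) by ring.
  by case: (prime_ideal_ideal pP) => _ _ _; apply=> //; apply: subringM; auto.
case/(prime_idealM pP (SR _ Su) (subringM sR Rsa Rsb)) => [/PS//|].
by case/(prime_idealM pP Rsa Rsb) => ?; [left; exists s|right; exists s'].
Qed.

Lemma frac_prime_sub R S P a : mult_set R S -> prime_ideal R P ->
  (forall a, P a -> ~ S a) -> R a -> frac S P a -> P a.
Proof.
move=> [SR _ _ _] pP PS Ra [s Ss Psa].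
by case: (prime_idealM pP (SR _ Ss) Ra Psa) => // /PS.
Qed.

Lemma nonunits_frac R P : subring R -> prime_ideal R P ->
  nonunits (frac (R `\` P) R) = frac (R `\` P) P.
Proof.
move=> sR pP; have mS := prime_mult_set sR pP; apply/seteqP; split; last first.
  by apply: prime_sub_nonunits; apply: prime_frac => // a Pa [].
move=> a [[s [Rs Ps] Rsa] Na]; exists s => //; apply: contrapT => Psa; apply: Na.
have s0 : s != 0 by apply: (mult_setN0 mS).
have sa0 : s * a != 0 by apply: (mult_setN0 mS).
have a0 : a != 0 by apply: contraNneq sa0 => ->; rewrite mulr0.
split=> //; first by exists s.
by exists (s * a) => //; rewrite mulfK.
Qed.

(** ** Nakayama's lemma *)

Definition local_ring R : Prop := subring R /\ ideal R (nonunits R).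

Lemma local_unit R a : R a -> ~ nonunits R a -> unit_in R a.
Proof. by move=> Ra ma; apply: contrapT => ua; apply: ma. Qed.

Lemma nonunits1 R : ~ nonunits R 1.
Proof. by move=> [R1]; apply; split; rewrite ?oner_eq0 ?invr1. Qed.

Lemma local_unitB R a : local_ring R -> nonunits R a -> unit_in R (1 - a).
Proof.
move=> [sR im] ma; have [mR _ mD _] := im; have [R1 RB _] := sR.
apply: local_unit; first by apply: RB => //; apply: mR.
by move=> m1a; apply: (@nonunits1 R); rewrite -(subrK a 1); apply: mD.
Qed.

Lemma local_max_prime R : local_ring R -> prime_ideal R (nonunits R).
Proof.
move=> [sR im]; have [mR m0 mD mM] := im; split; first split=> //.
  exact: nonunits1.
split=> // a b Ra Rb [Rab uab].
apply: contrapT => /not_orP[/(local_unit Ra)[_ a0 Rai]].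
move=> /(local_unit Rb)[_ b0 Rbi]; apply: uab; split=> //.
  by rewrite mulf_neq0.
by rewrite invfM; apply: subringM.
Qed.

Definition submodule R (E : lmodType K) (N : set E) : Prop :=
  [/\ N 0, forall u v, N u -> N v -> N (u + v)
    & forall a u, R a -> N u -> N (a *: u)].

Lemma submodule_sum R (E : lmodType K) (N : set E) (J : Type) (r : seq J)
    (Q : pred J) (c : J -> K) (f : J -> E) :
  submodule R N -> (forall i, Q i -> R (c i)) -> (forall i, Q i -> N (f i)) ->
  N (\sum_(i <- r | Q i) c i *: f i).
Proof.
move=> [N0 ND NZ] Rc Nf; elim/big_rec: _ => // i v Qi Nv.
by apply: ND => //; apply: NZ; auto.
Qed.

(** Elimination of the generators one at a time. *)
Lemma nakayama R (E : lmodType K) (N : set E) r (g : 'I_r -> E) :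
  local_ring R -> submodule R N ->
  (forall i, exists c : 'I_r -> K, (forall j, nonunits R (c j)) /\
     N (g i - \sum_j c j *: g j)) ->
  forall i, N (g i).
Proof.
move=> lR sN; have [sR im] := lR; have [mR m0 mD mM] := im.
have [N0 ND NZ] := sN.
elim: r g => [|r IHr] g Hg; first by case.
have [c [mc Nc]] := Hg ord_max; have [_ u0 Ru] := local_unitB lR (mc ord_max).
set w := widen_ord (leqnSn r); set u := (1 - c ord_max)^-1 in Ru.
have glast : N (g ord_max - \sum_j (u * c (w j)) *: g (w j)).
  have -> : g ord_max - \sum_j (u * c (w j)) *: g (w j) =
      u *: (g ord_max - \sum_j c j *: g j).
    have e : u *: g ord_max - (u * c ord_max) *: g ord_max = g ord_max.
      by rewrite -scalerBl -{1}(mulr1 u) -mulrBr mulVf // scale1r.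
    rewrite big_ord_recr /= scalerBr scalerDr scalerA opprD addrA addrAC e.
    by rewrite scaler_sumr; under [in RHS]eq_bigr do rewrite scalerA.
  exact: NZ.
have Hw i : N (g (w i)).
  apply: (IHr (fun i => g (w i))) => {}i; have [d [md Nd]] := Hg (w i).
  exists (fun j => d (w j) + d ord_max * (u * c (w j))); split=> [j|].
    by apply/mD => //; apply/mM; [exact: mR|apply/mM].
  have -> : g (w i) - \sum_j (d (w j) + d ord_max * (u * c (w j))) *: g (w j) =
      (g (w i) - \sum_j d j *: g j) +
      d ord_max *: (g ord_max - \sum_j (u * c (w j)) *: g (w j)).
    rewrite big_ord_recr /= scalerBr opprD addrA -!addrA; congr (_ + _).
    rewrite addKr -opprD; congr (- _); rewrite scaler_sumr -big_split.
    by apply: eq_bigr => j _; rewrite scalerDl scalerA.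
  by apply: ND => //; apply: NZ => //; apply: mR.
move=> i; case: (unliftP ord_max i) => [j ->|->].
  have <- : w j = lift ord_max j; last exact: Hw.
  by apply: val_inj; rewrite /= /bump leqNgt ltn_ord.
rewrite -(subrK (\sum_j (u * c (w j)) *: g (w j)) (g ord_max)).
apply: ND => //; apply: (submodule_sum _ sN) => // j _.
by apply: subringM => //; apply: mR.
Qed.

Lemma nakayama_ideal R I M x : local_ring R -> noetherian R -> ideal R I ->
  ideal R M -> nonunits R x ->
  (forall a, M a -> exists b c, [/\ I b, M c & a = b + x * c]) -> M `<=` I.
Proof.
move=> lR nR iI iM mx Mdec; have [sR im] := lR; have [mR m0 mD mM] := im.
have [r [g [Mg genM]]] := noetherian_fin_gen sR nR iM.
have sI : @submodule R K^o I by case: iI => IR I0 ID IM; split.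
suff Ig i : I (g i).
  move=> a /genM[c [Rc ->]]; apply: (ideal_sum _ iI) => i _.
  by case: iI => _ _ _; apply.
apply: (nakayama lR sI) => {}i; have [b [a [Ib /genM[c [Rc ea]] eg]]] := Mdec _ (Mg i).
exists (fun j => x * c j); split=> [j|].
  by rewrite mulrC; apply: mM.
suff -> : \sum_j (x * c j) *: (g j : K^o) = x * a by rewrite eg addrK.
by rewrite ea mulr_sumr; apply: eq_bigr => j _; rewrite mulrA.
Qed.

End LocalAlgebra.

(** * Krull's principal ideal theorem and regular local rings *)

Section Krull.
Variable K : fieldType.
Implicit Types (R P Q I J S M : set K) (x a b : K) (t : seq K).

(** [R / J] is Artinian when the maximal ideal is its only prime. For an ideal [L] maximal among the
    counterexamples, the associated prime of some [g] modulo [L] is the maximal ideal, so [L + (g)]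
    exceeds [L] by a simple module and already satisfies the chain condition. *)
Lemma descending_chain R J : local_ring R -> noetherian R -> ideal R J ->
  (forall P, prime_ideal R P -> J `<=` P -> nonunits R `<=` P) ->
  forall Q : nat -> set K, (forall n, ideal R (Q n)) -> (forall n, J `<=` Q n) ->
  (forall n, Q n.+1 `<=` Q n) -> exists n, forall i, (n <= i)%N -> Q n `<=` Q i.
Proof.
move=> lR nR iJ Jprime; have [sR im] := lR.
pose dcc L := forall Q : nat -> set K, (forall n, ideal R (Q n)) ->
  (forall n, L `<=` Q n) -> (forall n, Q n.+1 `<=` Q n) ->
  exists n, forall i, (n <= i)%N -> Q n `<=` Q i.
suff: dcc J by [].
apply: contrapT => NJ.
have [|L [iL [JL NL] maxL]] := @noetherian_ideal_maximal K R
    (fun L => J `<=` L /\ ~ dcc L) nR; first by exists J => //; split.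
have [LR L0 LD LM] := iL.
have L1 : ~ L 1.
  move=> L1; apply: NL => Q iQ LQ _; exists 0%N => i _ a Qa.
  have [QR _ _ _] := iQ 0%N; rewrite -(mulr1 a).
  by case: (iQ i) => _ _ _; apply; [apply: QR|apply: LQ].
have [g [Rg Lg pg]] := associated_prime sR nR iL L1.
have mg a : nonunits R a -> L (a * g).
  move=> ma; have [|//] := Jprime _ pg _ a ma.
  move=> b /JL Lb; split; first exact: LR.
  by rewrite mulrC; apply/LM.
have [iLg LLg Lgg] := adjoinP sR iL Rg.
have dccLg : dcc (adjoin R L g).
  apply: contrapT => NLg; apply: Lg; apply: (maxL _ iLg) => //.
  by split=> // a /JL/LLg.
apply: NL => Q iQ LQ Qdec.
have Qdecr n i : (n <= i)%N -> Q i `<=` Q n.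
  elim: i => [|i IHi]; first by rewrite leqn0 => /eqP->.
  by rewrite leq_eqVlt => /predU1P[->//|/IHi QQ] a /Qdec/QQ.
case: (pselect (forall n, Q n g)) => [Qg|/existsNP[n1 Qg]].
  by apply: dccLg => // n; apply: adjoin_sub.
(* Here [g] is outside [Q n1], and the ideals [Q n + (g)] stabilize. Past both indices, a unit
   coefficient of [g] would put [g] into [Q n1], while a nonunit coefficient carries [g] into [L],
   hence into [Q i]. *)
have [|n|n|n0 Hn0] := dccLg (fun n => adjoin R (Q n) g).
- by move=> n; case: (adjoinP sR (iQ n) Rg).
- have [iQg QQg Qgg] := adjoinP sR (iQ n) Rg.
  by apply: adjoin_sub => // a /LQ/QQg.
- have [iQg QQg Qgg] := adjoinP sR (iQ n) Rg.
  by apply: adjoin_sub => // a /Qdec/QQg.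
exists (maxn n0 n1) => i; rewrite geq_max => /andP[n0i n1i] a Qa.
have Q0a : Q n0 a by apply: Qdecr Qa; apply: leq_maxl.
have Q1a : Q n1 a by apply: Qdecr Qa; apply: leq_maxr.
have : adjoin R (Q n0) g a by apply: sub_adjoin.
case/(Hn0 _ n0i) => b [r [Qb Rr ea]]; rewrite ea.
case: (pselect (nonunits R r)) => [/mg Lrg|].
  by case: (iQ i) => _ _ QD _; apply/QD => //; apply: LQ.
case/(local_unit Rr) => _ r0 Rri; case: Qg.
have Q1b := Qdecr _ _ n1i _ Qb.
rewrite -(mulKf r0 g); case: (iQ n1) => _ _ _; apply=> //.
by rewrite -(addKr b (r * g)) -ea addrC; apply: (idealB sR).
Qed.

(** With [y] in [P1] but not in [P0], the ideals
    [P0 + (y^n)], localized at [P1], decrease, and stabilize modulo [x]; by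
    Nakayama's lemma they stabilize, so that [y] is a unit at [P1]. *)
Lemma principal_ideal_local R P0 P1 x : local_ring R -> noetherian R ->
  prime_ideal R P0 -> prime_ideal R P1 -> P0 `<` P1 -> P1 `<` nonunits R ->
  nonunits R x ->
  exists P, [/\ prime_ideal R P, P0 `<=` P, P x & P `<` nonunits R].
Proof.
move=> lR nR pP0 pP1 [P01 /nonsubset[y [P1y P0y]]] [P1m mP1] mx.
have [sR im] := lR; have [mR m0 mD mM] := im.
case: (pselect (P1 x)) => [P1x|P1x]; first by exists P1.
apply: contrapT => noP.
have [R1 RB RM] := sR.
have iP0 := prime_ideal_ideal pP0; have [P0R P00 P0D P0M] := iP0.
have iP1 := prime_ideal_ideal pP1; have [P1R P10 P1D P1M] := iP1.
have [iJ P0J Jx] := adjoinP sR iP0 (mR _ mx).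
have [S_R S1 S0 SM] := prime_mult_set sR pP1.
pose Q n : set K := [set a | R a /\ exists b c, [/\ R b, ~ P1 b, R c
                                              & P0 (b * a - c * y ^+ n)]].
have Ry := P1R _ P1y.
have iQ n : ideal R (Q n).
  split=> [a []//||a a' [Ra [b [c [Rb Pb Rc H]]]] [Ra' [b' [c' [Rb' Pb' Rc' H']]]]|].
  - split; first exact: subring0.
    by exists 1, 0; rewrite mulr0 mul0r subr0; split=> //;
      [exact: prime_ideal1 pP1|exact: subring0].
  - split; first exact: subringD.
    have [Rbb Pbb] := SM b b' (conj Rb Pb) (conj Rb' Pb').
    exists (b * b'), (b' * c + b * c'); split=> //.
      by apply: subringD => //; apply/RM.
    have -> : b * b' * (a + a') - (b' * c + b * c') * y ^+ n =
      b' * (b * a - c * y ^+ n) + b * (b' * a' - c' * y ^+ n) by ring.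
    by apply/P0D; apply/P0M.
  - move=> r a Rr [Ra [b [c [Rb Pb Rc H]]]]; split; first exact: RM.
    exists b, (r * c); split=> //; first exact: RM.
    have -> : b * (r * a) - r * c * y ^+ n = r * (b * a - c * y ^+ n) by ring.
    exact: P0M.
have P0Q n : P0 `<=` Q n.
  move=> a P0a; split; first exact: P0R.
  by exists 1, 0; rewrite mul0r subr0 mul1r; split=> //;
      [exact: prime_ideal1 pP1|exact: subring0].
have Qdec n : Q n.+1 `<=` Q n.
  move=> a [Ra [b [c [Rb Pb Rc H]]]]; split=> //; exists b, (c * y).
  by rewrite -mulrA -exprS; split=> //; apply/RM.
have [|n|n|n|n Hn] := descending_chain lR nR iJ _ (Q := fun n => adjoin R (Q n) x).
- move=> P pP JP; apply: contrapT => mP; apply: noP; exists P; split=> //.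
  + by move=> a /P0J/JP.
  + exact: JP.
  + by split=> //; apply: prime_sub_nonunits pP.
- by case: (adjoinP sR (iQ n) (mR _ mx)).
- have [iQx QQx Qxx] := adjoinP sR (iQ n) (mR _ mx).
  by apply: adjoin_sub => // a /P0Q/QQx.
- have [iQx QQx Qxx] := adjoinP sR (iQ n) (mR _ mx).
  by apply: adjoin_sub => // a /Qdec/QQx.
(* Since [x] is a unit at [P1], [r * x] in [Q n] forces [r] in [Q n]; so [Q n] is contained in
   [Q n.+1 + x Q n], and Nakayama's lemma applies. *)
have /(_ (y ^+ n)) : Q n `<=` Q n.+1.
  apply: (nakayama_ideal lR nR (iQ _) (iQ _) mx) => a Qa.
  have : adjoin R (Q n) x a by apply: sub_adjoin.
  case/(Hn _ (leqnSn n)) => b [r [Qb Rr ea]].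
  exists b, r; split=> //; last by rewrite mulrC.
  have [_ [c [d [Rc Pc Rd H]]]] : Q n (r * x).
    by rewrite -(addKr b (r * x)) -ea addrC; apply: (idealB sR) => //; apply: Qdec.
  have [Rcx Pcx] := SM c x (conj Rc Pc) (conj (mR _ mx) P1x).
  split=> //; exists (c * x), d; split=> //.
  by rewrite -mulrA (mulrC x).
have Qy : Q n (y ^+ n).
  split; first exact: subringX.
  by exists 1, 1; rewrite mul1r subrr; split=> //; apply: prime_ideal1 pP1.
case/(_ Qy) => _ [b [c [Rb Pb Rc]]].
rewrite exprS mulrA -mulrBl => H.
have P0X i : P0 (y ^+ i) -> False.
  elim: i => [|i IHi]; first by rewrite expr0; apply: prime_ideal1 pP0.
  by rewrite exprS => /(prime_idealM pP0 Ry (subringX i sR Ry))[].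
case: (prime_idealM pP0 _ _ H); first by apply/RB/RM.
- exact: subringX.
- move=> /P01 Pbcy; apply: Pb; rewrite -(subrK (c * y) b).
  by apply/P1D => //; apply/P1M.
- exact: P0X.
Qed.

Lemma proper_frac R S P Q : mult_set R S -> prime_ideal R P -> prime_ideal R Q ->
  (forall a, P a -> ~ S a) -> P `<` Q -> frac S P `<` frac S Q.
Proof.
move=> mS pP pQ PS [PQ /nonsubset[a [Qa Pa]]]; split.
  by move=> b [s Ss /PQ Qsb]; exists s.
move=> /(_ a (frac_sub mS Qa)) /(frac_prime_sub mS pP PS) H; apply/Pa/H.
by case: pQ => [[QR _ _] _]; apply: QR.
Qed.

Lemma principal_ideal R P0 P1 P2 x : subring R -> noetherian R ->
  prime_ideal R P0 -> prime_ideal R P1 -> prime_ideal R P2 ->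
  P0 `<` P1 -> P1 `<` P2 -> P2 x ->
  exists P, [/\ prime_ideal R P, P0 `<=` P, P x & P `<` P2].
Proof.
move=> sR nR pP0 pP1 pP2 P01 P12 P2x; have mS := prime_mult_set sR pP2.
set S := R `\` P2 in mS; have sub P : P `<=` P2 -> forall a, P a -> ~ S a.
  by move=> PP2 a /PP2 P2a [].
have P0P2 : P0 `<=` P2 by move=> a /P01.1/P12.1.
have mE := nonunits_frac sR pP2.
have lF : local_ring (frac S R).
  split; first exact: subring_frac.
  by rewrite mE; apply: (ideal_frac sR mS); apply: prime_ideal_ideal.
have [|||||P [pP FP0P Px [PF /nonsubset[z [Fz Pz]]]]] := @principal_ideal_local
    (frac S R) (frac S P0) (frac S P1) x lF (noetherian_frac sR mS nR).
- by apply: prime_frac => //; apply: sub.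
- by apply: prime_frac => //; apply: sub => a /P12.1.
- by apply: proper_frac pP0 pP1 _ _ => //; apply: sub.
- by rewrite mE; apply: proper_frac pP1 pP2 _ _ => //; apply: sub => a /P12.1.
- by rewrite mE; apply: (frac_sub mS).
have PS a : P a -> ~ S a.
  move=> Pa Sa; have [SR _ _ _] := mS; apply: (prime_ideal_unit pP Pa); split.
  - by apply: (frac_sub mS); apply: SR.
  - exact: (mult_setN0 mS Sa).
  - by exists a => //; rewrite divff ?(mult_setN0 mS Sa) //; case: sR.
have P2R : P2 `<=` R by case: pP2 => [[]].
exists (P `&` R); split.
- by apply: (prime_contract _ sR pP); apply: (frac_sub mS).
- move=> a P0a; split; first by apply/FP0P/(frac_sub mS).
  by case: pP0 => [[P0R _ _] _]; apply: P0R.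
- by split=> //; apply: P2R.
- split; first by move=> a [Pa Ra]; apply: contrapT => P2a; apply: (PS a).
  move: Fz; rewrite mE => -[s Ss P2sz] /(_ _ P2sz)[Psz _].
  apply: Pz; have [SR _ _ _] := mS.
  rewrite -(mulKf (mult_setN0 mS Ss) z).
  case: (prime_ideal_ideal pP) => _ _ _; apply=> //.
  by exists s => //; rewrite divff ?(mult_setN0 mS Ss) //; case: sR.
Qed.

(** ** Heights *)

(** A chain of primes of length [d] upwards from [P]. Recursion from the bottom suits the arguments
    below, which replace the lowest member of a chain. *)
Fixpoint primes_above R (d : nat) P : Prop :=
  prime_ideal R P /\
  if d is d'.+1 then exists2 Q, P `<` Q & primes_above R d' Q else True.

Lemma primes_above_prime R d P : primes_above R d P -> prime_ideal R P.
Proof. by case: d => [|d] []. Qed.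

Lemma prime_chain_above R d : prime_chain R d -> exists P, primes_above R d P.
Proof.
case=> P [pP Plt]; exists (P 0%N).
elim: d P pP Plt => [|d IHd] P pP Plt; split=> //; try exact: pP.
exists (P 1%N); first exact: Plt.
by apply: (IHd (fun i => P i.+1)) => i ltid; [apply: pP|apply: Plt].
Qed.

Lemma primes_above_chain R d P : primes_above R d P -> prime_chain R d.
Proof.
suff: primes_above R d P -> exists Q : nat -> set K, Q 0%N = P /\
    (forall i, (i <= d)%N -> prime_ideal R (Q i)) /\
    (forall i, (i < d)%N -> Q i `<` Q i.+1).
  by move=> H /H[Q [_ ?]]; exists Q.
elim: d P => [|d IHd] P [pP]; first by exists (fun=> P).
case=> P' PP' /IHd[Q [Q0 [pQ Qlt]]]; exists (fun i => if i is j.+1 then Q j else P).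
split=> //; split=> -[|i] //; [exact: pQ|by rewrite Q0|exact: Qlt].
Qed.

Lemma primes_above_le R d e P : (d <= e)%N -> primes_above R e P ->
  primes_above R d P.
Proof.
elim: d e P => [|d IHd] [|e] P //= le_de [pP]; first by [].
by case=> Q PQ /(IHd e _ le_de) H; split=> //; exists Q.
Qed.

(** Passing to [R / (x)] costs at most one step of a chain: from the top downwards, the principal
    ideal theorem exchanges each intermediate prime for one that contains [x]. *)
Lemma primes_above_adjoin R x d P : local_ring R -> noetherian R ->
  nonunits R x -> primes_above R d.+1 P ->
  exists Q, [/\ P `<=` Q, Q x & primes_above R d Q].
Proof.
move=> lR nR mx; have [sR _] := lR.
elim: d P => [|d IHd] P [pP [P1 PP1 cP1]].
  exists (nonunits R); split=> //; last by split=> //; apply: local_max_prime.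
  exact: prime_sub_nonunits pP.
case: (pselect (P1 x)) => [P1x|P1x]; first by exists P1; split=> //; case: PP1.
have [P2 [P12 P2x cP2]] := IHd _ cP1.
have P12' : P1 `<` P2 by split=> // P21; apply/P1x/P21.
have [P' [pP' PP' P'x P'2]] := principal_ideal sR nR pP
  cP1.1 (primes_above_prime cP2) PP1 P12' P2x.
by exists P'; split=> //; split=> //; exists P2.
Qed.

Definition adjoin_seq R I t : set K := foldl (adjoin R) I t.

(** Krull's height theorem for the maximal ideal of [R / I]: each generator uses up one step of the
    chain. *)
Lemma height_bound R I t : local_ring R -> noetherian R -> ideal R I ->
  (forall x, x \in t -> nonunits R x) -> nonunits R `<=` adjoin_seq R I t ->
  forall P, I `<=` P -> ~ primes_above R (size t).+1 P.
Proof.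
move=> lR nR; have [sR im] := lR; have [mR m0 mD mM] := im.
elim: t I => [|x t IHt] I iI mt mI P IP.
  move=> [pP [Q [PQ QP]]] [/prime_sub_nonunits Qm _]; apply: QP => a /Qm/mI.
  exact: IP.
have mx : nonunits R x by apply: mt; rewrite mem_head.
have [iIx IIx Ixx] := adjoinP sR iI (mR _ mx).
case/(primes_above_adjoin lR nR mx) => Q [PQ Qx cQ].
apply: (IHt _ iIx _ mI Q _ cQ).
  by move=> y ty; apply: mt; rewrite inE ty orbT.
have iQ := prime_ideal_ideal (primes_above_prime cQ).
by apply: (adjoin_sub iQ) => // a /IP/PQ.
Qed.

Fixpoint regular_seq R I t : Prop :=
  if t is x :: t' then (forall a, R a -> I (x * a) -> I a) /\
    regular_seq R (adjoin R I x) t' else True.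

(** If [R / I] has dimension at least [size t] and its maximal ideal is
    generated by [t], then [I] is prime. *)
Lemma regular_seq_prime R I t : local_ring R -> noetherian R -> ideal R I ->
  (forall x, x \in t -> nonunits R x) -> nonunits R `<=` adjoin_seq R I t ->
  forall P, I `<=` P -> primes_above R (size t) P ->
  P `<=` I /\ regular_seq R I t.
Proof.
move=> lR nR; have [sR im] := lR; have [mR m0 mD mM] := im.
elim: t I => [|x t IHt] I iI mt mI P IP cP.
  by split=> // a; case: cP => /prime_sub_nonunits Pm _ /Pm/mI.
have mx : nonunits R x by apply: mt; rewrite mem_head.
have mt' y : y \in t -> nonunits R y by move=> ty; apply: mt; rewrite inE ty orbT.
have [iIx IIx Ixx] := adjoinP sR iI (mR _ mx).
have pP := primes_above_prime cP; have iP := prime_ideal_ideal pP.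
(* If [x] were in [P], the chain above [P] would be one step too long for the ideal [I + (x)]. *)
have Px : ~ P x.
  move=> Px; apply: (height_bound lR nR iIx mt' mI _ cP).
  exact: adjoin_sub.
have [Q [PQ Qx cQ]] := primes_above_adjoin lR nR mx cP.
have [|QI rt] := IHt _ iIx mt' mI Q _ cQ.
  have iQ := prime_ideal_ideal (primes_above_prime cQ).
  by apply: (adjoin_sub iQ) => // a /IP/PQ.
(* By induction [P] is inside [I + (x)]; as [x] is not in the prime [P], the multiple of [x] has its
   coefficient in [P]. Thus [P] is contained in [I + x P]. *)
have PI : P `<=` I.
  apply: (nakayama_ideal lR nR iI iP mx) => a Pa.
  have [b [r [Ib Rr ea]]] := QI _ (PQ _ Pa).
  exists b, r; split=> //; last by rewrite mulrC.
  have : P (r * x).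
    by rewrite -(addKr b (r * x)) -ea addrC; apply: (idealB sR iP) => //; apply: IP.
  by case/(prime_idealM pP Rr (mR _ mx)).
split=> //; split=> // a Ra /IP/(prime_idealM pP (mR _ mx) Ra)[//|].
exact: PI.
Qed.

Lemma adjoin_seq_sum R I m (g : 'I_m -> K) : subring R -> ideal R I ->
  (forall i, R (g i)) -> forall c : 'I_m -> K, (forall i, R (c i)) ->
  adjoin_seq R I [seq g i | i <- enum 'I_m] (\sum_i c i * g i).
Proof.
move=> sR iI Rg c Rc; have aux s a J : ideal R J -> J a ->
    adjoin_seq R J [seq g i | i <- s] (a + \sum_(i <- s) c i * g i).
  elim: s a J => [|i s IHs] a J iJ Ja; first by rewrite big_nil addr0.
  have [iJg _ _] := adjoinP sR iJ (Rg i).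
  by rewrite big_cons addrA; apply: IHs => //; exists a, (c i).
have -> : \sum_i c i * g i = 0 + \sum_(i <- enum 'I_m) c i * g i.
  by rewrite add0r big_enum.
by apply: aux => //; case: iI.
Qed.

Lemma regular_local_seq R : local_ring R -> noetherian R -> regular_local R ->
  forall e, prime_chain R e ->
  exists t, [/\ (e <= size t)%N, forall x, x \in t -> nonunits R x
               & regular_seq R [set 0] t].
Proof.
move=> lR nR [d [[chd nchd] [g [mg gen]]]] e che.
have [sR im] := lR; have [mR m0 mD mM] := im.
have i0 : ideal R [set 0].
  split=> [_ ->||_ _ -> ->|a _ _ ->] //; first exact: subring0.
    by rewrite addr0.
  by rewrite mulr0.
exists [seq g i | i <- enum 'I_d]; rewrite size_map size_enum_ord; split.
- have [P cP] := prime_chain_above che.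
  rewrite leqNgt; apply/negP => lt_de; apply: nchd.
  exact: primes_above_chain (primes_above_le lt_de cP).
- by move=> x /mapP[i _ ->].
- have [P cP] := prime_chain_above chd.
  have [||||_ //] := @regular_seq_prime R [set 0]
    [seq g i | i <- enum 'I_d] lR nR i0 _ _ P.
  + by move=> x /mapP[i _ ->].
  + move=> a /gen[c [Rc ->]]; apply: adjoin_seq_sum => // i.
    exact: mR.
  + by move=> _ ->; case: (primes_above_prime cP) => [[]].
  + by rewrite size_map size_enum_ord.
Qed.

End Krull.

(** * The Nullstellensatz *)

Section ClassicalDomain.
Variable T : comNzRingType.

Definition integral : Prop := forall x y : T, x * y = 0 -> (x == 0) || (y == 0).

Hypothesis T_integral : integral.

(** A copy of [T] that carries the hypothesis as a parameter, so that a domain structure with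
    classically selected inverses can be attached to it. *)
Definition classical_domain of integral : Type := T.
Notation D := (classical_domain T_integral).

HB.instance Definition _ := GRing.ComNzRing.on D.

Let unitD : {pred D} := fun x => `[< exists y : D, y * x = 1 >].
Let invD (x : D) : D :=
  if pselect (exists y : D, y * x = 1) is left H then sval (cid H) else x.

Let mulVD : {in unitD, left_inverse 1 invD *%R}.
Proof.
move=> x /asboolP H; rewrite /invD; case: pselect => // H'.
by case: (cid H').
Qed.

Let unitDP (x y : D) : y * x = 1 -> unitD x.
Proof. by move=> H; apply/asboolP; exists y. Qed.

Let invD_out : {in [predC unitD], invD =1 id}.
Proof. by move=> x /asboolP H; rewrite /invD; case: pselect. Qed.

HB.instance Definition _ :=
  GRing.ComNzRing_hasMulInverse.Build D mulVD unitDP invD_out.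
HB.instance Definition _ := GRing.ComUnitRing_isIntegral.Build D T_integral.

Lemma classical_domainP : exists (R : idomainType) (f : {rmorphism T -> R}),
  bijective f.
Proof.
have fB : zmod_morphism (fun x : T => x : D) by [].
have fM : monoid_morphism (fun x : T => x : D) by [].
pose f : {rmorphism T -> D} := HB.pack (fun x : T => x : D)
  (GRing.isZmodMorphism.Build T D _ fB) (GRing.isMonoidMorphism.Build T D _ fM).
by exists D, f; exists id.
Qed.

End ClassicalDomain.

Section PrimeQuotient.
Local Open Scope quotient_scope.
Variables (T : comNzRingType) (P : set T).

Definition prime_set : Prop :=
  [/\ P 0, ~ P 1, forall a b, P a -> P b -> P (a + b),
      forall a b, P b -> P (a * b)
    & forall a b, P (a * b) -> P a \/ P b].

Hypothesis primeP : prime_set.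

Definition prime_pred of prime_set : {pred T} := fun x => `[< P x >].
Notation I := (prime_pred primeP).

Let I_idealr : idealr_closed I.
Proof.
have [P0 P1 PD PM _] := primeP; split; [exact/asboolP|exact/asboolP|].
by move=> a u v /asboolP Pu /asboolP Pv; apply/asboolP/PD => //; apply: PM.
Qed.

Let I_prime : prime_idealr_closed I.
Proof.
have [_ _ _ _ PM] := primeP; move=> u v /asboolP/PM[]H; apply/orP.
  by left; apply/asboolP.
by right; apply/asboolP.
Qed.

HB.instance Definition _ := isIdealr.Build T I I_idealr.
HB.instance Definition _ := isPrimeIdealrClosed.Build T I I_prime.

Lemma prime_quotient : exists (D : idomainType) (f : {rmorphism T -> D}),
  (forall a, f a = 0 <-> P a) /\ (forall d, exists a, f a = d).
Proof.
have [D [g gbij]] := @classical_domainP {ideal_quot I}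
  (@Quotient.rquot_IdomainAxiom T I).
have g0 a : g a = 0 <-> a = 0.
  by split=> [|->]; rewrite ?rmorph0 // -(rmorph0 g) => /(bij_inj gbij).
pose f : {rmorphism T -> D} := g \o (\pi_{ideal_quot I} : {rmorphism T -> _}).
exists D, f; split=> [a|d].
  rewrite /f /= g0; split=> [/eqP|Pa].
    rewrite -(rmorph0 (\pi_{ideal_quot I})) -Quotient.idealrBE subr0.
    by move/asboolP.
  apply/eqP; rewrite -(rmorph0 (\pi_{ideal_quot I})) -Quotient.idealrBE subr0.
  exact/asboolP.
by have [h _ gK] := gbij; exists (repr (h d)); rewrite /f /= reprK gK.
Qed.

End PrimeQuotient.

Lemma quotient_morphism (T D S : comNzRingType) (f : {rmorphism T -> D})
    (g : {rmorphism T -> S}) :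
  (forall d, exists a, f a = d) -> (forall a, f a = 0 -> g a = 0) ->
  exists h : {rmorphism D -> S}, forall a, h (f a) = g a.
Proof.
move=> fsurj fg; pose h d := g (sval (cid (fsurj d))).
have hE a : h (f a) = g a.
  rewrite /h; case: cid => b /= fb; apply/eqP; rewrite -subr_eq0 -rmorphB.
  by rewrite fg // rmorphB fb subrr.
have hB : zmod_morphism h.
  move=> x y; have [[a <-] [b <-]] := (fsurj x, fsurj y).
  by rewrite -rmorphB !hE rmorphB.
have hM : monoid_morphism h.
  split=> [|x y]; first by rewrite -(rmorph1 f) hE rmorph1.
  have [[a <-] [b <-]] := (fsurj x, fsurj y).
  by rewrite -rmorphM !hE rmorphM.
pose h' : {rmorphism D -> S} := HB.pack h
  (GRing.isZmodMorphism.Build D S h hB) (GRing.isMonoidMorphism.Build D S h hM).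
by exists h'.
Qed.

Section Nullstellensatz.
Variable k : closedFieldType.

(** Asking that the point avoid the zeros of a given [s] outside [P] is what lets the property pass
    to polynomial rings: the element [r] of [prime_poly_point] must not vanish at the point of the
    base. *)
Definition nullstellensatz (T : comNzRingType) (kappa : {rmorphism k -> T}) :=
  forall P s, prime_set P -> ~ P s -> exists f : {rmorphism T -> k},
    [/\ forall c, f (kappa c) = c, forall a, P a -> f a = 0 & f s != 0].

Lemma nullstellensatz_base : nullstellensatz (idfun : {rmorphism k -> k}).
Proof.
move=> P s [P0 P1 PD PM _] Ps; exists idfun; split=> // [a Pa|] /=.
  apply/eqP/negPn/negP => a0; apply: P1.
  by rewrite -(mulVf a0); apply: PM.
by apply: contra_notN Ps => /eqP->.
Qed.

(** A prime [P] of [D[X]] meeting [D] only in [0] is [0] or generated up to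
    denominators by an element [f] of minimal degree. *)
Lemma prime_poly_point (D : idomainType) (P : set {poly D}) (s : {poly D}) :
  prime_set P -> (forall c, P c%:P -> c = 0) -> ~ P s ->
  exists2 r : D, r != 0 & forall g : {rmorphism D -> k}, g r != 0 ->
    exists xi : k, (forall p, P p -> (map_poly g p).[xi] = 0) /\
      (map_poly g s).[xi] != 0.
Proof.
move=> [P0 P1 PD PM Pprime] Pconst Ps.
have PZ c p : P p -> P (c *: p) by rewrite -mul_polyC; apply: PM.
have PN p : P p -> P (- p) by rewrite -mulN1r; apply: PM.
have PZinv c p : c != 0 -> P (c *: p) -> P p.
  rewrite -mul_polyC => c0 /Pprime[/Pconst ec|//].
  by rewrite ec eqxx in c0.
case: (pselect (exists2 f, P f & f != 0)) => [exf|noP]; last first.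
  have s0 : s != 0 by apply: contra_notN Ps => /eqP->.
  exists (lead_coef s); first by rewrite lead_coef_eq0.
  move=> g gs0; have : map_poly g s != 0.
    apply: contraNneq gs0 => gs; rewrite lead_coefE -coef_map gs coef0 //.
  move=> /closed_nonrootP[xi Hxi]; exists xi; split=> // p Pp.
  suff -> : p = 0 by rewrite rmorph0 horner0.
  by apply/eqP/negPn/negP => p0; apply: noP; exists p.
have [f [Pf f0] minf] : exists2 f, P f /\ f != 0 &
    forall p, P p -> (size p < size f)%N -> p = 0.
  have : exists n, `[< exists2 f, P f /\ f != 0 & size f = n >].
    by case: exf => f Pf f0; exists (size f); apply/asboolP; exists f.
  case/ex_minnP => n /asboolP[f Pf sf] minn; exists f => // p Pp sp.
  apply/eqP/negPn/negP => p0; move: sp; rewrite ltnNge sf => /negP; apply.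
  by apply: minn; apply/asboolP; exists p.
have sf : (1 < size f)%N.
  rewrite ltnNge; apply/negP => /size1_polyC ef; move: Pf f0; rewrite ef.
  by move=> /Pconst->; rewrite eqxx.
(* Were the gcd of [f] and [s] not constant, primality would put it or its cofactor in [f] into [P].
   The first gives [s] in [P], the second contradicts the minimal degree of [f]. *)
have [c [u [v [c0 ec]]]] : exists c u v, c != 0 /\ u * f + v * s = c%:P.
  have h0 : gcdp f s != 0 by rewrite gcdp_eq0 (negPf f0).
  have [[u v] /= /eqpP[[c1 c2] /= /andP[c10 c20] ec]] := Bezoutp f s.
  have [sh|sh] := leqP (size (gcdp f s)) 1.
    have eh := size1_polyC sh; exists (c2 * (gcdp f s)`_0), (c1 *: u), (c1 *: v).
    split; last by rewrite -!scalerAl -scalerDr ec eh coefC eqxx scale_polyC.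
    by rewrite mulf_neq0 //; apply: contraNneq h0 => e0; rewrite eh e0.
  have [[c q] /= c0 ef] := Pdiv.Idomain.dvdpP _ _ (dvdp_gcdl f s).
  have q0 : q != 0.
    apply: contraNneq f0 => q0; move: ef; rewrite q0 mul0r => /eqP.
    by rewrite -mul_polyC mulf_eq0 polyC_eq0 (negPf c0).
  have : P (q * gcdp f s) by rewrite -ef; apply: PZ.
  case/Pprime => [Pq|Ph].
    case/eqP: (q0); apply: (minf _ Pq).
    by rewrite -(size_scale f c0) ef (size_mul q0 h0); move: sh; lia.
  have [[c' q'] /= c'0 es] := Pdiv.Idomain.dvdpP _ _ (dvdp_gcdr f s).
  by case: Ps; apply: (PZinv _ _ c'0); rewrite es; apply: PM.
(* The leading coefficient keeps the image of [f] nonconstant, so that it has a root, and permits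
   pseudo-division by [f]; the factor [c] keeps [s] from vanishing at that root. *)
exists (c * lead_coef f); first by rewrite mulf_neq0 ?lead_coef_eq0.
move=> g; rewrite rmorphM mulf_eq0 negb_or => /andP[gc gf].
have : size (map_poly g f) != 1.
  by rewrite size_map_poly_id0 // neq_ltn sf orbT.
case/closed_rootP => xi /rootP Hxi; exists xi.
have gP p : P p -> (map_poly g p).[xi] = 0.
  move=> Pp; have Ediv := Pdiv.Idomain.divp_eq p f.
  have rem0 : p %% f = 0.
    apply: minf; last by rewrite Pdiv.Idomain.ltn_modp.
    have -> : p %% f = lead_coef f ^+ scalp p f *: p + - (p %/ f * f).
      by rewrite Ediv addrAC subrr add0r.
    by apply/PD; [apply: PZ|apply/PN/PM].
  move/(congr1 (fun p => (map_poly g p).[xi])): Ediv.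
  rewrite rem0 addr0 map_polyZ rmorphM hornerZ hornerM Hxi mulr0 rmorphXn.
  by move/eqP; rewrite mulf_eq0 expf_eq0 (negPf gf) andbF => /eqP.
split=> //; apply: contraNneq gc => gs.
move/(congr1 (fun p => (map_poly g p).[xi])): ec.
rewrite rmorphD !rmorphM /= !hornerE Hxi gs !mulr0 addr0 map_polyC hornerC.
by move=> <-.
Qed.

(** Modulo the contraction [p] of [P], the prime meets the constants only in zero. A point of [T]
    that contains [p] and avoids [r] is then lifted along a suitable value [xi] of the variable. *)
Lemma nullstellensatz_poly (T : comNzRingType) (kappa : {rmorphism k -> T}) :
  nullstellensatz kappa ->
  nullstellensatz (polyC \o kappa : {rmorphism k -> {poly T}}).
Proof.
move=> nullT P s pP Ps; have [P0 P1 PD PM Pprime] := pP.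
pose p : set T := [set c | P c%:P].
have pp : prime_set p.
  split; rewrite /p /= ?rmorph0 ?rmorph1 //.
  - by move=> a b Pa Pb; rewrite rmorphD; apply: PD.
  - by move=> a b Pb; rewrite rmorphM; apply: PM.
  - by move=> a b; rewrite rmorphM; apply: Pprime.
have [D [f [f0 fsurj]]] := prime_quotient pp.
have coefP (h : {poly T}) : (forall i, p h`_i) -> P h.
  move=> ph; rewrite -(coefK h) poly_def.
  elim/big_rec: _ => // i x _ Px; apply: PD => //.
  by rewrite -mul_polyC mulrC; apply/PM/ph.
have Peq (g h : {poly T}) : map_poly f g = map_poly f h -> P h -> P g.
  move=> eqgh Ph; rewrite -(subrK h g); apply: PD => //; apply: coefP => i.
  apply/f0; have := congr1 (fun q : {poly D} => q`_i) eqgh.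
  by rewrite !coef_map coefB rmorphB => /= ->; rewrite subrr.
have lift (g : {poly D}) : exists h : {poly T}, map_poly f h = g.
  exists (\poly_(i < size g) sval (cid (fsurj g`_i))).
  apply/polyP => i; rewrite coef_map coef_poly; case: ltnP => hi.
    by case: cid.
  by rewrite nth_default //; apply: rmorph0.
have [|||r r0 Hr] := @prime_poly_point D [set map_poly f g | g in P] (map_poly f s).
- split.
  + by exists 0; rewrite ?rmorph0.
  + move=> [g Pg fg]; apply/P1/(Peq _ g) => //; by rewrite fg rmorph1.
  + by move=> _ _ [g Pg <-] [h Ph <-]; exists (g + h); rewrite ?rmorphD //; apply: PD.
  + move=> a _ [g Pg <-]; have [b <-] := lift a.
    by exists (b * g); rewrite ?rmorphM //; apply: PM.
  + move=> a b; have [[a' <-] [b' <-]] := (lift a, lift b).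
    case=> g Pg; rewrite -rmorphM => /esym/Peq/(_ Pg)/Pprime[]H; [left|right].
      by exists a'.
    by exists b'.
- move=> d; have [c <-] := fsurj d; case=> g Pg; rewrite -map_polyC.
  by move=> /esym/Peq/(_ Pg)/f0.
- by case=> g Pg /esym/Peq/(_ Pg).
have [r' er] := fsurj r.
have [|phi [phik phip phir]] := nullT p r' pp.
  by move=> /f0; rewrite er => e0; rewrite e0 eqxx in r0.
have [phi' Ephi] := quotient_morphism fsurj (fun a fa => phip a ((f0 a).1 fa)).
have [|xi [xiP xis]] := Hr phi'; first by rewrite -er Ephi.
have Emap g : map_poly phi' (map_poly f g) = map_poly phi g.
  by apply/polyP => i; rewrite !coef_map; apply: Ephi.
exists (horner_eval xi \o map_poly phi : {rmorphism {poly T} -> k}).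
split=> [c|a Pa|] /=; rewrite /horner_eval.
- by rewrite map_polyC hornerC; apply: phik.
- by rewrite -Emap xiP //; exists a.
- by rewrite -Emap.
Qed.

(** [T] is a polynomial ring with one variable per generator, built by iterating [{poly _}]; both
    properties of [T] survive each adjunction. *)
Lemma fin_gen_algebra_image (K : fieldType) (iota : {rmorphism k -> K})
    (A : set K) : fin_gen_algebra iota A ->
  exists (T : comNzRingType) (kappa : {rmorphism k -> T})
         (f : {rmorphism T -> K}),
    [/\ noetherian [set: T], nullstellensatz kappa,
        forall c, f (kappa c) = iota c & range f = A].
Proof.
case=> m [a [[Ak AB AM] aA minA]].
have A0 : A 0 by rewrite -(rmorph0 iota).
have AD x y : A x -> A y -> A (x + y).
  by move=> Ax Ay; rewrite -(opprK y); apply/AB => //; rewrite -sub0r; apply/AB.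
suff [T [kappa [f [nT nullT fk fA fa]]]] : exists (T : comNzRingType)
    (kappa : {rmorphism k -> T}) (f : {rmorphism T -> K}),
    [/\ noetherian [set: T], nullstellensatz kappa,
        forall c, f (kappa c) = iota c, range f `<=` A
      & forall x, x \in [seq a i | i <- enum 'I_m] -> range f x].
  exists T, kappa, f; split=> //; apply/seteqP; split=> //; apply: minA.
    split=> [c|_ _ [x _ <-] [y _ <-]|_ _ [x _ <-] [y _ <-]].
    - by exists (kappa c).
    - by exists (x - y); rewrite ?rmorphB.
    - by exists (x * y); rewrite ?rmorphM.
  by move=> _ [i _ <-]; apply: fa; rewrite map_f ?mem_enum.
elim: (enum 'I_m) => [|i s [T [kappa [f [nT nullT fk fA fa]]]]].
  exists k, idfun, iota; split=> //; first exact: noetherian_field.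
    exact: nullstellensatz_base.
  by move=> _ [c _ <-].
have fcomm : commr_rmorph f (a i) by move=> x; apply: mulrC.
exists {poly T}, (polyC \o kappa : {rmorphism k -> {poly T}}), (horner_morph fcomm).
split.
- exact: hilbert_basis.
- exact: nullstellensatz_poly.
- by move=> c; rewrite /= horner_morphC.
- move=> _ [p _ <-]; change (A (map_poly f p).[a i]); rewrite horner_coef.
  elim/big_rec: _ => // j x _ Ax; apply: AD => //; apply/AM.
    by rewrite coef_map; apply: fA; exists p`_j.
  elim: (nat_of_ord j) => [|n IHn]; first by rewrite expr0 -(rmorph1 iota).
  by rewrite exprS; apply/AM => //; apply: aA; exists i.
- move=> x; rewrite inE => /predU1P[->|/fa[y _ <-]].
    by exists 'X => //; apply: horner_morphX.
  by exists y%:P => //; apply: horner_morphC.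
Qed.

End Nullstellensatz.

(** * Affine open sets *)

Section AffineOpens.
Variables (k : closedFieldType) (X : variety k).
Notation K := (function_field X).
Notation sec := (sections (stalk X)).
Notation pt := (prime_at (stalk X)).
Notation aff := (affine (stalk X) (scalars X)).
Implicit Types (U V W : set X) (x y z : X) (a b f : K).

Lemma stalk_subring x : subring (stalk X x).
Proof.
have [Rk RB RM] := stalk_subalgebra x.
by split=> //; rewrite -(rmorph1 (scalars X)).
Qed.

Lemma subring_sections U : subring (sec U).
Proof.
split=> [x _|a b Aa Ab x Ux|a b Aa Ab x Ux].
- by case: (stalk_subring x).
- by case: (stalk_subring x) => _ RB _; apply: RB; [apply: Aa|apply: Ab].
- by apply: (subringM (stalk_subring x)); [apply: Aa|apply: Ab].
Qed.

Lemma sections_scalars U c : sec U (scalars X c).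
Proof. by move=> x _; case: (stalk_subalgebra x). Qed.

Lemma sections_sub U V : U `<=` V -> sec V `<=` sec U.
Proof. by move=> UV f Vf x /UV; apply: Vf. Qed.

Lemma affine_prime U x : aff U -> U x -> prime_ideal (sec U) (pt U x).
Proof. by move=> [_ [H _ _ _ _]]; apply: H. Qed.

Lemma affine_inj U x y : aff U -> U x -> U y -> pt U x = pt U y -> x = y.
Proof. by move=> [_ [_ H _ _ _]]; apply: H. Qed.

Lemma affine_point U P : aff U -> prime_ideal (sec U) P ->
  exists2 x, U x & pt U x = P.
Proof. by move=> [_ [_ _ H _ _]]; apply: H. Qed.

Lemma affine_mult U x : aff U -> U x -> mult_set (sec U) (sec U `\` pt U x).
Proof. by move=> aU Ux; apply: prime_mult_set (subring_sections U) (affine_prime aU Ux). Qed.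

Lemma affine_stalk U x : aff U -> U x ->
  stalk X x = frac (sec U `\` pt U x) (sec U).
Proof.
move=> aU Ux; have mS := affine_mult aU Ux.
case: (aU) => _ [_ _ _ -> // _]; apply/seteqP; split=> f.
  move=> [a [b [Aa Ab pb ->]]]; exists b => //.
  by rewrite mulrC divfK // (mult_setN0 mS).
move=> [s [As ps] Asf]; exists (s * f), s; split=> //.
by rewrite mulrC mulKf // (mult_setN0 mS).
Qed.

Lemma stalk_fraction U x f : aff U -> U x -> stalk X x f ->
  exists2 s, (sec U `\` pt U x) s & sec U (s * f).
Proof. by move=> aU Ux; rewrite (affine_stalk aU Ux). Qed.

Lemma affine_noetherian U : aff U -> noetherian (sec U).
Proof.
move=> [[_ /fin_gen_algebra_image[T [kappa [f [nT _ _ <-]]]] _] _].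
exact: noetherian_image.
Qed.

Lemma affine_cover x : exists2 U, aff U & U x.
Proof.
have [m [U [aU Ucov]]] := variety_finite_type X.
by have [i Uix] := Ucov x; exists (U i).
Qed.

Lemma nonunits_stalk U x : aff U -> U x ->
  nonunits (stalk X x) = frac (sec U `\` pt U x) (pt U x).
Proof.
move=> aU Ux; rewrite {1}(affine_stalk aU Ux).
exact: nonunits_frac (subring_sections U) (affine_prime aU Ux).
Qed.

Lemma stalk_local x : local_ring (stalk X x).
Proof.
have [U aU Ux] := affine_cover x; split; first exact: stalk_subring.
rewrite (nonunits_stalk aU Ux) (affine_stalk aU Ux).
apply: (ideal_frac (subring_sections U) (affine_mult aU Ux)).
exact/prime_ideal_ideal/affine_prime.
Qed.

Lemma stalk_noetherian x : noetherian (stalk X x).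
Proof.
have [U aU Ux] := affine_cover x; rewrite (affine_stalk aU Ux).
apply: (noetherian_frac (subring_sections U) (affine_mult aU Ux)).
exact: affine_noetherian.
Qed.

Lemma prime_atE U x : U x -> pt U x = nonunits (stalk X x) `&` sec U.
Proof.
move=> Ux; apply/seteqP; split=> [a [Aa Na]|a [[_ Na] Aa]]; last by [].
by split=> //; split=> //; apply: Aa.
Qed.

Lemma prime_at_sub U V x a : U `<=` V -> U x -> sec V a -> pt U x a <-> pt V x a.
Proof.
move=> UV Ux Va; split=> [[_ Na]|[_ Na]]; split=> //.
exact: sections_sub Va.
Qed.

Lemma prime_at_unit U x a : sec U a -> U x -> ~ pt U x a -> unit_in (stalk X x) a.
Proof. by move=> Ua Ux pa; apply: contrapT => Na; apply: pa. Qed.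

Lemma affine_open U : aff U -> open U.
Proof. by case=> [[]]. Qed.

(** Every prime of [sections U] comes from a point of [U], so an ideal meets a
    multiplicative set as soon as it does so at each point. *)
Lemma affine_ideal_meets U I S : aff U -> ideal (sec U) I -> mult_set (sec U) S ->
  (forall z, U z -> (forall s, S s -> ~ pt U z s) ->
     exists2 b, I b & ~ pt U z b) ->
  exists2 s, S s & I s.
Proof.
move=> aU iI mS Hz; apply: contrapT => noS.
have [|P [pP IP PS]] := prime_avoiding (subring_sections U) (affine_noetherian aU) mS iI.
  by move=> a Ia Sa; apply: noS; exists a.
have [z Uz ez] := affine_point aU pP.
have [|b /IP Pb] := Hz z Uz; first by rewrite ez => s Ss /PS.
by rewrite ez.
Qed.

Definition basic U f : set X := [set y | U y /\ ~ pt U y f].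

Lemma affine_openP U V : aff U -> V `<=` U -> open V <->
  (forall x, V x -> exists f, [/\ sec U f, ~ pt U x f & basic U f `<=` V]).
Proof. by move=> [_ [_ _ _ _]]; apply. Qed.

Lemma basic_sub U f : basic U f `<=` U.
Proof. by move=> y []. Qed.

Lemma basic_open U f : aff U -> sec U f -> open (basic U f).
Proof.
move=> aU Af; apply/(affine_openP aU); first exact: basic_sub.
by move=> x [Ux px]; exists f; split.
Qed.

Lemma affine_basis U V x : aff U -> U x -> open V -> V x ->
  exists f, [/\ sec U f, ~ pt U x f & basic U f `<=` V].
Proof.
move=> aU Ux oV Vx.
have sub : U `&` V `<=` U by apply: subIsetl.
have oUV : open (U `&` V) by apply: openI => //; apply: affine_open.
have [f [Af pf fV]] := (affine_openP aU sub).1 oUV x (conj Ux Vx).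
by exists f; split=> // y /fV[].
Qed.

Lemma powers_mult_set R f : subring R -> R f -> f != 0 ->
  @mult_set K R [set f ^+ n | n in [set: nat]].
Proof.
move=> sR Rf f0; split.
- by move=> _ [n _ <-]; apply: subringX.
- by exists 0%N; rewrite ?expr0.
- by move=> [n _ /eqP]; rewrite expf_eq0 (negPf f0) andbF.
- by move=> _ _ [n _ <-] [m _ <-]; exists (n + m)%N; rewrite ?exprD.
Qed.

Lemma prime_atX U x f n : aff U -> U x -> sec U f -> pt U x (f ^+ n) -> pt U x f.
Proof.
move=> aU Ux Af; have pP := affine_prime aU Ux.
elim: n => [|n IHn]; first by rewrite expr0 => /(prime_ideal1 pP).
rewrite exprS => /(prime_idealM pP Af (subringX n (subring_sections U) Af)).
by case.
Qed.

Lemma prime_at0 U x : aff U -> U x -> pt U x 0.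
Proof. by move=> aU Ux; case: (affine_prime aU Ux) => [[]]. Qed.

(** The denominators of [g] form an ideal of [sec U]; it escapes the prime of each point where [f]
    does not vanish, so it meets the powers of [f]. *)
Lemma section_basic U f g : aff U -> sec U f -> sec (basic U f) g ->
  exists n, sec U (f ^+ n * g).
Proof.
move=> aU Af Ag; case: (eqVneq f 0) => [->|f0].
  by exists 1%N; rewrite expr1 mul0r; apply: (subring0 (subring_sections _)).
have sA := subring_sections U.
have [|||_ [n _ <-] [_ An]] := @affine_ideal_meets U [set a | sec U a /\ sec U (a * g)]
    [set f ^+ n | n in [set: nat]] aU.
- split=> [a []//||a b [Aa Aag] [Ab Abg]|a b Aa [Ab Abg]].
  + by split; rewrite ?mul0r; apply: (subring0 sA).
  + by split; rewrite ?mulrDl; apply: (subringD sA).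
  + by split; rewrite -?mulrA; apply: (subringM sA).
- exact: powers_mult_set.
- move=> z Uz Sz.
  have : stalk X z g.
    by apply: Ag; split=> //; apply: Sz; exists 1%N; rewrite ?expr1.
  by rewrite (affine_stalk aU Uz) => -[b [Ab pb] Abg]; exists b.
- by exists n.
Qed.

(** By [section_basic] the ring of [basic U f] is that of [U] with [f^-1] adjoined, and its primes
    are the primes of [sec U] without [f]. *)
Lemma basic_affine U f : aff U -> sec U f -> f != 0 -> aff (basic U f).
Proof.
move=> aU Af f0; have sA := subring_sections U; have sAf := subring_sections (basic U f).
have AAf := sections_sub (@basic_sub U f).
have Afi : sec (basic U f) f^-1.
  by move=> y [Uy py]; case: (prime_at_unit Af Uy py).
have pointE y a : basic U f y -> sec U a -> pt (basic U f) y a <-> pt U y a.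
  by move=> Dy Aa; apply: prime_at_sub => //; apply: basic_sub.
have fX n : f ^+ n != 0 by rewrite expf_neq0.
have clear g : sec (basic U f) g -> exists n a, sec U a /\ g = a / f ^+ n.
  move=> /(section_basic aU Af)[n An]; exists n, (f ^+ n * g); split=> //.
  by rewrite mulrC mulKf.
have clearp y a n : basic U f y -> sec U a ->
    pt (basic U f) y (a / f ^+ n) <-> pt U y a.
  move=> Dy Aa; have [_ _ _ pM] : ideal (sec (basic U f)) (pt (basic U f) y).
    split=> [b []//||b c [Ab Nb] [Ac Nc]|b c Ab [Ac Nc]];
      rewrite prime_atE //; have [_ [_ m0 mD mM]] := stalk_local y.
    + by split=> //; apply: (subring0 sAf).
    + split; last exact: (subringD sAf).
      by apply: mD; split=> //; [apply: Ab|apply: Ac].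
    + split; last exact: (subringM sAf).
      by apply: mM; [apply: Ab|split=> //; apply: Ac].
  split=> H.
    apply/(pointE y a Dy Aa); rewrite -(divfK (fX n) a) mulrC.
    by apply: pM => //; apply: AAf; apply: (subringX n sA).
  by rewrite mulrC; apply: pM; [rewrite -exprVn; apply: (subringX n sAf)|apply/pointE].
have pprime y : basic U f y -> prime_ideal (sec (basic U f)) (pt (basic U f) y).
  move=> Dy; rewrite prime_atE //.
  have sub : sec (basic U f) `<=` stalk X y by move=> g; apply.
  exact: prime_contract sub sAf (local_max_prime (stalk_local y)).
split; split=> //.
- exact: basic_open.
- case: (aU) => [[_ [m [a [sa aA minA]]] _] _].
  exists m.+1, (fun i => if unlift ord_max i is Some j then a j else f^-1).
  have sAf' : subalgebra (scalars X) (sec (basic U f)).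
    by case: sAf => A1 AB AM; split=> // c; apply: sections_scalars.
  split=> // [_ [i _ <-]|B sB aB g Ag].
    case: unliftP => [j|] _ //; apply/AAf/aA; by exists j.
  have [n [b [Ab ->]]] := clear g Ag.
  have [Bk BB BM] := sB.
  have B1 : B 1 by rewrite -(rmorph1 (scalars X)).
  have Bb : B b.
    apply: minA Ab => // _ [j _ <-]; apply: aB; exists (lift ord_max j) => //.
    by rewrite liftK.
  have Bf : B f^-1 by apply: aB; exists ord_max; rewrite ?unlift_none.
  apply/BM => //; rewrite -exprVn; elim: n => [|n IHn]; first by rewrite expr0.
  by rewrite exprS; apply/BM.
- move=> g; case: (aU) => [[_ _ /(_ g)[a [b [Aa Ab b0 ->]]]] _].
  by exists a, b; split=> //; apply: AAf.
- move=> x y Dx Dy exy; apply: (affine_inj aU Dx.1 Dy.1).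
  apply/seteqP; split=> a Ha; have Aa : sec U a by case: Ha.
    by apply/(pointE y a Dy Aa); rewrite -exy; apply/pointE.
  by apply/(pointE x a Dx Aa); rewrite exy; apply/pointE.
- move=> P pP; have pPA := prime_contract AAf sA pP.
  have [y Uy ey] := affine_point aU pPA.
  have Dy : basic U f y.
    split=> //; rewrite ey => -[Pf _]; apply: (prime_ideal_unit pP Pf).
    by split=> //; apply: AAf.
  have iP := prime_ideal_ideal pP; case: (iP) => PR _ _ PM.
  exists y => //; apply/seteqP; split=> g Hg.
    have [n [a [Aa eg]]] := clear g Hg.1; move: Hg; rewrite eg.
    move/(clearp y a n Dy Aa); rewrite ey => -[Pa _].
    by rewrite mulrC; apply: PM => //; rewrite -exprVn; apply: (subringX n sAf).
  have [n [a [Aa eg]]] := clear g (PR _ Hg); move: Hg; rewrite eg => Pg.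
  apply/(clearp y a n Dy Aa); rewrite ey; split=> //.
  by rewrite -(divfK (fX n) a) mulrC; apply: PM => //; apply: AAf; apply: (subringX n sA).
- move=> y Dy; apply/seteqP; split=> g.
    rewrite (affine_stalk aU Dy.1) => -[b [Ab pb] Abg].
    have mS := affine_mult aU Dy.1.
    exists (b * g), b; split; [exact: AAf|exact: AAf|by move/(pointE y b Dy Ab)|].
    by rewrite mulrC mulKf // (mult_setN0 mS).
  move=> [a [b [Aa Ab pb ->]]]; apply: (subringM (stalk_subring y)); first exact: Aa.
  by case: (prime_at_unit Ab Dy pb).
- move=> V VD; have VU : V `<=` U by move=> y /VD[].
  split=> [/(affine_openP aU VU) oV x Vx|HV].
    have [g [Ag pg gV]] := oV x Vx; exists g; split; first exact: AAf.
      by move/(pointE x g (VD _ Vx) Ag).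
    by move=> y [Dy py]; apply: gV; split; [case: Dy|move/(pointE y g Dy Ag)].
  apply/(affine_openP aU VU) => x Vx; have [g [Ag pg gV]] := HV x Vx.
  have [n [a [Aa eg]]] := clear g Ag.
  have Dx := VD _ Vx; exists (a * f); split; first exact: (subringM sA).
    move/(prime_idealM (affine_prime aU Dx.1) Aa Af)=> -[pa|]; last by case: Dx.
    by apply: pg; rewrite eg; apply/clearp.
  move=> y [Uy py].
  have [iR _ _ iM] := prime_ideal_ideal (affine_prime aU Uy).
  have Dy : basic U f y by split=> // pf; apply/py/iM.
  apply: gV; split=> //; rewrite eg => /(clearp y a n Dy Aa) pa.
  by apply: py; rewrite mulrC; apply: iM.
Qed.

Lemma affine_nbhd x V : open V -> V x -> exists W, [/\ aff W, W x & W `<=` V].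
Proof.
move=> oV Vx; have [U aU Ux] := affine_cover x.
have [f [Af pf fV]] := affine_basis aU Ux oV Vx.
exists (basic U f); split=> //; apply: basic_affine => //.
by apply/eqP => f0; apply: pf; rewrite f0; apply: prime_at0.
Qed.

Lemma affineI U V : aff U -> aff V -> aff (U `&` V).
Proof. by move=> aU aV; case: (variety_separated aU aV). Qed.

(** ** Generic point and specializations *)

Lemma zero_prime U : prime_ideal (sec U) [set 0].
Proof.
split; first split=> [_ ->||]; first exact: subring0 (subring_sections U).
- by [].
- by move=> /eqP; rewrite oner_eq0.
- split=> [_ _ -> ->|a _ _ ->|a b _ _ /eqP]; [exact: addr0|exact: mulr0|].
  by rewrite mulf_eq0 => /orP[]/eqP; [left|right].
Qed.

Lemma generic_point : exists eta : X,
  (forall V, open V -> V !=set0 -> V eta) /\ stalk X eta = setT.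
Proof.
have [[x0 _] irr] := variety_irreducible X.
have [U aU Ux0] := affine_cover x0.
have [eta Ueta eeta] := affine_point aU (zero_prime U).
exists eta; split=> [V oV [y Vy]|].
  have [z [[_ Uz] Vz]] : [set: X] `&` U `&` V !=set0.
    by apply: irr; [exact: affine_open| |exists x0|exists y].
  have [f [Af pf fV]] := affine_basis aU Uz oV Vz.
  apply: fV; split=> //; rewrite eeta => f0; apply: pf; rewrite f0.
  exact: prime_at0.
apply/seteqP; split=> // f _; rewrite (affine_stalk aU Ueta) eeta.
case: (aU) => [[_ _ /(_ f)[a [b [Aa Ab b0 ->]]]] _].
exists b; first by split=> //; apply/eqP.
by rewrite mulrC divfK.
Qed.

Lemma affine_generalization U x y V : aff U -> U x -> U y ->
  pt U y `<=` pt U x -> open V -> V x -> V y.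
Proof.
move=> aU Ux Uy pyx oV Vx.
have [f [Af pf fV]] := affine_basis aU Ux oV Vx.
by apply: fV; split=> // /pyx.
Qed.

(** The Nullstellensatz gives a [k]-valued character that vanishes on the prime of [y]; its kernel
    is the prime of a point with residue field [k]. At such a point the maximal ideal alone controls
    the differentials. *)
Lemma rational_specialization U y : aff U -> U y ->
  exists x, [/\ U x, pt U y `<=` pt U x &
    forall a, sec U a -> exists c, pt U x (a - scalars X c)].
Proof.
move=> aU Uy; case: (aU) => [[_ /fin_gen_algebra_image[T [kappa [f [_ nullT fk fA]]]] _] _].
have pP := affine_prime aU Uy; have [PA P0 PD PM] := prime_ideal_ideal pP.
have Afr t : sec U (f t) by rewrite -fA; exists t.
have rng a : sec U a -> exists t, a = f t by rewrite -fA => -[t _ <-]; exists t.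
have pQ0 : prime_set [set t | pt U y (f t)].
  split; rewrite /= ?rmorph0 ?rmorph1 //; first exact: prime_ideal1 pP.
  - by move=> a b; rewrite rmorphD; apply: PD.
  - by move=> a b; rewrite rmorphM; apply: PM.
  - by move=> a b; rewrite rmorphM; apply: prime_idealM pP _ _.
have [|phi [phik phiP _]] := nullT _ 1 pQ0.
  by rewrite /= rmorph1; apply: prime_ideal1 pP.
have ker s t : f s = f t -> phi s = phi t.
    move=> est; have e0 : f (s - t) = 0 by rewrite rmorphB est subrr.
    by apply/eqP; rewrite -subr_eq0 -rmorphB; apply/eqP/phiP; rewrite /= e0.
  have pQ : prime_ideal (sec U) [set f t | t in [set t | phi t = 0]].
    split; first split=> [_ [t _ <-]//||[t /= t0]].
    + by exists 0; rewrite /= ?rmorph0.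
    + by rewrite -(rmorph1 f) => /ker /eqP; rewrite t0 rmorph1 eq_sym oner_eq0.
    split.
    + move=> _ _ [s s0 <-] [t t0 <-]; exists (s + t); last by rewrite rmorphD.
      by rewrite /= rmorphD s0 t0 addr0.
    + move=> a _ /rng[s ->] [t t0 <-].
      exists (s * t); last by rewrite rmorphM.
      by rewrite /= rmorphM t0 mulr0.
    + move=> a b /rng[s ->] /rng[t ->] [u u0].
      rewrite -rmorphM => /ker/eqP; rewrite u0 rmorphM eq_sym mulf_eq0.
      by case/orP => /eqP ?; [left; exists s|right; exists t].
  have [x Ux ex] := affine_point aU pQ; exists x; split=> //.
    move=> a pa; have [t et] := rng _ (PA _ pa); rewrite ex.
    by exists t => //=; apply: phiP; rewrite /= -et.
  move=> a /rng[t ->]; exists (phi t); rewrite ex.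
  exists (t - kappa (phi t)); last by rewrite rmorphB fk.
  by rewrite /= rmorphB phik subrr.
Qed.

(** ** Quasi-compactness *)

(** Take an ideal maximal among those whose elements all have their basic open sets covered by one
    finite subfamily. It contains every [f] with [basic U f] inside some [B y], because adding [y]
    to the subfamily serves the enlarged ideal. *)
Lemma affine_quasi_compact U O (B : X -> set X) : aff U -> open O ->
  (forall x, O x -> open (B x) /\ B x x) ->
  exists s : seq X, (forall x, x \in s -> O x) /\
    forall y, O y -> U y -> exists2 x, x \in s & B x y.
Proof.
move=> aU oO OB; have sA := subring_sections U.
pose cov (s : seq X) (f : K) := sec U f /\
  forall y, basic U f y -> exists2 x, x \in s & B x y.
pose ok I := exists2 s : seq X, (forall x, x \in s -> O x) & I `<=` cov s.
have [|I [iI [s sO Is] maxI]] := @noetherian_ideal_maximal K (sec U) ok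
    (affine_noetherian aU).
  exists [set 0]; first exact/prime_ideal_ideal/zero_prime.
  exists [::] => // _ ->; split; first exact: (subring0 sA).
  by move=> y [Uy []]; apply: prime_at0.
exists s; split=> // y Oy Uy; have [oBy Byy] := OB _ Oy.
have [f [Af pf fB]] := affine_basis aU Uy oBy Byy.
suff If : I f by case: (Is _ If) => _; apply; split.
have [iIf IIf Iff] := adjoinP sA iI Af.
apply: (maxI _ iIf _ IIf) => //; exists (y :: s).
  by move=> x; rewrite inE => /predU1P[->|/sO].
have IA : I `<=` sec U by case: iI.
move=> _ [a [r [Ia Ar ->]]]; have Aa := IA _ Ia.
have Arf : sec U (r * f) by apply: (subringM sA).
split; first exact: (subringD sA).
move=> z [Uz pz]; have [_ _ pD pM] := prime_ideal_ideal (affine_prime aU Uz).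
case: (pselect (pt U z a)) => pa; last first.
  have [_ /(_ z (conj Uz pa))[x xs Bx]] := Is _ Ia.
  by exists x; rewrite // inE xs orbT.
exists y; first exact: mem_head.
by apply: fB; split=> // pfz; apply/pz/pD => //; apply: pM.
Qed.

Lemma quasi_compact O (B : X -> set X) : open O ->
  (forall x, O x -> open (B x) /\ B x x) ->
  exists s : seq X, (forall x, x \in s -> O x) /\
    forall y, O y -> exists2 x, x \in s & B x y.
Proof.
move=> oO OB; have [m [U [aU Ucov]]] := variety_finite_type X.
have H i := affine_quasi_compact (aU i) oO OB.
pose s i := sval (cid (H i)).
exists (flatten [seq s i | i <- enum 'I_m]); split.
  move=> x /flatten_mapP[i _]; rewrite /s; case: cid => t /= [tO _]; exact: tO.
move=> y Oy; have [i Uiy] := Ucov y.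
have [x xs Bx] : exists2 x, x \in s i & B x y.
  by rewrite /s; case: cid => t /= [_]; apply.
by exists x => //; apply/flatten_mapP; exists i; rewrite ?mem_enum.
Qed.

(** ** Chains of irreducible closed subsets *)

(** Functions on an affine neighbourhood of [y] that vanish on [Z i] form a prime ideal since [Z i]
    is irreducible. Localized at [y] and taken in reverse order, these primes form the chain. *)
Lemma irr_chain_primes d Z y : irr_chain d Z -> Z 0%N y ->
  prime_chain (stalk X y) d.
Proof.
move=> [Zirr Zlt] Z0y; have [U aU Uy] := affine_cover y.
have sA := subring_sections U; have mS := affine_mult aU Uy.
have Zy i : (i <= d)%N -> Z i y.
  elim: i => // i IHi lid; have [ZZ _] := Zlt _ lid.
  exact/ZZ/IHi/ltnW.
pose I i : set K := [set a | sec U a /\ forall z, Z i z -> U z -> pt U z a].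
have pI i : (i <= d)%N -> prime_ideal (sec U) (I i).
  move=> lid; have [_ [_ irr]] := Zirr _ lid.
  split; first split=> [a []//||[_ /(_ y (Zy _ lid) Uy)]].
  - by split; [exact: (subring0 sA)|move=> z _ Uz; apply: prime_at0].
  - exact/prime_ideal1/affine_prime.
  split.
  - move=> a b [Aa Ia] [Ab Ib]; split; first exact: (subringD sA).
    move=> z Zz Uz; have [_ _ pD _] := prime_ideal_ideal (affine_prime aU Uz).
    by apply: pD; [apply: Ia|apply: Ib].
  - move=> a b Aa [Ab Ib]; split; first exact: (subringM sA).
    move=> z Zz Uz; have [_ _ _ pM] := prime_ideal_ideal (affine_prime aU Uz).
    by apply: pM => //; apply: Ib.
  - move=> a b Aa Ab [_ Iab]; apply: contrapT => /not_orP[Na Nb].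
    have meets c : sec U c -> ~ I i c -> Z i `&` basic U c !=set0.
      move=> Ac Nc; apply: contrapT => noz; apply: Nc; split=> // z Zz Uz.
      by apply: contrapT => pz; apply: noz; exists z.
    have [z [[Zz [Uz pa]] [_ pb]]] : Z i `&` basic U a `&` basic U b !=set0.
      by apply: irr; [exact: basic_open|exact: basic_open|exact: meets|exact: meets].
    by have [] := prime_idealM (affine_prime aU Uz) Aa Ab (Iab z Zz Uz).
have ISy i : (i <= d)%N -> forall a, I i a -> ~ (sec U `\` pt U y) a.
  by move=> lid a [_ /(_ y (Zy _ lid) Uy)] pa [].
have Ilt i : (i < d)%N -> I i.+1 `<` I i.
  move=> lid; have [ZZ /nonsubset[w [Z'w Zw]]] := Zlt _ lid.
  have [cZ _] := Zirr _ (ltnW lid); have [_ [_ irr]] := Zirr _ lid.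
  split=> [a [Aa Ia]|]; first by split=> // z /ZZ; apply: Ia.
  have [z [[Z'z Uz] Zz]] : Z i.+1 `&` U `&` ~` Z i !=set0.
    apply: irr; [exact: affine_open|by rewrite openC| |by exists w].
    by exists y; split=> //; apply: Zy.
  have [|f [Af pf fZ]] := @affine_basis U (~` Z i) z aU Uz _ Zz; first by rewrite openC.
  move=> /(_ f); case; last by move=> _ /(_ z Z'z Uz).
  by split=> // u Zu Uu; apply: contrapT => pu; apply: (fZ u).
exists (fun i => frac (sec U `\` pt U y) (I (d - i)%N)); rewrite (affine_stalk aU Uy).
split=> i lid.
  by apply: prime_frac => //; [apply: pI|apply: ISy]; rewrite leq_subr.
have e : (d - i = (d - i.+1).+1)%N by rewrite subnSK.
have l1 : (d - i <= d)%N by rewrite leq_subr.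
have l2 : (d - i.+1 <= d)%N by rewrite leq_subr.
apply: (proper_frac mS (pI _ l1) (pI _ l2) (ISy _ l1)).
by rewrite e; apply: Ilt; rewrite -e.
Qed.

Lemma closure_irreducible y : irreducible (closure [set y]).
Proof.
split=> [|U V oU oV [u [cu Uu]] [v [cv Vv]]]; first by exists y; apply: subset_closure.
have in_ W w : open W -> W w -> closure [set y] w -> W y.
  move=> oW Ww /(_ W); case; first by apply: open_nbhs_nbhs.
  by move=> _ [-> ].
by exists y; split; [split; [apply: subset_closure|apply: in_ cu]|apply: in_ cv].
Qed.

Lemma codim_primes S c y : closed S -> S y -> codim_ge S c ->
  prime_chain (stalk X y) c.
Proof.
move=> cS Sy codS.
have [|Z [cZ Z0]] := codS _ (@closed_closure _ [set y]) (closure_irreducible y).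
  by rewrite [X in _ `<=` X](closure_id S).1 //; apply: closureS => _ ->.
by apply: (irr_chain_primes cZ); rewrite Z0; apply: subset_closure.
Qed.

(** The closures of the points of the contracted primes, in reverse order. An element separating two
    consecutive primes yields a basic open set that separates their closures. *)
Lemma primes_irr_chain x d : prime_chain (stalk X x) d ->
  exists Z : nat -> set X, irr_chain d Z.
Proof.
move=> [P [pP Plt]]; have [U aU Ux] := affine_cover x.
have sA := subring_sections U; have mS := affine_mult aU Ux.
rewrite (affine_stalk aU Ux) in pP.
have subA := frac_sub mS (M := sec U).
have pPA i (lid : (i <= d)%N) := prime_contract subA sA (pP i lid).
have ypt i : exists y, (i <= d)%N -> U y /\ pt U y = P i `&` sec U.
  case: (leqP i d) => [lid|]; last by exists x.
  by have [y Uy ey] := affine_point aU (pPA i lid); exists y.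
pose y i := sval (cid (ypt i)).
have yP i : (i <= d)%N -> U (y i) /\ pt U (y i) = P i `&` sec U.
  by rewrite /y; case: cid.
exists (fun j => closure [set y (d - j)%N]); split=> j ljd.
  by split; [exact: closed_closure|exact: closure_irreducible].
have e : (d - j = (d - j.+1).+1)%N by rewrite subnSK.
rewrite e; set i := (d - j.+1)%N in e *.
have lid : (i < d)%N by rewrite -e leq_subr.
have [Ui pi] := yP _ (ltnW lid); have [Ui' pi'] := yP _ lid.
have [PP /nonsubset[a [P'a Pa]]] := Plt _ lid; split.
  rewrite [X in _ `<=` X](closure_id _).1; last exact: closed_closure.
  apply: closureS => _ -> B; rewrite nbhsE => -[V [oV Vy] VB].
  exists (y i); split=> //; apply: VB; apply: (affine_generalization aU Ui' Ui _ oV Vy).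
  by rewrite pi pi' => b [/PP].
have iP' := prime_ideal_ideal (pP _ lid).
have [s Ss [P'sa Asa]] : exists2 s, (sec U `\` pt U x) s & (P i.+1 `&` sec U) (s * a).
  by move: P'a; rewrite {1}(frac_contract sA mS iP').
have Psa : ~ (P i `&` sec U) (s * a).
  move=> [Psa _]; apply: Pa; rewrite (frac_contract sA mS (prime_ideal_ideal (pP _ (ltnW lid)))).
  by exists s.
move=> /(_ (y i) (subset_closure (erefl _))).
move=> /(_ (basic U (s * a)))[|z [-> [_]]]; last by rewrite pi'; apply.
apply: open_nbhs_nbhs; split; first exact: basic_open.
by split=> //; rewrite pi.
Qed.

Lemma dimension_bound n x d : dimension X n -> prime_chain (stalk X x) d ->
  (d <= n)%N.
Proof.
move=> [_ nochain] /primes_irr_chain[Z [Zirr Zlt]].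
rewrite leqNgt; apply/negP => ltnd; apply: nochain; exists Z.
by split=> i lin; [apply: Zirr; apply: leq_trans ltnd|apply: Zlt; apply: leq_trans ltnd].
Qed.

End AffineOpens.

(** * Cech complexes *)

Section Cobound.
Variables (T : eqType) (E : zmodType).
Implicit Types (c b : seq T -> E) (l m : seq T).

(** The Cech differential, for cochains indexed by lists; the value at the empty
    list is the term of degree [-1] of the augmented complex. *)
Fixpoint cobound c l : E :=
  if l is x :: l' then c l' - cobound (fun m => c (x :: m)) l' else 0.

Lemma eq_cobound c b l :
  (forall l1 x l2, l = l1 ++ x :: l2 -> c (l1 ++ l2) = b (l1 ++ l2)) ->
  cobound c l = cobound b l.
Proof.
elim: l c b => //= x l IHl c b H; congr (_ - _).
  exact: (H [::]).
by apply: IHl => l1 y l2 el; apply: (H (x :: l1) y l2); rewrite el.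
Qed.

Lemma cobound0 l : cobound (fun=> 0) l = 0.
Proof. by elim: l => //= x l ->; rewrite subr0. Qed.

Lemma coboundB c b l : cobound (fun m => c m - b m) l = cobound c l - cobound b l.
Proof.
elim: l c b => [|x l IHl] c b /=; first by rewrite subrr.
by rewrite IHl opprB addrACA opprB [RHS]addrACA [- b l + _]addrC.
Qed.

Lemma cobound_cobound c l : cobound (cobound c) l = 0.
Proof.
elim: l c => //= x l IHl c.
by rewrite coboundB IHl subr0 subrr.
Qed.

(** Prepending an index contracts the complex: on cocycles it is a primitive. *)
Lemma cobound_cone c x l :
  cobound (fun m => c (x :: m)) l = c l - cobound c (x :: l).
Proof. by rewrite /= opprB addrC subrK. Qed.

Lemma cobound_ind (N : E -> Prop) c l : N 0 ->
  (forall u v, N u -> N v -> N (u - v)) ->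
  (forall l1 x l2, l = l1 ++ x :: l2 -> N (c (l1 ++ l2))) -> N (cobound c l).
Proof.
move=> N0 NB; elim: l c => //= x l IHl c H; apply/NB; first exact: (H [::]).
by apply: IHl => l1 y l2 el; apply: (H (x :: l1) y l2); rewrite el.
Qed.

End Cobound.

Lemma cobound_morph (T : eqType) (E E' : zmodType) (f : E -> E') (c : seq T -> E) l :
  f 0 = 0 -> (forall u v, f (u - v) = f u - f v) ->
  cobound (fun m => f (c m)) l = f (cobound c l).
Proof. by move=> f0 fB; elim: l c => //= x l IHl c; rewrite IHl fB. Qed.

Lemma coboundM (T : eqType) (K : fieldType) (a : K) (c : seq T -> K) l :
  cobound (fun m => a * c m) l = a * cobound c l.
Proof. by apply: (cobound_morph (f := *%R a)); [apply: mulr0|apply: mulrBr]. Qed.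

(** * Cech classes killed by a regular sequence *)

Section KoszulArgument.
Variables (K : fieldType) (T : eqType) (Q : pred T) (B : seq T -> set K).
Implicit Types (N : seq T -> set K) (c b : seq T -> K) (l : seq T) (t : seq K).

Hypothesis B_subring : forall l, all Q l -> subring (B l).
Hypothesis B_mono : forall l1 x l2, B (l1 ++ l2) `<=` B (l1 ++ x :: l2).

Definition cochains s N c := forall l, all Q l -> size l = s -> N l (c l).

(** Cochains one degree below [s]. The successor on the left leaves no list at [s = 0], where the
    complex ends. *)
Definition pre_cochains s N c := forall l, all Q l -> (size l).+1 = s -> N l (c l).

(** Exactness at lists of length [s] of the augmented complex with terms [B l / N l], expressed on
    representatives in [B]. *)
Definition cech_exact s N := forall c, cochains s B c ->
  cochains s.+1 N (cobound c) ->
  exists b, pre_cochains s B b /\ cochains s N (fun l => c l - cobound b l).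

Let ideals N := (forall l, all Q l -> ideal (B l) (N l)) /\
  forall l1 x l2, N (l1 ++ l2) `<=` N (l1 ++ x :: l2).

Let cochains_cobound s N c : ideals N -> cochains s N c ->
  cochains s.+1 N (cobound c).
Proof.
move=> [iN mN] Nc l Ql sl; have iNl := iN _ Ql.
apply: cobound_ind => [|u v Nu Nv|l1 x l2 el]; first by case: iNl.
  exact: (idealB (B_subring Ql) iNl).
rewrite el; apply: mN; move: sl Ql; rewrite el => sl Ql; apply: Nc.
  by move: Ql; rewrite !all_cat /= => /and3P[-> _ ->].
by move: sl; rewrite !size_cat /= addnS => -[].
Qed.

Let ideals_B : ideals B.
Proof.
split=> // l Ql; have sB := B_subring Ql.
split=> //; [exact: subring0|by move=> *; apply: subringD|by move=> *; apply: subringM].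
Qed.

Let ideals_adjoin N x : ideals N -> (forall l, all Q l -> B l x) ->
  ideals (fun l => adjoin (B l) (N l) x).
Proof.
move=> [iN mN] Bx; split=> [l Ql|l1 y l2 _ [b [r [Nb Br ->]]]].
  by case: (adjoinP (B_subring Ql) (iN _ Ql) (Bx _ Ql)).
by exists b, r; split=> //; [apply: mN|apply: B_mono].
Qed.

Let choose_coef s N x c : cochains s (fun l => adjoin (B l) (N l) x) c ->
  exists y, cochains s B y /\ cochains s N (fun l => c l - y l * x).
Proof.
move=> Hc; have /choice[y Hy] : forall l, exists y, all Q l -> size l = s ->
    B l y /\ N l (c l - y * x).
  move=> l; case: (pselect (all Q l /\ size l = s)) => [[Ql sl]|nl].
    have [b [r [Nb Br ->]]] := Hc l Ql sl.
    by exists r => _ _; rewrite addrK.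
  by exists 0 => Ql sl; case: nl.
by exists y; split=> l Ql sl; have [] := Hy l Ql sl.
Qed.

(** If all [s' < s] are exact modulo [N], a class at [s] that is killed by an
    [N]-regular sequence of length [> s] is zero: dividing by the first element
    of the sequence shifts the class injectively to [s - 1]. *)
Lemma koszul_vanishing s t N c : ideals N -> (s < size t)%N ->
  (forall l x, all Q l -> x \in t -> B l x) ->
  (forall l, all Q l -> regular_seq (B l) (N l) t) ->
  (forall s', (s' < s)%N -> cech_exact s' N) ->
  cochains s B c -> cochains s.+1 N (cobound c) ->
  (forall x, x \in t -> exists b, pre_cochains s B b /\
     cochains s N (fun l => x * c l - cobound b l)) ->
  exists b, pre_cochains s B b /\ cochains s N (fun l => c l - cobound b l).
Proof.
elim: s t N c => [|s IHs] [//|x t] N c iN; case: (iN) => idN mN.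
  move=> _ Bx regt _ Bc Nc kill; exists (fun=> 0); split=> // -[|//] Ql _.
  have [b [_ /(_ _ Ql erefl)]] := kill x (mem_head _ _).
  rewrite /= !subr0; have [reg _] := regt _ Ql.
  by apply: reg; apply: Bc.
move=> st Bt regt exN Bc Nc kill.
have Bx l : all Q l -> B l x by move=> Ql; apply: Bt => //; apply: mem_head.
have reg l a : all Q l -> B l a -> N l (x * a) -> N l a.
  by move=> Ql; have [+ _] := regt _ Ql; apply.
have sub l u v : all Q l -> N l u -> N l v -> N l (u - v).
  by move=> Ql; apply: (idealB (B_subring Ql) (idN _ Ql)).
have add l u v : all Q l -> N l u -> N l v -> N l (u + v).
  by move=> Ql; case: (idN _ Ql) => _ _ + _; apply.
have mul l u v : all Q l -> B l u -> N l v -> N l (u * v).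
  by move=> Ql; case: (idN _ Ql) => _ _ _; apply.
have [b0 [Bb0 Nb0]] := kill x (mem_head _ _).
have {}Bb0 : cochains s B b0 by move=> l Ql sl; apply: Bb0; rewrite ?sl.
set N' := fun l => adjoin (B l) (N l) x.
have iN' : ideals N' by apply: ideals_adjoin.
have NN' l u : all Q l -> N l u -> N' l u.
  by move=> Ql; apply: sub_adjoin; apply: B_subring.
(* [x c = cobound b0] modulo [N], so [b0] is a cocycle modulo [N' = N + (x)]. Once its class
   vanishes, [b0] is [cobound e + x b'] modulo [N], hence [x c = x cobound b'], and [x] cancels by
   regularity. *)
have [e [Be Ne]] : exists b, pre_cochains s B b /\
    cochains s N' (fun l => b0 l - cobound b l).
  apply: (IHs t N') => //.
  - by move=> l y Ql ty; apply: Bt => //; rewrite inE ty orbT.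
  - by move=> l Ql; have [] := regt _ Ql.
  (* The long exact sequence of multiplication by [x] on [B / N]: exactness modulo [N'] at [s']
     follows from exactness modulo [N] at [s'.+1], applied to the connecting cochain [y], and at
     [s']. *)
  - move=> s' lts z Bz N'z; have [y [By Ny]] := choose_coef N'z.
    have N'y : cochains s'.+2 N (cobound y).
      move=> l Ql sl; apply: reg => //; first by apply: (cochains_cobound ideals_B By).
      have := cochains_cobound iN Ny Ql sl.
      rewrite coboundB cobound_cobound sub0r => H.
      rewrite -coboundM -[cobound _ l]opprK; rewrite (@eq_cobound _ _ _ (fun m => y m * x)).
        exact: (idealN (B_subring Ql) (idN _ Ql)).
      by move=> *; rewrite mulrC.
    have [w [Bw Nw]] := exN s'.+1 lts y By N'y.
    have {}Bw : cochains s' B w by move=> l Ql sl; apply: Bw; rewrite ?sl.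
    have [||v [Bv Nv]] := exN s' (ltnW lts) (fun l => z l - x * w l).
    + move=> l Ql sl; have sB := B_subring Ql; have [_ BB _] := sB; apply/BB; first exact: Bz.
      by apply: (subringM sB); [exact: Bx|exact: Bw].
    + move=> l Ql sl; rewrite coboundB coboundM.
      have -> : cobound z l - x * cobound w l =
          (cobound z l - y l * x) + x * (y l - cobound w l) by ring.
      by apply: add => //; [exact: Ny|apply: mul => //; [exact: Bx|exact: Nw]].
    exists v; split=> // l Ql sl.
    exists (z l - x * w l - cobound v l), (w l); split; [exact: Nv|exact: Bw|by ring].
  - move=> l Ql sl; exists (- (x * c l - cobound b0 l)), (c l); split; last by ring.
      by apply: (idealN (B_subring Ql) (idN _ Ql)); apply: Nb0.
    exact: Bc.
  (* [x' b0 - x b'] is a cocycle modulo [N], as both terms are primitives of [x x' c]. Exactness one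
     degree below makes it a coboundary, so [x'] kills the class of [b0] modulo [N']. *)
  - move=> x' tx'; have x't : x' \in x :: t by rewrite inE tx' orbT.
    have [b' [Bb' Nb']] := kill x' x't.
    have {}Bb' : cochains s B b' by move=> l Ql sl; apply: Bb'; rewrite ?sl.
    have Bx' l : all Q l -> B l x' by move=> Ql; apply: Bt.
    have [||v [Bv Nv]] := exN s (ltnSn s) (fun l => x' * b0 l - x * b' l).
    + move=> l Ql sl; have sB := B_subring Ql; have [_ BB _] := sB.
      by apply/BB; apply: (subringM sB); auto.
    + move=> l Ql sl; rewrite coboundB !coboundM.
      have -> : x' * cobound b0 l - x * cobound b' l =
        x * (x' * c l - cobound b' l) - x' * (x * c l - cobound b0 l) by ring.
      by apply: sub => //; apply: mul; auto.
    exists v; split=> // l Ql sl.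
    exists (x' * b0 l - x * b' l - cobound v l), (b' l).
    by split; [exact: Nv|exact: Bb'|ring].
have [b' [Bb' Nb']] := choose_coef Ne.
exists b'; split=> [l Ql [sl]|l Ql sl]; first exact: Bb'.
apply: reg => //.
  have [_ BB _] := B_subring Ql; apply/BB; first exact: Bc.
  exact: (cochains_cobound ideals_B Bb').
have := cochains_cobound iN Nb' Ql sl.
rewrite !coboundB cobound_cobound subr0.
rewrite (@eq_cobound _ _ (fun m => b' m * x) (fun m => x * b' m)); last by move=> *; rewrite mulrC.
rewrite coboundM => H.
have -> : x * (c l - cobound b' l) =
  (x * c l - cobound b0 l) + (cobound b0 l - x * cobound b' l) by ring.
by apply: add => //; apply: Nb0.
Qed.

End KoszulArgument.

(** * Ideals and regular sequences under localization *)

Section AdjoinFractions.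
Variable K : fieldType.
Implicit Types (R I S : set K) (t : seq K).

Lemma adjoin_frac R S I x : subring R -> mult_set R S -> ideal R I -> R x ->
  adjoin (frac S R) (frac S I) x = frac S (adjoin R I x).
Proof.
move=> sR mS iI Rx; have [SR S1 S0 SM] := mS; have [IR I0 ID IM] := iI.
apply/seteqP; split=> a.
  move=> [b [r [[s Ss Isb] [s' Ss' Rr] ->]]]; exists (s * s'); first exact: SM.
  exists (s' * (s * b)), (s * (s' * r)); split; [|by apply: subringM; auto|by ring].
  by apply: IM; auto.
move=> [s Ss [b [r [Ib Rr e]]]]; have s0 := mult_setN0 mS Ss.
exists (s^-1 * b), (s^-1 * r); split.
- by exists s => //; rewrite mulVKf.
- by exists s => //; rewrite mulVKf.
- by rewrite -mulrA -mulrDr -e mulKf.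
Qed.

Lemma adjoin_seq_frac R S I t : subring R -> mult_set R S -> ideal R I ->
  (forall x, x \in t -> R x) ->
  adjoin_seq (frac S R) (frac S I) t = frac S (adjoin_seq R I t) /\
  ideal R (adjoin_seq R I t).
Proof.
move=> sR mS; elim: t I => [|x t IHt] I iI Rt //=.
have Rx : R x by apply: Rt; apply: mem_head.
rewrite (adjoin_frac sR mS iI Rx); apply: IHt; first by case: (adjoinP sR iI Rx).
by move=> y ty; apply: Rt; rewrite inE ty orbT.
Qed.

Lemma adjoin_seq_mono R R' I I' t : R `<=` R' -> I `<=` I' ->
  adjoin_seq R I t `<=` adjoin_seq R' I' t.
Proof.
move=> RR'; elim: t I I' => [|x t IHt] I I' II' //=; apply: IHt.
by move=> _ [b [r [Ib Rr ->]]]; exists b, r; split; auto.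
Qed.

(** Unrolls the recursion on [I], so that each stage can be transported to another ring
    separately. *)
Lemma regular_seqP R I t : regular_seq R I t <->
  forall t1 x t2, t = t1 ++ x :: t2 -> forall a, R a ->
    adjoin_seq R I t1 (x * a) -> adjoin_seq R I t1 a.
Proof.
elim: t I => [|x t IHt] I /=; first by split=> // _ [].
split=> [[reg /IHt H] [|y t1] z t2 /= [ex et]|H].
- by rewrite -ex.
- by rewrite -ex; apply: H et.
- split; first exact: (H [::] x t).
  by apply/IHt => t1 y t2 et; apply: (H (x :: t1) y t2); rewrite et.
Qed.

Lemma ideal0 R : subring R -> ideal R [set 0].
Proof.
move=> sR; split=> [_ ->||_ _ -> ->|a _ _ ->] //; first exact: subring0.
  by rewrite addr0.
by rewrite mulr0.
Qed.

Lemma frac0 R S : mult_set R S -> frac S [set 0] = [set 0].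
Proof.
move=> mS; apply/seteqP; split=> [a [s Ss /eqP]|_ ->].
  by rewrite mulf_eq0 (negPf (mult_setN0 mS Ss)) => /eqP.
by case: (mS) => _ S1 _ _; exists 1; rewrite ?mulr0.
Qed.

End AdjoinFractions.

(** * Exactness of the augmented Cech complex over an affine open set *)

Section AffineCech.
Variables (k : closedFieldType) (X : variety k).
Notation K := (function_field X).
Notation sec := (sections (stalk X)).
Notation pt := (prime_at (stalk X)).
Notation aff := (affine (stalk X) (scalars X)).
Implicit Types (U V W : set X) (x y z : X) (a b f : K).

(** A regular sequence of the local ring at [y] stays regular on the
    localization at [y] of the ring of any smaller affine open set, by flatness:
    all local rings of that localization are local rings of [stalk X y]. *)
Lemma regular_seq_localization V W y (t : seq K) : aff V -> aff W -> V `<=` W ->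
  W y -> (forall a, a \in t -> stalk X y a) ->
  regular_seq (stalk X y) [set 0] t ->
  regular_seq (frac (sec W `\` pt W y) (sec V)) [set 0] t.
Proof.
move=> aV aW VW Wy Ot /regular_seqP regt; apply/regular_seqP => t1 x t2 et a Ba Hxa.
set S := sec W `\` pt W y in Ba Hxa *; set B := frac S (sec V) in Ba Hxa *.
have sV := subring_sections V; have sW := subring_sections W.
have mSW : mult_set (sec W) S := affine_mult aW Wy.
have mS : mult_set (sec V) S.
  by case: mSW => SR S1 S0 SM; split=> // s /SR; apply: sections_sub.
have OE : stalk X y = frac S (sec W) by apply: affine_stalk.
have OB : stalk X y `<=` B.
  by rewrite OE => c [s Ss Wsc]; exists s => //; apply: sections_sub Wsc.
have Ox : stalk X y x by apply: Ot; rewrite et mem_cat mem_head orbT.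
have Ot1 c : c \in t1 -> stalk X y c by move=> tc; apply: Ot; rewrite et mem_cat tc.
have sB : subring B by apply: subring_frac.
have iB := ideal0 sB; have iO := ideal0 (stalk_subring y).
have iadj : ideal B (adjoin_seq B [set 0] t1).
  have mB1 : mult_set B [set 1].
    split=> [_ ->||/eqP|_ _ -> ->]; [by case: sB|by []| |by rewrite mulr1].
    by rewrite eq_sym oner_eq0.
  have [|_ //] := adjoin_seq_frac (t := t1) sB mB1 iB.
  by move=> c /Ot1/OB.
have [_ _ adjD adjM] := iadj.
have VB : sec V `<=` B by apply: (frac_sub mS).
(* The multipliers of [a] into the ideal of [t1] form an ideal of [sec V], and it suffices that it
   meets [S]. Only points [z] at which all of [S] is invertible remain to be examined. *)
have [|z Vz Sz|s Ss [Vs adjs]] := @affine_ideal_meets _ _ V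
    [set b | sec V b /\ adjoin_seq B [set 0] t1 (b * a)] S aV _ mS.
- split=> [b []//||b c [Vb Ib] [Vc Ic]|b c Vb [Vc Ic]].
  + by split; [exact: subring0 sV|rewrite mul0r; case: iadj].
  + by split; [exact: (subringD sV)|rewrite mulrDl; apply: adjD].
  + by split; [exact: (subringM sV)|rewrite -mulrA; apply: adjM => //; apply: VB].
- have Wz := VW _ Vz; have sO := stalk_subring z.
  have SO s : S s -> unit_in (stalk X z) s.
    by move=> Ss; apply: (prime_at_unit _ Vz); [case: mS => + _ _ _; apply|apply: Sz].
  have BO : B `<=` stalk X z.
    move=> c [s /SO[Os s0 Osi] Vsc].
    by rewrite -(mulKf s0 c); apply: (subringM sO) => //; apply: Vsc.
  (* [stalk X z] is the localization of [stalk X y] at [S']; this carries the regularity of the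
     sequence from [y] to [z]. *)
  pose S' := [set o | stalk X y o /\ unit_in (stalk X z) o].
  have mS' : mult_set (stalk X y) S'.
    split=> [c []//|||c d [Oc [Oc' c0 Oci]] [Od [Od' d0 Odi]]].
    - have [O1 _ _] := stalk_subring y; have [O1' _ _] := sO.
      by split=> //; split; rewrite ?oner_eq0 ?invr1.
    - by move=> [_ [_ /eqP]].
    - split; first exact: (subringM (stalk_subring y)).
      by split; [exact: (subringM sO)|rewrite mulf_neq0|rewrite invfM; apply: (subringM sO)].
  have Oz_frac c : stalk X z c -> frac S' (stalk X y) c.
    rewrite (affine_stalk aW Wz) => -[s [Ws ps] Wsc]; exists s; last exact: Wsc.
    by split; [exact: Ws|apply: prime_at_unit ps].
  have O_frac : frac S' (stalk X y) = stalk X z.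
    apply/seteqP; split=> // c [s [Os [_ s0 Osi]] /OB/BO Osc].
    by rewrite -(mulKf s0 c); apply: (subringM sO).
  have : adjoin_seq (stalk X z) [set 0] t1 a.
    have : adjoin_seq (stalk X z) [set 0] t1 (x * a).
      by apply: adjoin_seq_mono Hxa.
    rewrite -O_frac -(frac0 mS').
    have [-> iOt] := adjoin_seq_frac (t := t1) (stalk_subring y) mS' iO Ot1.
    move=> [u S'u Iuxa]; have [u' S'u' Ou'a] := Oz_frac a (BO _ Ba).
    have [S'O _ _ S'M] := mS'.
    exists (u * u'); first exact: S'M.
    apply: (regt _ _ _ et); first by rewrite -mulrA; apply: (subringM (stalk_subring y)); auto.
    have -> : x * (u * u' * a) = u' * (u * (x * a)) by ring.
    by case: iOt => _ _ _; apply; auto.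
  have mz : mult_set B (sec V `\` pt V z).
    by case: (affine_mult aV Vz) => SR S1 S0 SM; split=> // s /SR/VB.
  have -> : stalk X z = frac (sec V `\` pt V z) B.
    apply/seteqP; split=> c.
      by rewrite (affine_stalk aV Vz) => -[s Ss /VB Bsc]; exists s.
    move=> [s [Vs ps] /BO Osc]; have [Os s0 Osi] := prime_at_unit Vs Vz ps.
    by rewrite -(mulKf s0 c); apply: (subringM sO).
  rewrite -{1}(frac0 mz).
  have [|-> _] := adjoin_seq_frac (t := t1) sB mz iB; first by move=> c /Ot1/OB.
  by move=> [b [Vb pb] Iba]; exists b.
- have s0 := mult_setN0 mS Ss; rewrite -(mulKf s0 a); apply: adjM => //.
  by exists s => //; rewrite divff //; case: sV.
Qed.

Variables (T : finType) (Q : pred T) (V : T -> set X) (W : set X).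
Hypotheses (aV : forall j, Q j -> aff (V j)) (aW : aff W).
Implicit Types (l : seq T) (c : seq T -> K).

(** The factor [W] makes the empty list stand for [W] itself, the term of degree [-1]. *)
Definition meet W l : set X := [set y | W y /\ forall j, j \in l -> V j y].

Lemma meet_sub l : meet W l `<=` W.
Proof. by move=> y []. Qed.

Lemma meet_mono l1 i l2 : meet W (l1 ++ i :: l2) `<=` meet W (l1 ++ l2).
Proof.
move=> y [Wy Vy]; split=> // j jl; apply: Vy; move: jl.
by rewrite !mem_cat inE => /orP[->//|->]; rewrite !orbT.
Qed.

Lemma meet_cons i l : meet W (i :: l) = V i `&` meet W l.
Proof.
apply/seteqP; split=> y.
  move=> [Wy Vy]; split; first by apply: Vy; apply: mem_head.
  by split=> // j jl; apply: Vy; rewrite inE jl orbT.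
move=> [Vi [Wy Vy]]; split=> // j; rewrite inE => /predU1P[->//|].
exact: Vy.
Qed.

Lemma meet_affine l : all Q l -> aff (meet W l).
Proof.
elim: l => [_|x l IHl /= /andP[Qx Ql]].
  by have -> : meet W [::] = W by apply/seteqP; split=> y // [].
by rewrite meet_cons; apply: affineI; [apply: aV|apply: IHl].
Qed.

Local Notation A := (fun l => sec (meet W l)).

Let A_mono l1 i l2 : A (l1 ++ l2) `<=` A (l1 ++ i :: l2).
Proof. by apply: sections_sub; apply: meet_mono. Qed.

Let secW_A l : sec W `<=` A l.
Proof. by apply: sections_sub; apply: meet_sub. Qed.

(** There are finitely many lists of length [s] over a finite type, so the product of their
    denominators serves for all. *)
Lemma common_denominator (S : set K) s c : mult_set (sec W) S ->
  cochains Q s (fun l => frac S (A l)) c ->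
  exists2 u, S u & cochains Q s A (fun l => u * c l).
Proof.
move=> mS Hc; have [SR S1 S0 SM] := mS.
have /choice[u Hu] : forall t : s.-tuple T, exists u, S u /\ (all Q t -> A t (u * c t)).
  move=> t; case: (pselect (all Q t)) => Qt; last by exists 1.
  by have [u Su Au] := Hc t Qt (size_tuple t); exists u.
have prodS (P : pred (s.-tuple T)) : S (\prod_(t | P t) u t).
  by elim/big_rec: _ => // t v _ Sv; apply: SM => //; case: (Hu t).
exists (\prod_t u t) => // l Ql /eqP sl; pose t := Tuple sl.
rewrite (bigD1 t) //= mulrAC mulrC; apply: (subringM (subring_sections _)).
  by apply/secW_A/SR/prodS.
by have [_] := Hu t; apply.
Qed.

(** The annihilator of the class of [c] is not inside the prime of a point of
    [V j]: there, the complex is contracted by inserting the index [j]. *)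
Lemma contract_cochain j y s c : Q j -> W y -> V j y -> cochains Q s A c ->
  (forall l, all Q l -> size l = s.+1 -> cobound c l = 0) ->
  exists a (b : seq T -> K), [/\ sec W a, ~ pt W y a, pre_cochains Q s A b &
    forall l, all Q l -> size l = s -> a * c l = cobound b l].
Proof.
move=> Qj Wy Vjy Ac dc; have [h [Ah ph hV]] := affine_basis aW Wy (affine_open (aV Qj)) Vjy.
(* [c (j :: l)] is regular on [V j] inside the intersection, in particular where [h] does not
   vanish; a power of [h] extends it over the whole intersection. *)
have Hn l : exists n, all Q l -> (size l).+1 = s -> A l (h ^+ n * c (j :: l)).
  case: (pselect (all Q l /\ (size l).+1 = s)) => [[Ql sl]|nl]; last first.
    by exists 0%N => Ql sl; case: nl.
  have [n An] : exists n, A l (h ^+ n * c (j :: l)).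
    apply: (section_basic (meet_affine Ql) (secW_A Ah)).
    apply: sections_sub (Ac (j :: l) _ sl); last by rewrite /= Qj.
    rewrite meet_cons => z [mz pz]; split=> //; apply: hV.
    split; first exact: meet_sub mz.
    by move/(prime_at_sub (@meet_sub l) mz Ah).
  by exists n.
have /choice[n {}Hn] := Hn.
pose N := \max_(t : s.-1.-tuple T) n t.
have HN l : all Q l -> (size l).+1 = s -> A l (h ^+ N * c (j :: l)).
  move=> Ql sl; have /eqP st : size l = s.-1 by rewrite -sl.
  have le : (n l <= N)%N by rewrite /N (bigD1 (Tuple st)) //= leq_maxl.
  rewrite -(subnK le) exprD -mulrA; apply: (subringM (subring_sections _)).
    by apply: (subringX _ (subring_sections _)); apply: secW_A.
  exact: Hn.
exists (h ^+ N), (fun l => h ^+ N * c (j :: l)); split=> //.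
- exact: (subringX N (subring_sections W) Ah).
- by move/(prime_atX aW Wy Ah).
- move=> l Ql sl; rewrite coboundM cobound_cone dc ?subr0 //= ?Qj //.
  by rewrite sl.
Qed.

(** [c] is exact up to its annihilator; at an associated prime of the latter
    the regular sequence of the local ring kills [c]. *)
Lemma affine_cech_exact e s : smooth X ->
  (forall y, W y -> (forall j, Q j -> ~ V j y) -> prime_chain (stalk X y) e) ->
  (s < e)%N -> cech_exact Q A s (fun=> [set 0]).
Proof.
move=> smX dimV; elim/ltn_ind: s => s IHs lt_se c Ac dc.
have sA l := subring_sections (meet W l); have sW := subring_sections W.
pose J := [set a | sec W a /\ exists b : seq T -> K, pre_cochains Q s A b /\
  forall l, all Q l -> size l = s -> a * c l = cobound b l].
suff [_ [b [Ab eb]]] : J 1.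
  by exists b; split=> // l Ql sl; rewrite -eb // mul1r subrr.
apply: contrapT => J1.
have iJ : ideal (sec W) J.
  split=> [a []//||a a' [Wa [b [Ab eb]]] [Wa' [b' [Ab' eb']]]|a a' Wa [Wa' [b' [Ab' eb']]]].
  - split; first exact: subring0.
    exists (fun=> 0); split=> [l _ _|l _ _]; first exact: subring0 (sA l).
    by rewrite mul0r cobound0.
  - split; first exact: (subringD sW).
    exists (fun l => b l - - b' l); split=> l Ql sl.
      by rewrite opprK; apply: (subringD (sA l)); auto.
    rewrite coboundB (cobound_morph (f := -%R)) ?oppr0 //; last first.
      by move=> u v; rewrite opprD.
    by rewrite opprK -eb // -eb' // mulrDl.
  - split; first exact: (subringM sW).
    exists (fun l => a * b' l); split=> l Ql sl.
      by apply: (subringM (sA l)); [apply: secW_A|auto].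
    by rewrite coboundM -eb' // mulrA.
(* [J] is the annihilator of the class of [c]; the multiple [g c] has a prime annihilator, the ideal
   of a point [y] of [W]. *)
have [g [Wg Jg pp]] := associated_prime sW (affine_noetherian aW) iJ J1.
have [y Wy ey] := affine_point aW pp.
have py a : pt W y a -> J (a * g) by rewrite ey => -[].
have pyN a : sec W a -> ~ pt W y a -> ~ J (a * g) by rewrite ey => Wa pa Jag; apply: pa.
set c' := fun l => g * c l.
have Ac' : cochains Q s A c'.
  by move=> l Ql sl; apply: (subringM (sA l)); [apply: secW_A|apply: Ac].
have dc' l : all Q l -> size l = s.+1 -> cobound c' l = 0.
  by move=> Ql sl; rewrite coboundM (dc l Ql sl) mulr0.
have Vy j : Q j -> ~ V j y.
  move=> Qj Vjy; have [a [b [Wa pa Ab eb]]] := contract_cochain Qj Wy Vjy Ac' dc'.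
  apply: (pyN a Wa pa); split; first exact: (subringM sW).
  by exists b; split=> // l Ql sl; rewrite -mulrA eb.
have [t [le_et mt regt]] := regular_local_seq (stalk_local y)
  (@stalk_noetherian _ _ y) (smX y) (dimV y Wy Vy).
set S := sec W `\` pt W y; have mSW : mult_set (sec W) S := affine_mult aW Wy.
have mS l : mult_set (A l) S.
  by case: mSW => SR S1 S0 SM; split=> // u /SR; apply: secW_A.
pose B l := frac S (A l).
have sB l : all Q l -> subring (B l) by move=> _; apply: subring_frac.
have AB l : A l `<=` B l by apply: (frac_sub (mS l)).
have OB l : stalk X y `<=` B l.
  by rewrite (affine_stalk aW Wy) => a [u Su Wua]; exists u => //; apply: secW_A.
have B_mono l1 i l2 : B (l1 ++ l2) `<=` B (l1 ++ i :: l2).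
  by move=> a [u Su Aua]; exists u => //; apply: A_mono.
have Ot a : a \in t -> stalk X y a by move=> /mt[].
have i0 : (forall l, all Q l -> ideal (B l) [set 0]) /\
    forall (l1 : seq T) (i : T) (l2 : seq T), [set 0 : K] `<=` [set 0].
  by split=> [l Ql|_ _ _ a //]; exact: ideal0 (sB l Ql).
have Sinv u : S u -> forall l, B l u^-1.
  move=> Su l; exists u => //; rewrite divff ?(mult_setN0 mSW) //.
  by case: (sA l).
have [|||||||b [Bb eb]] := @koszul_vanishing K T Q B sB B_mono s t (fun=> [set 0]) c' i0.
- exact: leq_trans le_et.
- by move=> l x Ql /Ot; apply: OB.
- move=> l Ql; apply: regular_seq_localization => //; first exact: meet_affine.
  exact: meet_sub.
(* Exactness in lower degree passes to the localization at [y]: clear denominators, apply the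
   induction hypothesis, divide again. *)
- move=> s' lts z Bz dz; have [u Su Auz] := common_denominator mSW Bz.
  have u0 := mult_setN0 mSW Su.
  have [|b [Ab eb]] := IHs s' lts (ltn_trans lts lt_se) (fun l => u * z l) Auz.
    by move=> l Ql sl; rewrite coboundM (dz l Ql sl) mulr0.
  exists (fun l => u^-1 * b l); split=> l Ql sl.
    by apply: (subringM (sB l Ql)); [apply: Sinv|apply/AB/Ab].
  rewrite coboundM; have /eqP := eb l Ql sl; rewrite subr_eq0 => /eqP <-.
  by rewrite mulKf // subrr.
- by move=> l Ql sl; apply/AB/Ac'.
- by move=> l Ql sl; apply: dc'.
(* Up to an element of [S], [x] lies in the prime of [y], which is the annihilator of the class of
   [c']. *)
- move=> x tx; have := mt x tx; rewrite (nonunits_stalk aW Wy) => -[u Su /py].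
  move=> [_ [b [Ab eb]]]; have u0 := mult_setN0 mSW Su.
  exists (fun l => u^-1 * b l); split=> l Ql sl.
    by apply: (subringM (sB l Ql)); [apply: Sinv|apply/AB/Ab].
  by rewrite coboundM -eb // -mulrA -[u * x * _]mulrA mulKf // subrr.
(* At [s = 0] nothing is known about [b]; the value [0] then makes it a cochain at [s.-1], as
   [common_denominator] asks. *)
have {}Bb : cochains Q s.-1 B (fun l => if s is _.+1 then b l else 0).
  case: s Bb {IHs lt_se Ac dc J J1 iJ Jg pp ey py pyN c' Ac' dc' eb} => [|s] Bb l Ql sl.
    by apply: subring0; apply: sB.
  by apply: Bb => //; rewrite sl.
have [u Su Aub] := common_denominator mSW Bb.
have [Wu pu] := Su; apply: (pyN u Wu pu); split; first exact: (subringM sW).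
exists (fun l => u * b l); split=> l Ql sl.
  by have := Aub l Ql; rewrite -sl; apply.
have /eqP := eb l Ql sl; rewrite subr_eq0 => /eqP e0.
by rewrite coboundM -e0 mulrA.
Qed.

End AffineCech.

(** * Extending a primitive over further members of the cover *)

Section Gluing.
Variables (k : closedFieldType) (X : variety k) (E : lmodType (function_field X)).
Variable M : X -> set E.
Notation K := (function_field X).
Notation sec := (sections (stalk X)).
Notation aff := (affine (stalk X) (scalars X)).

(** Over [W], the [O_X]-module with stalks [M x] is a direct summand of a
    finite free one. *)
Definition projective_over (W : set X) : Prop :=
  exists (N : finType) (P : E -> N -> K) (R : (N -> K) -> E),
    [/\ forall u v i, P (u - v) i = P u i - P v i
      & forall b b', R (fun i => b i - b' i) = R b - R b'] /\
    [/\ forall z u, W z -> M z u -> forall i, stalk X z (P u i),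
        forall z b, W z -> (forall i, stalk X z (b i)) -> M z (R b)
      & forall z u, W z -> M z u -> R (P u) = u].

Definition regular_over (T : finType) (V : T -> set X) (W : set X)
    (Q : pred T) s (c : seq T -> E) : Prop :=
  forall l, all Q l -> size l = s -> forall z, meet V W l z -> M z (c l).

(** The coordinates under [P] are cocycles of functions; [R] reassembles their primitives. *)
Lemma affine_cech_exact_module (T : finType) (Q : pred T) (V : T -> set X)
    (W : set X) e s (c : seq T -> E) :
  (forall j, Q j -> aff (V j)) -> aff W -> smooth X ->
  (forall y, W y -> (forall j, Q j -> ~ V j y) -> prime_chain (stalk X y) e) ->
  (s < e)%N -> projective_over W -> regular_over V W Q s c ->
  (forall l, all Q l -> size l = s.+1 -> cobound c l = 0) ->
  exists b, (forall l, all Q l -> (size l).+1 = s ->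
               forall z, meet V W l z -> M z (b l)) /\
            (forall l, all Q l -> size l = s -> c l = cobound b l).
Proof.
move=> aV aW smX dimV lt_se [N [P [R [[PB RB] [MP RM RP]]]]] Mc dc.
have P0 i : P 0 i = 0 by have := PB 0 0 i; rewrite !subrr.
have R0 : R (fun=> 0) = 0.
  have -> : (fun=> 0) = (fun _ : N => (0 : K) - 0).
    by apply: funext => i; rewrite subrr.
  by rewrite (RB (fun=> 0) (fun=> 0)) subrr.
have ex i : exists b : seq T -> K,
    pre_cochains Q s (fun l => sec (meet V W l)) b /\
    cochains Q s (fun=> [set 0]) (fun l => P (c l) i - cobound b l).
  apply: (affine_cech_exact aV aW smX dimV lt_se).
    move=> l Ql sl z mz; apply: MP (Mc l Ql sl z mz) i; exact: meet_sub mz.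
  move=> l Ql sl; rewrite (cobound_morph (f := fun u => P u i)) //.
  by rewrite dc // P0.
have /choice[b Hb] := ex.
exists (fun l => R (fun i => b i l)); split=> l Ql sl.
  move=> z mz; apply: RM; first exact: meet_sub mz.
  by move=> i; have [Ab _] := Hb i; apply: Ab.
have aml := meet_affine aV aW Ql.
(* Any point of the intersection serves to apply [RP]; the zero prime provides one. *)
have [z mz ez] := affine_point aml (zero_prime _).
rewrite -(RP z (c l) (meet_sub mz) (Mc l Ql sl z mz)).
have -> : P (c l) = fun i => cobound (b i) l.
  apply: funext => i; have [_ /(_ l Ql sl)/eqP] := Hb i.
  by rewrite subr_eq0 => /eqP.
elim: (l) (b) => [|j m IHm] b' /=; first exact: R0.
by rewrite RB IHm.
Qed.

(** Prepending [o] to [c] gives a primitive of [c], but one regular only inside [V o]. On lists over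
    [Q] it differs from [b] by a cocycle on [V o], that is, by some [cobound f]; subtracting this
    coboundary returns [b] on the lists without [o]. *)
Lemma glue_cochain (T : finType) (Q : pred T) (V : T -> set X) (o : T) e s
    (c b : seq T -> E) :
  smooth X -> (forall z, M z 0) -> (forall z u v, M z u -> M z v -> M z (u - v)) ->
  (forall j, Q j -> aff (V j)) -> aff (V o) -> projective_over (V o) ->
  (forall y, V o y -> (forall j, Q j -> ~ V j y) -> prime_chain (stalk X y) e) ->
  (s < e)%N -> let Q' := [pred j | Q j || (j == o)] in
  regular_over V setT Q' s.+1 c ->
  (forall l, all Q' l -> size l = s.+2 -> cobound c l = 0) ->
  regular_over V setT Q s b ->
  (forall l, all Q l -> size l = s.+1 -> cobound b l = c l) ->
  exists b', regular_over V setT Q' s b' /\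
    forall l, all Q' l -> size l = s.+1 -> cobound b' l = c l.
Proof.
move=> smX M0 MB aV ao proj dimV lt_se Q' Mc dc Mb db.
case: (boolP (Q o)) => [Qo|NQo].
  have QQ l : all Q' l -> all Q l.
    by apply: sub_all => j /orP[//|/eqP->].
  by exists b; split=> l /QQ; [apply: Mb|apply: db].
have QQ' l : all Q l -> all Q' l by apply: sub_all => j /= ->.
have Q'o : Q' o by rewrite /= eqxx orbT.
have meetT l z : meet V (V o) l z -> meet V setT (o :: l) z.
  by rewrite meet_cons => -[Voz Vl]; split=> //; split.
have [||f [Mf ef]] := @affine_cech_exact_module T Q V (V o) e s
    (fun l => c (o :: l) - b l) aV ao smX dimV lt_se proj.
- move=> l Ql sl z mz; apply: MB.
    by apply: Mc; [rewrite /= eqxx orbT QQ'|rewrite /= sl|apply: meetT].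
  by apply: (Mb l Ql sl); case: mz.
- move=> l Ql sl; rewrite coboundB cobound_cone db // dc ?subr0 ?subrr //=.
    by rewrite eqxx orbT QQ'.
  by rewrite sl.
(* With value zero on lists that contain [o], [cobound f'] agrees with [cobound f] on lists without
   [o], and on a list with [o] all its terms are regular on the intersection, which lies in
   [V o]. *)
pose f' (l : seq T) : E := if o \in l then 0 else f l.
exists (fun l => c (o :: l) - cobound f' l); split=> l Ql sl; last first.
  rewrite coboundB cobound_cobound subr0 cobound_cone dc ?subr0 //=.
    by rewrite eqxx orbT.
  by rewrite sl.
move=> z mz; case: (boolP (o \in l)) => ol.
  have mz' : meet V (V o) l z by case: mz => _ H; split=> //; apply: H.
  apply/MB; first by apply: Mc; rewrite /= ?eqxx ?orbT ?sl //; apply: meetT.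
  apply: (@cobound_ind _ _ (M z)) => [||l1 i l2 el]; [exact: M0|exact: MB|].
  rewrite /f'; case: ifPn => [_|ol12]; first exact: M0.
  have io : i = o.
    by move: ol ol12; rewrite el !mem_cat inE; case: eqVneq => [->|_] //= ->.
  have [Ql1 Ql2] : all Q l1 /\ all Q l2.
    move: Ql ol12; rewrite el !all_cat mem_cat negb_or /= => /and3P[Q1 _ Q2].
    have sub m : all Q' m -> o \notin m -> all Q m.
      move=> /allP Qm om; apply/allP => j jm; have /orP[//|/eqP jo] := Qm j jm.
      by rewrite -jo jm in om.
    by move=> /andP[o1 o2]; rewrite !sub.
  apply: Mf; rewrite ?all_cat ?Ql1 //.
    by move: sl; rewrite el !size_cat /= addnS.
  by move: mz'; rewrite el; apply: meet_mono.
have {}Ql : all Q l.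
  apply/allP => j jl; have /orP[//|/eqP jo] := allP Ql j jl.
  by rewrite -jo jl in ol.
rewrite (eq_cobound (b := f)); last first.
  move=> l1 i l2 el; rewrite /f'; case: ifP => // ol12.
  by move: ol; rewrite el mem_cat inE; move: ol12; rewrite mem_cat => /orP[]->; rewrite ?orbT.
by rewrite -ef // subKr; apply: Mb.
Qed.

Lemma glue_cochain_all (T : finType) (Q : pred T) (V : T -> set X) e s
    (c b : seq T -> E) :
  smooth X -> (forall z, M z 0) -> (forall z u v, M z u -> M z v -> M z (u - v)) ->
  (forall j, aff (V j)) -> (forall j, projective_over (V j)) ->
  (forall y, (forall j, Q j -> ~ V j y) -> prime_chain (stalk X y) e) ->
  (s < e)%N -> regular_over V setT xpredT s.+1 c ->
  (forall l, size l = s.+2 -> cobound c l = 0) ->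
  regular_over V setT Q s b ->
  (forall l, all Q l -> size l = s.+1 -> cobound b l = c l) ->
  exists b', regular_over V setT xpredT s b' /\
    forall l, size l = s.+1 -> cobound b' l = c l.
Proof.
move=> smX M0 MB aV proj dimV lt_se Mc dc Mb db.
suff [b' [Mb' db']] : exists b',
    regular_over V setT [pred j | Q j || (j \in enum T)] s b' /\
    forall l, all [pred j | Q j || (j \in enum T)] l -> size l = s.+1 ->
      cobound b' l = c l.
  have allT l : all [pred j | Q j || (j \in enum T)] l.
    by apply/allP => j _; rewrite /= mem_enum orbT.
  by exists b'; split=> [l _|l]; [apply: Mb'|apply: db'].
elim: (enum T) => [|o r [b' [Mb' db']]].
  have QE l : all [pred j | Q j || (j \in [::])] l = all Q l.
    by apply: eq_all => j /=; rewrite orbF.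
  by exists b; split=> l; rewrite QE; [apply: Mb|apply: db].
have Mc' Q' : regular_over V setT Q' s.+1 c.
  by move=> l _ sl; apply: Mc => //; apply: all_predT.
have aV' j : [pred j | Q j || (j \in r)] j -> aff (V j) by move=> _; apply: aV.
have dimV' y : V o y -> (forall j, [pred j | Q j || (j \in r)] j -> ~ V j y) ->
    prime_chain (stalk X y) e.
  by move=> _ Vy; apply: dimV => j Qj; apply: Vy; rewrite /= Qj.
have [b2 [Mb2 db2]] := glue_cochain smX M0 MB aV' (aV o) (proj o) dimV' lt_se
  (Mc' _) (fun l _ => dc l) Mb' db'.
have QE l : all [pred j | Q j || (j \in o :: r)] l =
    all [pred j | [pred j | Q j || (j \in r)] j || (j == o)] l.
  by apply: eq_all => j /=; rewrite inE orbA orbAC.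
by exists b2; split=> l; rewrite QE; [apply: Mb2|apply: db2].
Qed.

End Gluing.

(** * Products of consecutive differences *)

Section Telescope.
Variables (T : eqType) (V E : zmodType).
Implicit Types (Phi : seq V -> E) (eta mu theta : T -> V) (l : seq T) (x y : T).

Definition multi_additive m Phi : Prop := forall p s u v,
  (size p + size s).+1 = m -> Phi (p ++ (u - v) :: s) = Phi (p ++ u :: s) - Phi (p ++ v :: s).

Lemma multi_additive_cons m Phi u : multi_additive m.+1 Phi ->
  multi_additive m (fun s => Phi (u :: s)).
Proof. by move=> H p s v w e; rewrite -!cat_cons H //= -e. Qed.

Fixpoint steps_from eta x l : seq V :=
  if l is y :: l' then (eta y - eta x) :: steps_from eta y l' else [::].

Definition steps eta l : seq V :=
  if l is x :: l' then steps_from eta x l' else [::].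

Lemma size_steps_from eta x l : size (steps_from eta x l) = size l.
Proof. by elim: l x => //= y l IHl x; rewrite IHl. Qed.

(** Deleting an index merges two neighbouring steps, and additivity makes the alternating sum
    telescope. *)
Lemma cobound_steps_from m Phi eta x l : multi_additive m Phi ->
  size l = m.+1 -> cobound (fun r => Phi (steps_from eta x r)) l = Phi (steps eta l).
Proof.
elim: m Phi x l => [|m IHm] Phi x [|y [|z l]] //= MA; first by rewrite subr0.
case=> sl.
have /= -> := IHm _ y (z :: l) (multi_additive_cons (eta y - eta x) MA)
  (congr1 succn sl).
have MA' u v : Phi ((u - v) :: steps_from eta z l) =
    Phi (u :: steps_from eta z l) - Phi (v :: steps_from eta z l).
  by apply: (MA [::]); rewrite /= size_steps_from sl.
by rewrite -MA' opprB addrA subrK.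
Qed.

Lemma cobound_steps m Phi eta l : multi_additive m Phi -> size l = m.+2 ->
  cobound (fun r => Phi (steps eta r)) l = 0.
Proof.
case: l => //= x l MA [sl].
by rewrite (cobound_steps_from _ _ MA sl) subrr.
Qed.

Variables (eta mu theta : T -> V).
Hypothesis thetaE : forall x, theta x = eta x - mu x.

(** Replaces the steps of [eta] by those of [mu] one at a time:
    [sum_a (-1)^a Phi (mu-steps up to l_a, theta l_a, eta-steps from l_a)]. *)
Fixpoint homotopy Phi l : E :=
  if l is x :: l' then Phi (theta x :: steps_from eta x l') -
    homotopy (fun s => Phi ((mu (head x l') - mu x) :: s)) l' else 0.

Lemma homotopyB m Phi u v l : multi_additive m.+1 Phi -> size l = m ->
  homotopy (fun s => Phi ((u - v) :: s)) l =
  homotopy (fun s => Phi (u :: s)) l - homotopy (fun s => Phi (v :: s)) l.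
Proof.
move=> MA.
suff H P1 P2 P3 : (forall s : seq V, size s = m -> P1 s = P2 s - P3 s) ->
    size l = m -> homotopy P1 l = homotopy P2 l - homotopy P3 l.
  by apply: H => s ss; apply: (MA [::]); rewrite /= ss.
move: P1 P2 P3 {MA}.
elim: l m => [|x l IHl] [|m] // P1 P2 P3 H; first by rewrite /= subrr.
move=> [sl] /=; rewrite H; last by rewrite /= size_steps_from sl.
rewrite (IHl m _ (fun s => P2 ((mu (head x l) - mu x) :: s))
  (fun s => P3 ((mu (head x l) - mu x) :: s))) //; last first.
  by move=> s ss; apply: H; rewrite /= ss.
by rewrite !opprB addrACA [RHS]addrACA; congr (_ + _); rewrite addrC.
Qed.

Lemma cobound_homotopy m Phi l : multi_additive m Phi -> size l = m.+1 ->
  cobound (homotopy Phi) l = Phi (steps eta l) - Phi (steps mu l).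
Proof.
elim: m Phi l => [|m IHm] Phi [|x [|y l]] //= MA; first by rewrite !subrr.
case=> sl.
(* The step [mu (head x r) - mu x] varies with the head of [r]. Additivity splits it into [K], which
   does not involve [x], and a part with the fixed entry [mu x]; the induction hypothesis is used
   with [mu x] and with [mu y] in front. *)
pose K r := homotopy (fun s => Phi (mu (head x r) :: s)) r.
have MA1 u : multi_additive m (fun s => Phi (u :: s)) by apply: multi_additive_cons.
have head_ r z : homotopy (fun s => Phi (mu (head z r) :: s)) r = K r.
  by case: r.
have E1 : cobound (fun r => homotopy Phi (x :: r)) (y :: l) =
    Phi (theta x :: steps_from eta y l) - (cobound K (y :: l) -
    cobound (homotopy (fun s => Phi (mu x :: s))) (y :: l)).
  rewrite -coboundB -(cobound_steps_from eta x (MA1 (theta x)) (l := y :: l)) /= ?sl //.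
  rewrite -[LHS]/(cobound (fun r => homotopy Phi (x :: r)) (y :: l)).
  rewrite -[RHS]/(cobound (fun r => Phi (theta x :: steps_from eta x r)) (y :: l) -
    cobound (fun r => K r - homotopy (fun s => Phi (mu x :: s)) r) (y :: l)).
  rewrite -coboundB; apply: eq_cobound => l1 z l2 el /=.
  rewrite (homotopyB _ _ MA) ?head_ //.
  by have := congr1 size el; rewrite /= !size_cat /= addnS sl => -[].
have E2 : cobound K (y :: l) =
    K l - homotopy (fun s => Phi (mu y :: s)) l +
    cobound (homotopy (fun s => Phi (mu y :: s))) (y :: l).
  set G := homotopy (fun s => Phi (mu y :: s)).
  rewrite -[LHS]/(K l - cobound (fun r => G (y :: r)) l) cobound_cone.
  by rewrite opprB addrA addrAC.
rewrite -[LHS]/(homotopy Phi (y :: l) - cobound (fun r => homotopy Phi (x :: r)) (y :: l)).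
rewrite E1 E2 (IHm _ _ (MA1 _)) ?(IHm _ _ (MA1 _)) /= ?sl //.
rewrite (homotopyB _ _ MA) // head_.
have add1 s u v : size s = m -> Phi ((u - v) :: s) = Phi (u :: s) - Phi (v :: s).
  by move=> ss; apply: (MA [::]); rewrite /= ss.
rewrite !thetaE !add1 ?size_steps_from //.
set K1 := K l; set K2 := homotopy _ _.
rewrite !(opprB, opprD) !addrA.
move: (Phi (eta y :: _)) (Phi (mu y :: steps_from eta y l)) (Phi (eta x :: _))
  (Phi (mu x :: steps_from eta y l)) (Phi (mu y :: steps_from mu y l))
  (Phi (mu x :: steps_from mu y l)) K1 K2 => a b c d e f g h.
by rewrite !subrK addrK !subrK addrAC [a - e - c]addrAC addrAC.
Qed.

Lemma homotopy_ind (N : E -> Prop) (R : V -> Prop) Phi l :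
  N 0 -> (forall u v, N u -> N v -> N (u - v)) ->
  (forall s, (forall u, u \in s -> R u) -> N (Phi s)) ->
  {in l, forall x, R (theta x)} ->
  {in l &, forall x y, R (eta y - eta x) /\ R (mu y - mu x)} ->
  N (homotopy Phi l).
Proof.
move=> N0 NB; elim: l Phi => //= x l IHl Phi NPhi Rth Rst; apply/NB.
  apply: NPhi => u; rewrite inE => /predU1P[->|].
    by apply: Rth; apply: mem_head.
  elim: l x Rst {IHl Rth} => //= y l IHl x Rst; rewrite inE => /predU1P[->|].
    by apply: (Rst x y _ _).1; rewrite !inE eqxx ?orbT.
  by apply: IHl => a b al bl; apply: Rst; rewrite inE ?al ?bl orbT.
case: l IHl Rth Rst => [//|y l] IHl Rth Rst; apply: IHl.
- move=> s Rs; apply: NPhi => u; rewrite inE => /predU1P[->|/Rs//].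
  by apply: (Rst x y _ _).2; rewrite !inE eqxx ?orbT.
- by move=> a al; apply: Rth; rewrite inE al orbT.
- by move=> a b al bl; apply: Rst; rewrite inE ?al ?bl orbT.
Qed.

End Telescope.

(** * Local coordinates *)

Section DerivationTheory.
Variables (k : closedFieldType) (X : variety k).
Notation K := (function_field X).
Notation Der := (derivation (scalars X)).
Implicit Types (D E : Der) (a b f : K).

Lemma derD D a b : D (a + b) = D a + D b.
Proof. by have /asboolP[H _ _] := der_funP D; apply: H. Qed.

Lemma derM D a b : D (a * b) = a * D b + b * D a.
Proof. by have /asboolP[_ H _] := der_funP D; apply: H. Qed.

Lemma der_scalar D c : D (scalars X c) = 0.
Proof. by have /asboolP[_ _ H] := der_funP D; apply: H. Qed.

Lemma der0 D : D 0 = 0.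
Proof. by rewrite -[in LHS](rmorph0 (scalars X)) der_scalar. Qed.

Lemma der1 D : D 1 = 0.
Proof. by rewrite -(rmorph1 (scalars X)) der_scalar. Qed.

Lemma derB D a b : D (a - b) = D a - D b.
Proof. by apply/eqP; rewrite eq_sym subr_eq -derD subrK. Qed.

Lemma der_sum D (I : Type) (r : seq I) (P : pred I) (F : I -> K) :
  D (\sum_(i <- r | P i) F i) = \sum_(i <- r | P i) D (F i).
Proof. by elim/big_rec2: _ => [|i x y _ <-]; [exact: der0|exact: derD]. Qed.

Lemma derV D a : a != 0 -> D a^-1 = - (a ^- 2 * D a).
Proof.
move=> a0; have /eqP := derM D a a^-1; rewrite divff // der1 eq_sym addr_eq0 => /eqP e.
by rewrite -[LHS](mulKf a0) e mulrN mulrA -expr2 exprVn.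
Qed.

Lemma derivation_linear a D E f : (a *: D + E) f = a * D f + E f.
Proof. by []. Qed.

Lemma derivation_ext D E : (forall f, D f = E f) -> D = E.
Proof. by move=> H; apply: val_inj; apply: funext => f; apply: H. Qed.

Lemma derZE a D f : (a *: D) f = a * D f. Proof. by []. Qed.

Lemma derAE D E f : (D + E) f = D f + E f. Proof. by []. Qed.

Lemma derBE D E f : (D - E) f = D f - E f. Proof. by []. Qed.

Lemma derivation_sum (I : Type) (r : seq I) (P : pred I) (F : I -> Der) f :
  (\sum_(i <- r | P i) F i) f = \sum_(i <- r | P i) F i f.
Proof. by elim/big_rec2: _ => // i x y _ <-. Qed.

Lemma dlogM D a b : a != 0 -> b != 0 -> D (a * b) / (a * b) = D a / a + D b / b.
Proof. by move=> a0 b0; rewrite derM; field; rewrite a0 b0. Qed.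

(** The relation [df = \sum_j h_j dg_j] over [R], tested on the derivations of [K] in place of a
    module of Kaehler differentials. *)
Definition diff_span (R : set K) m (g : 'I_m -> K) f : Prop :=
  exists h : 'I_m -> K, (forall j, R (h j)) /\ forall D, D f = \sum_j h j * D (g j).

Section DiffSpan.
Variables (R : set K) (m : nat) (g : 'I_m -> K).
Hypothesis sR : subring R.

Lemma diff_span_scalar c : diff_span R g (scalars X c).
Proof.
exists (fun=> 0); split=> [j|D]; first exact: subring0.
by rewrite der_scalar big1 // => j _; rewrite mul0r.
Qed.

Lemma diff_span_gen i : diff_span R g (g i).
Proof.
exists (fun j => (j == i)%:R); split=> [j|D].
  by case: (j == i); [case: sR|apply: subring0].
by rewrite (bigD1 i) //= eqxx mul1r big1 ?addr0 // => j /negPf->; rewrite mul0r.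
Qed.

Lemma diff_span_comb (a b f1 f2 f : K) : R a -> R b ->
  diff_span R g f1 -> diff_span R g f2 ->
  (forall D, D f = a * D f1 + b * D f2) -> diff_span R g f.
Proof.
move=> Ra Rb [h1 [Rh1 e1]] [h2 [Rh2 e2]] e.
exists (fun j => a * h1 j + b * h2 j); split=> [j|D].
  by apply: (subringD sR); apply: (subringM sR).
rewrite e e1 e2 !mulr_sumr -big_split; apply: eq_bigr => j _ /=.
by rewrite mulrDl !mulrA.
Qed.

Lemma diff_spanB f1 f2 : diff_span R g f1 -> diff_span R g f2 ->
  diff_span R g (f1 - f2).
Proof.
have [R1 _ _] := sR; move=> d1 d2.
apply: (@diff_span_comb 1 (- 1) f1 f2) => //; first exact: (subringN sR).
by move=> D; rewrite derB mul1r mulN1r.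
Qed.

Lemma diff_spanM f1 f2 : R f1 -> R f2 -> diff_span R g f1 -> diff_span R g f2 ->
  diff_span R g (f1 * f2).
Proof.
move=> R1 R2 d1 d2; apply: (@diff_span_comb f1 f2 f2 f1) => //.
by move=> D; rewrite derM.
Qed.

Lemma diff_spanV f : R f^-1 -> f != 0 -> diff_span R g f -> diff_span R g f^-1.
Proof.
move=> Rf f0 df; apply: (@diff_span_comb (- f ^- 2) 0 f f) => //.
- by apply: (subringN sR); rewrite -exprVn; apply: (subringX 2 sR).
- exact: subring0.
- by move=> D; rewrite derV // mul0r addr0 mulNr.
Qed.

End DiffSpan.

Lemma diff_span_trans (R R' : set K) m (g : 'I_m -> K) m' (g' : 'I_m' -> K) f :
  subring R' -> R `<=` R' -> diff_span R g f ->
  (forall j, diff_span R' g' (g j)) -> diff_span R' g' f.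
Proof.
move=> sR' RR' [h [Rh eh]] /choice[h' Hh'].
exists (fun i => \sum_j h j * h' j i); split=> [i|D].
  apply: subring_sum => // j _; apply: (subringM sR'); first exact: RR'.
  by have [H _] := Hh' j; apply: H.
rewrite eh; under eq_bigr => j _ do rewrite (Hh' j).2 mulr_sumr.
rewrite exchange_big; apply: eq_bigr => i _; rewrite mulr_suml.
by apply: eq_bigr => j _; rewrite mulrA.
Qed.

Notation sec := (sections (stalk X)).
Notation pt := (prime_at (stalk X)).
Notation aff := (affine (stalk X) (scalars X)).
Implicit Types (U W : set X) (x y z : X).

Lemma affine_diff_span U : aff U -> exists m (g : 'I_m -> K),
  (forall i, sec U (g i)) /\
  forall f, sec U f -> diff_span (sec U) g f.
Proof.
move=> [[_ [m [g [_ gA minA]]] _] _]; have sA := subring_sections U.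
exists m, g; split=> [i|f Af]; first by apply: gA; exists i.
have : (sec U `&` [set f | diff_span (sec U) g f]) f; last by case.
apply: minA Af.
  split=> [c|a b [Aa da] [Ab db]|a b [Aa da] [Ab db]]; split.
  - exact: sections_scalars.
  - exact: diff_span_scalar.
  - by case: sA => _ AB _; apply: AB.
  - exact: diff_spanB.
  - exact: (subringM sA).
  - exact: diff_spanM.
move=> _ [i _ <-]; split; first by apply: gA; exists i.
exact: diff_span_gen.
Qed.

Lemma stalk_diff_span x (U : set X) m (g : 'I_m -> K) m' (g' : 'I_m' -> K) :
  aff U -> U x -> (forall f, sec U f -> diff_span (sec U) g f) ->
  (forall j, diff_span (stalk X x) g' (g j)) ->
  forall f, stalk X x f -> diff_span (stalk X x) g' f.
Proof.
move=> aU Ux gspan g'g f Of; have sO := stalk_subring x.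
have AO : sec U `<=` stalk X x by move=> a; apply.
have aspan a : sec U a -> diff_span (stalk X x) g' a.
  by move=> /gspan H; apply: diff_span_trans H g'g.
have [s [As ps] Asf] := stalk_fraction aU Ux Of.
have [Os s0 Osi] := prime_at_unit As Ux ps.
rewrite -(mulKf s0 f); apply: (diff_spanM sO) => //; first exact: AO.
  by apply: (diff_spanV sO) => //; apply: aspan.
exact: aspan.
Qed.

(** At a rational point the differentials of generators of the maximal
    ideal generate the module of differentials, by Nakayama's lemma. *)
Lemma max_ideal_diff_span U x d (t : 'I_d -> K) : aff U -> U x ->
  (forall a, sec U a -> exists c, pt U x (a - scalars X c)) ->
  (forall i, nonunits (stalk X x) (t i)) ->
  (forall a, nonunits (stalk X x) a -> exists c : 'I_d -> K,
     (forall i, stalk X x (c i)) /\ a = \sum_i c i * t i) ->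
  forall f, stalk X x f -> diff_span (stalk X x) t f.
Proof.
move=> aU Ux rat mt gent; have [m [g [Ag gspan]]] := affine_diff_span aU.
have sO := stalk_subring x; have lO := stalk_local x.
have [mR m0 mD mM] := lO.2.
have AO : sec U `<=` stalk X x by move=> a; apply.
have gO f : stalk X x f -> diff_span (stalk X x) g f.
  by apply: (stalk_diff_span aU Ux gspan) => j; apply: diff_span_gen.
apply: (stalk_diff_span aU Ux gspan).
pose N : set (Der -> K^o) := [set u | exists c : 'I_d -> K,
  (forall i, stalk X x (c i)) /\ u = fun D => \sum_i c i * D (t i)].
have sN : submodule (stalk X x) N.
  split.
  - exists (fun=> 0); split=> [i|]; first exact: subring0.
    by apply: funext => D; rewrite big1 // => i _; rewrite mul0r.
  - move=> _ _ [c [Oc ->]] [c' [Oc' ->]]; exists (fun i => c i + c' i).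
    split=> [i|]; first exact: (subringD sO).
    apply: funext => D; rewrite -[LHS]/(_ + _ : K) -big_split.
    by apply: eq_bigr => i _; rewrite mulrDl.
  - move=> a _ Oa [c [Oc ->]]; exists (fun i => a * c i).
    split=> [i|]; first exact: (subringM sO).
    apply: funext => D; rewrite -[LHS]/(a * _ : K) mulr_sumr.
    by apply: eq_bigr => i _; rewrite mulrA.
suff Ng : forall j, N (fun D => D (g j)).
  by move=> j; have [c [Oc ec]] := Ng j; exists c; split=> // D; have := congr1 (@^~ D) ec.
apply: (@nakayama K (stalk X x) _ N m (fun j D => D (g j)) lO sN) => j.
have [a [_ Na]] := rat _ (Ag j).
(* [g j] minus its value [a] at the rational point is [\sum_l e_l t_l]. Its differential is a
   combination of the [dt_l] plus [\sum_l t_l de_l], whose coefficients on the [dg_i] lie in the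
   maximal ideal. *)
have /gent[e [Oe ee]] : nonunits (stalk X x) (g j - scalars X a).
  split=> //; case: sO => _ OB _; apply: OB; first exact: AO.
  by case: (stalk_subalgebra x).
have /choice[h Hh] : forall l, exists h : 'I_m -> K, (forall i, stalk X x (h i)) /\
    forall D, D (e l) = \sum_i h i * D (g i).
  by move=> l; have [h H] := gO _ (Oe l); exists h.
exists (fun i => \sum_l h l i * t l); split=> [i|].
  by apply: (ideal_sum _ lO.2) => l _; apply: mM; [case: (Hh l)|].
exists e; split=> //; apply: funext => D.
rewrite -[LHS]/(D (g j) - (\sum_i (\sum_l h l i * t l) *:
    ((fun D : Der => D (g i)) : Der -> K^o)) D : K).
have -> : (\sum_i (\sum_l h l i * t l) *:
    ((fun D : Der => D (g i)) : Der -> K^o)) D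
    = \sum_i (\sum_l h l i * t l) * D (g i).
  by rewrite fct_sumE.
have -> : D (g j) = \sum_l (e l * D (t l) + t l * D (e l)).
  have -> : D (g j) = D (g j - scalars X a) by rewrite derB der_scalar subr0.
  by rewrite ee der_sum; apply: eq_bigr => l _; rewrite derM.
rewrite big_split /= [X in _ + X - _](_ : _ = \sum_i (\sum_l h l i * t l) * D (g i)).
  by rewrite addrK.
under eq_bigr => l _ do rewrite (Hh l).2 mulr_sumr.
rewrite exchange_big; apply: eq_bigr => i _; rewrite mulr_suml.
by apply: eq_bigr => l _; rewrite mulrCA mulrA.
Qed.

(** ** Dual bases *)

Definition independent m (v : 'I_m -> Der) : Prop :=
  forall c : 'I_m -> K, \sum_i c i *: v i = 0 -> forall i, c i = 0.

(** A combination of the [v i] that kills every [t l] is zero, since the [dt_l] span. So the matrix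
    [v i (t l)] has independent rows; with [d <= m] it is square, and its inverse turns [v] into
    derivations dual to [t]. *)
Lemma independent_dual m (v : 'I_m -> Der) d (t : 'I_d -> K) : independent v ->
  (forall f, diff_span setT t f) -> (d <= m)%N ->
  exists delta : 'I_d -> Der, d = m /\
    forall i j, delta i (t j) = (i == j)%:R.
Proof.
move=> iv tspan le_dm; pose A := \matrix_(i < m, l < d) v i (t l).
have freeA : row_free A.
  apply/row_freeP; apply/row_freeP; rewrite -kermx_eq0; apply/eqP/row_matrixP => i.
  rewrite row0; set u := row i _.
  have uA : u *m A = 0 by apply/sub_kermxP; apply: row_sub.
  have u0 : \sum_j (u 0 j : K) *: v j = 0.
    apply: derivation_ext => f; have [h [_ eh]] := tspan f.
    rewrite derivation_sum eh.
    have E l : \sum_j u 0 j * v j (t l) = 0.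
      have /rowP/(_ l) := uA; rewrite !mxE => e; rewrite -[RHS]e.
      by apply: eq_bigr => j _; rewrite [A j l]mxE.
    rewrite [RHS]big1; last by move=> l _; rewrite -[(0 : Der) _]/(0 : K) mulr0.
    under eq_bigr => j _ do rewrite derZE eh mulr_sumr.
    rewrite exchange_big big1 // => l _.
    under eq_bigr => j _ do rewrite mulrCA.
    by rewrite -mulr_sumr E mulr0.
  by apply/rowP => j; rewrite [RHS]mxE; apply: iv u0 j.
have emd : d = m.
  by apply/eqP; rewrite eqn_leq le_dm -{1}(eqP freeA) rank_leq_col.
subst m; have uA : A \in unitmx by rewrite -row_free_unit.
exists (fun i => \sum_j (invmx A i j : K) *: v j); split=> // i l.
rewrite derivation_sum; have /matrixP/(_ i l) := mulVmx uA.
rewrite !mxE => <-; apply: eq_bigr => j _.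
by rewrite derZE [A j l]mxE.
Qed.

(** Etale coordinates on [W], given together with the dual vector fields. *)
Definition coordinates W n (t : 'I_n -> K) (delta : 'I_n -> Der) : Prop :=
  [/\ forall i j, delta i (t j) = (i == j)%:R,
      forall f D, D f = \sum_i delta i f * D (t i),
      forall z i, W z -> stalk X z (t i)
    & forall z i f, W z -> stalk X z f -> stalk X z (delta i f)].

(** Regular parameters at a rational specialization [x] of [y] generate the differentials there and
    have dual derivations. Both are regular on a basic neighbourhood of [x], which contains the
    generalization [y]. *)
Lemma coordinates_exist m (v : 'I_m -> Der) y : smooth X -> independent v ->
  (forall x d, prime_chain (stalk X x) d -> (d <= m)%N) ->
  exists n (t : 'I_n -> K) (delta : 'I_n -> Der) W,
    [/\ n = m, aff W, W y & coordinates W t delta].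
Proof.
move=> smX iv dimX; have [U aU Uy] := affine_cover y.
have [x [Ux pyx rat]] := rational_specialization aU Uy.
have [d [[chd _] [t [mt gent]]]] := smX x.
have lO := stalk_local x; have [mR m0 mD mM] := lO.2.
have tspanO := max_ideal_diff_span aU Ux rat mt gent.
have sT : @subring K setT by [].
have tspan f : diff_span setT t f.
  have Osp a : stalk X x a -> diff_span setT t a.
    by move=> /tspanO[h [_ eh]]; exists h.
  case: (aU) => [[_ _ /(_ f)[a [b [Aa Ab b0 ->]]]] _].
  apply: (diff_spanM sT) => //; first exact/Osp/Aa.
  by apply: (diff_spanV sT) => //; apply/Osp/Ab.
have [delta [edm Edelta]] := independent_dual iv tspan (dimX _ _ chd).
have Ddelta f D : D f = \sum_i delta i f * D (t i).
  have [h [_ eh]] := tspan f; rewrite eh; apply: eq_bigr => i _.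
  rewrite eh (bigD1 i) //= Edelta eqxx mulr1 big1 ?addr0 // => j ji.
  by rewrite Edelta eq_sym (negPf ji) mulr0.
have deltaO i f : stalk X x f -> stalk X x (delta i f).
  move=> /tspanO[h [Oh eh]]; rewrite eh; apply: (subring_sum _ lO.1) => j _.
  apply: (subringM lO.1) => //; rewrite Edelta.
  by case: (i == j); [case: lO.1|apply: (subring0 lO.1)].
have [m' [g [Ag gspan]]] := affine_diff_span aU.
have AO a : sec U a -> stalk X x a by move=> Aa; apply: Aa.
have mS := affine_mult aU Ux; have [SA S1 S0 SM] := mS.
have den (J : finType) (F : J -> K) : (forall j, stalk X x (F j)) ->
    exists2 u, (sec U `\` pt U x) u & forall j, sec U (u * F j).
  move=> OF; have /choice[u Hu] : forall j, exists u, (sec U `\` pt U x) u /\ sec U (u * F j).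
    by move=> j; have [u Su Au] := stalk_fraction aU Ux (OF j); exists u.
  have prodS (P : pred J) : (sec U `\` pt U x) (\prod_(j | P j) u j).
    by elim/big_rec: _ => // j w _ Sw; apply: SM => //; case: (Hu j).
  exists (\prod_j u j) => // j; rewrite (bigD1 j) //= mulrAC mulrC.
  apply: (subringM (subring_sections U)); last by case: (Hu j).
  exact/SA/prodS.
(* [u] clears the denominators of the [t i], and [u'] those of the finitely many [delta i (g j)];
   the latter determine [delta i] on each local ring by the quotient rule. *)
have [u [Au pu] Aut] := den _ t (fun i => mR _ (mt i)).
have [u' [Au' pu'] Aug] := den _ (fun ij : 'I_d * 'I_m' => delta ij.1 (g ij.2))
  (fun ij => deltaO _ _ (AO _ (Ag _))).
have [Auu puu] := SM _ _ (conj Au pu) (conj Au' pu').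
have uu0 : u * u' != 0 by apply: (mult_setN0 mS); split.
exists d, t, delta, (basic U (u * u')); split=> //; first exact: basic_affine.
  by apply: (affine_generalization aU Ux Uy pyx (basic_open aU Auu)); split.
have unit2 z : basic U (u * u') z -> unit_in (stalk X z) u /\ unit_in (stalk X z) u'.
  move=> [Uz pz]; have [Ouu _ Oi] := prime_at_unit Auu Uz pz.
  move: uu0; rewrite mulf_eq0 negb_or => /andP[u0 u'0].
  have sO := stalk_subring z; have [Ou Ou'] : stalk X z u /\ stalk X z u'.
    by split; [apply: Au|apply: Au'].
  split; split=> //.
    have -> : u^-1 = u' * (u * u')^-1 by rewrite invfM mulrCA divff // mulr1.
    exact: (subringM sO).
  have -> : u'^-1 = u * (u * u')^-1 by rewrite invfM mulVKf.
  exact: (subringM sO).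
split=> // [z i Dz|z i f0 Dz]; have [[Ou u0 Oui] [Ou' u'0 Ou'i]] := unit2 z Dz;
  have sO := stalk_subring z; have Uz := Dz.1.
- rewrite -(mulKf u0 (t i)); apply: (subringM sO) => //.
  exact: Aut.
- move=> /(stalk_fraction aU Uz)[s [As ps] Asf].
  have [Os s0 Osi] := prime_at_unit As Uz ps.
  have gO j : stalk X z (delta i (g j)).
    rewrite -(mulKf u'0 (delta i (g j))); apply: (subringM sO) => //.
    exact: (Aug (i, j)).
  have aO a : sec U a -> stalk X z (delta i a).
    move=> /gspan[h [Ah eh]]; rewrite eh; apply: (subring_sum _ sO) => j _.
    by apply: (subringM sO) => //; apply: Ah.
  rewrite -(mulKf s0 f0) derM derV //.
  apply: (subringD sO); first by apply: (subringM sO) => //; apply: aO.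
  apply: (subringM sO); first exact: Asf.
  apply: (subringN sO); apply: (subringM sO); last exact: aO.
  by rewrite -exprVn; apply: (subringX 2 sO).
Qed.

End DerivationTheory.

(** * Differential forms *)

Section Forms.
Variables (k : closedFieldType) (X : variety k).
Notation K := (function_field X).
Notation Der := (derivation (scalars X)).
Implicit Types (D E : Der) (a b f : K) (al : Der -> K) (z : X).

Definition linear_covector al : Prop :=
  forall a D E, al (a *: D + E) = a * al D + al E.

Definition regular_covector z al : Prop :=
  linear_covector al /\ forall D, tangent z D -> stalk X z (al D).

Lemma linear_covector0 al : linear_covector al -> al 0 = 0.
Proof.
move=> lal; have := lal 1 0 0; rewrite scale1r addr0 mul1r => /eqP.
by rewrite -subr_eq0 opprD addNKr oppr_eq0 => /eqP.
Qed.

Lemma linear_covector_sum al (I : Type) (r : seq I) (P : pred I) (c : I -> K)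
    (v : I -> Der) : linear_covector al ->
  al (\sum_(i <- r | P i) c i *: v i) = \sum_(i <- r | P i) c i * al (v i).
Proof.
move=> lal; elim/big_rec2: _ => [|i x y _ <-]; first exact: linear_covector0.
by rewrite lal.
Qed.

Lemma linear_covectorB al D E : linear_covector al -> al (D - E) = al D - al E.
Proof. by move=> lal; rewrite addrC -scaleN1r lal mulN1r addrC. Qed.

Lemma linear_differential f : linear_covector (differential f).
Proof. by []. Qed.

Lemma regular_differential z f : stalk X z f -> regular_covector z (differential f).
Proof. by move=> Of; split=> // D; apply. Qed.

Lemma regular_covectorB z al be : regular_covector z al -> regular_covector z be ->
  regular_covector z (al - be).
Proof.
move=> [la ra] [lb rb]; split=> [a D E|D tD].
  rewrite -[LHS]/(al _ - be _) -[(al - be) D]/(al D - be D) -[(al - be) E]/(al E - be E).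
  by rewrite la lb; ring.
by case: (stalk_subring z) => _ OB _; apply: OB; auto.
Qed.

Lemma stalk_det z s (A : 'M[K]_s) : (forall i j, stalk X z (A i j)) -> stalk X z (\det A).
Proof.
move=> OA; have sO := stalk_subring z; have [O1 _ _] := sO.
apply: (subring_sum _ sO) => p _; apply: (subringM sO).
  by case: odd_perm; rewrite ?expr0 ?expr1 //; apply: (subringN sO).
by elim/big_rec: _ => // i x _ Ox; apply: (subringM sO).
Qed.

Definition wedge_seq s (r : seq (Der -> K)) : form X s :=
  wedge (fun i : 'I_s => nth (fun=> 0) r i).

Lemma wedge_seq_multi_additive s : multi_additive s (@wedge_seq s).
Proof.
move=> p r u v e; apply: funext => D.
have lt_ps : (size p < s)%N by rewrite -e ltnS leq_addr.
have nth_ne w w' (i : 'I_s) : i != Ordinal lt_ps ->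
    nth (fun=> 0 : K) (p ++ w :: r) i = nth (fun=> 0) (p ++ w' :: r) i.
  rewrite -val_eqE /= !nth_cat; case: ltngtP => // lt_pi _.
  by rewrite -(subnSK lt_pi).
rewrite -[RHS]/(wedge _ D - wedge _ D : K) /wedge_seq /wedge.
set A := \matrix_(_, _) _; set B := \matrix_(_, _) _; set C := \matrix_(_, _) _.
rewrite -[\det B]mul1r -mulN1r.
apply: (@determinant_multilinear _ _ A B C (Ordinal lt_ps)).
- by apply/rowP => j; rewrite !mxE /= !nth_cat ltnn subnn /= mul1r mulN1r.
- by apply/matrixP => i j; rewrite !mxE (nth_ne u (u - v)) // eq_sym neq_lift.
- by apply/matrixP => i j; rewrite !mxE (nth_ne v (u - v)) // eq_sym neq_lift.
Qed.

Lemma Omega_stalk0 s z : @Omega_stalk _ X s z 0.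
Proof.
exists 0%N, (fun=> 0), (fun _ _ => 0); split; [by case|by case|].
by rewrite big_ord0.
Qed.

Lemma Omega_stalkD s z (u v : form X s) :
  Omega_stalk z u -> Omega_stalk z v -> Omega_stalk z (u + v).
Proof.
move=> [m [a [f [Oa Of ->]]]] [m' [a' [f' [Oa' Of' ->]]]].
exists (m + m')%N, (fun i => match fintype.split i with inl j => a j | inr j => a' j end),
  (fun i => match fintype.split i with inl j => f j | inr j => f' j end).
split=> [i|i l|]; [by case: fintype.split|by case: fintype.split|].
rewrite big_split_ord; congr (_ + _); apply: eq_bigr => i _.
  by rewrite (unsplitK (inl i)).
by rewrite (unsplitK (inr i)).
Qed.

Lemma Omega_stalkZ s z a (u : form X s) :
  stalk X z a -> Omega_stalk z u -> Omega_stalk z (a *: u).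
Proof.
move=> Oa [m [b [f [Ob Of ->]]]]; exists m, (fun j => a * b j), f; split=> // [j|].
  exact: (subringM (stalk_subring z)).
by rewrite scaler_sumr; apply: eq_bigr => j _; rewrite scalerA.
Qed.

Lemma Omega_stalkB s z (u v : form X s) :
  Omega_stalk z u -> Omega_stalk z v -> Omega_stalk z (u - v).
Proof.
move=> Ou Ov; apply: Omega_stalkD => //; rewrite -scaleN1r; apply: Omega_stalkZ => //.
by have [O1 _ _] := stalk_subring z; apply: (subringN (stalk_subring z)).
Qed.

Lemma Omega_stalk_sum s z (I : Type) (r : seq I) (P : pred I) (c : I -> K)
    (w : I -> form X s) : (forall i, P i -> stalk X z (c i)) ->
  (forall i, P i -> Omega_stalk z (w i)) ->
  Omega_stalk z (\sum_(i <- r | P i) c i *: w i).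
Proof.
move=> Oc Ow; elim/big_rec: _ => [|i x Pi Ox]; first exact: Omega_stalk0.
by apply: Omega_stalkD => //; apply: Omega_stalkZ; auto.
Qed.

Variables (W : set X) (n : nat) (t : 'I_n -> K) (delta : 'I_n -> Der).
Hypothesis coord : coordinates W t delta.

Lemma coordinates_tangent z i : W z -> tangent z (delta i).
Proof. by move=> Wz f Of; have [_ _ _ H] := coord; apply: H. Qed.

Lemma coordinates_expand D : D = \sum_i (D (t i) : K) *: delta i.
Proof.
have [_ H _ _] := coord; apply: derivation_ext => f.
by rewrite derivation_sum H; apply: eq_bigr => i _; rewrite derZE mulrC.
Qed.

Lemma covector_expand al D : linear_covector al ->
  al D = \sum_i al (delta i) * D (t i).
Proof.
move=> lal; rewrite {1}(coordinates_expand D) linear_covector_sum //.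
by apply: eq_bigr => i _; rewrite mulrC.
Qed.

Variable s : nat.
Implicit Types g h : {ffun 'I_s -> 'I_n}.

Definition dt (f : {ffun 'I_s -> 'I_n}) : form X s :=
  wedge (fun i => differential (t (f i))).

Definition dual_frame (f : {ffun 'I_s -> 'I_n}) : 'I_s -> Der :=
  fun i => delta (f i).

(** The multilinear expansion runs over all maps of indices, repetitions included; passing to a
    basis is left to [chosen_part]. *)
Lemma wedge_expand (al : 'I_s -> Der -> K) : (forall i, linear_covector (al i)) ->
  wedge al = \sum_(f : {ffun 'I_s -> 'I_n}) (\prod_i al i (delta (f i))) *: dt f.
Proof.
move=> lal; apply: funext => D; rewrite fct_sumE.
transitivity (\sum_(f : {ffun 'I_s -> 'I_n}) (\prod_i al i (delta (f i))) * dt f D : K); last by [].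
rewrite /wedge /determinant.
under eq_bigr => p _.
  under eq_bigr => i _ do rewrite mxE (covector_expand _ (lal i)).
  rewrite bigA_distr_bigA mulr_sumr; over.
rewrite exchange_big /=; apply: eq_bigr => f _.
rewrite /dt /wedge /determinant mulr_sumr; apply: eq_bigr => p _.
rewrite big_split mulrCA; congr (_ * (_ * _)).
by apply: eq_bigr => i _; rewrite mxE.
Qed.

Lemma wedge_Omega z (al : 'I_s -> Der -> K) : W z ->
  (forall i, regular_covector z (al i)) -> Omega_stalk z (wedge al).
Proof.
move=> Wz ral; rewrite wedge_expand; last by move=> i; case: (ral i).
have sO := stalk_subring z.
apply: Omega_stalk_sum => f _.
  elim/big_rec: _ => [|i x _ Ox]; first by case: sO.
  apply: (subringM sO) => //; have [_ H] := ral i.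
  exact/H/coordinates_tangent.
exists 1%N, (fun=> 1), (fun _ i => t (f i)); split; first by case: sO.
  by move=> _ i; have [_ _ H _] := coord; apply: H.
by rewrite big_ord1 scale1r.
Qed.

(** One injective enumeration is selected for each [s]-subset of the
    coordinates, so that the corresponding [dt f] form a basis. *)
Definition chosen (f : {ffun 'I_s -> 'I_n}) : bool :=
  injectiveb f && ([pick g : {ffun 'I_s -> 'I_n} |
    injectiveb g && (g @: [set: 'I_s] == f @: [set: 'I_s])] == Some f).

Lemma chosen_inj g h : chosen g -> chosen h ->
  g @: [set: 'I_s] = h @: [set: 'I_s] -> g = h.
Proof.
move=> /andP[_ /eqP pg] /andP[_ /eqP ph] e.
by move: pg; rewrite e ph => -[].
Qed.

Lemma chosen_exists g : injective g -> exists2 h, chosen h &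
  h @: [set: 'I_s] = g @: [set: 'I_s].
Proof.
move=> injg; set S := g @: _.
case E : [pick h : {ffun 'I_s -> 'I_n} | injectiveb h && (h @: [set: 'I_s] == S)] => [h|].
  have /andP[ih /eqP eh] : injectiveb h && (h @: [set: 'I_s] == S).
    by move: E; case: pickP => // h' Ph [<-].
  by exists h; rewrite // /chosen ih eh E eqxx.
move: E; case: pickP => // /(_ g) /=; rewrite eqxx andbT => /negP[].
exact/injectiveP.
Qed.

Lemma dt_dual g : injective g -> dt g (dual_frame g) = 1.
Proof.
move=> injg; have [H _ _ _] := coord.
rewrite -[RHS](det1 K s) /dt /wedge; congr (\det _); apply/matrixP => i j.
by rewrite !mxE /differential H (inj_eq injg) eq_sym.
Qed.

Lemma dt_dual0 g h : ~~ (g @: [set: 'I_s] \subset h @: [set: 'I_s]) ->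
  dt g (dual_frame h) = 0.
Proof.
case/subsetPn => _ /imsetP[i _ ->] gi; have [H _ _ _] := coord.
rewrite /dt /wedge (expand_det_row _ i) big1 // => j _.
rewrite !mxE /differential H; case: eqP => [e|_]; last by rewrite mul0r.
by move: gi; rewrite -e imset_f ?in_setT.
Qed.

Lemma dt_perm g h : injective g -> g @: [set: 'I_s] = h @: [set: 'I_s] ->
  exists c : K, dt g = c *: dt h.
Proof.
move=> injg e; have ex i : exists j, g i == h j.
  have : g i \in h @: [set: 'I_s] by rewrite -e imset_f ?in_setT.
  by case/imsetP => j _ ->; exists j.
pose p i := xchoose (ex i); have pE i : g i = h (p i) by apply/eqP/(xchooseP (ex i)).
have injp : injective p by move=> i j eij; apply: injg; rewrite !pE eij.
exists ((-1) ^+ perm injp); apply: funext => D.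
rewrite -[RHS]/(_ * dt h D : K) -det_perm /dt /wedge -det_mulmx -row_permE.
by congr (\det _); apply/matrixP => i j; rewrite !mxE permE pE.
Qed.

Lemma dt_noninj g : ~ injective g -> dt g = 0.
Proof.
move=> Ninj; have [i [j [eij /eqP ij]]] : exists i j, g i = g j /\ i <> j.
  apply: contrapT => H; apply: Ninj => i j e; apply: contrapT => ij.
  by apply: H; exists i, j.
apply: funext => D; apply: (determinant_alternate ij) => l.
by rewrite !mxE eij.
Qed.

Definition chosen_part (w : form X s) : form X s :=
  \sum_(g | chosen g) (w (dual_frame g) : K) *: dt g.

Lemma chosen_part_sum (I : Type) (r : seq I) (P : pred I) (c : I -> K)
    (w : I -> form X s) :
  chosen_part (\sum_(i <- r | P i) c i *: w i) =
  \sum_(i <- r | P i) c i *: chosen_part (w i).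
Proof.
rewrite /chosen_part; under [RHS]eq_bigr => i _ do rewrite scaler_sumr.
rewrite exchange_big; apply: eq_bigr => g _ /=; rewrite fct_sumE scaler_suml.
by apply: eq_bigr => i _; rewrite scalerA.
Qed.

Lemma chosen_part_dt g : chosen_part (dt g) = dt g.
Proof.
case: (pselect (injective g)) => injg; last first.
  by rewrite (dt_noninj injg) /chosen_part big1 // => h _; rewrite scale0r.
have [h ch eh] := chosen_exists injg.
have injh : injective h by case/andP: ch => /injectiveP.
have [c ec] := dt_perm injg (esym eh).
rewrite ec /chosen_part (bigD1 h) //= big1 ?addr0 => [|h' /andP[ch' ne]].
  by rewrite -[X in X *: _]/(c * dt h (dual_frame h) : K) dt_dual // mulr1.
rewrite -[X in X *: _]/(c * dt h (dual_frame h') : K) dt_dual0.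
  by rewrite mulr0 scale0r.
apply: contra ne => sub; apply/eqP; apply: chosen_inj => //.
have injh' : injective h' by case/andP: ch' => /injectiveP.
by apply/esym/eqP; rewrite eqEcard sub (card_imset _ injh) (card_imset _ injh') leqnn.
Qed.

(** [P] evaluates a form on the dual frames and [R] recombines the values over the chosen index
    maps. The composite is [chosen_part], which fixes every [dt g]. *)
Lemma projective_Omega : projective_over (@Omega_stalk _ X s) W.
Proof.
exists {ffun 'I_s -> 'I_n}, (fun w g => w (dual_frame g)),
  (fun c => \sum_(g | chosen g) c g *: dt g); split; split.
- by [].
- move=> b b'; rewrite -sumrB; apply: eq_bigr => g _.
  by rewrite scalerBl.
- move=> z u Wz [m [a [f [Oa Of ->]]]] g; have sO := stalk_subring z.
  rewrite fct_sumE; apply: (subring_sum _ sO) => j _.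
  apply: (subringM sO (Oa j)); apply: stalk_det => i l; rewrite mxE.
  by have [_ _ _ H] := coord; apply: H.
- move=> z b Wz Ob; apply: Omega_stalk_sum => // g _.
  apply: wedge_Omega => // i; apply: regular_differential.
  by have [_ _ H _] := coord; apply: H.
- move=> z u Wz [m [a [f [_ _ ->]]]]; rewrite -/(chosen_part _) chosen_part_sum.
  apply: eq_bigr => j _; congr (_ *: _).
  rewrite wedge_expand; last by move=> i; apply: linear_differential.
  rewrite chosen_part_sum; apply: eq_bigr => g _.
  by rewrite chosen_part_dt.
Qed.

End Forms.

(** * Foliations *)

Section FoliationTheory.
Variables (k : closedFieldType) (X : variety k) (F : foliation X).
Notation K := (function_field X).
Notation Der := (derivation (scalars X)).
Notation G := (generic_fibre F).
Implicit Types (D E : Der) (a b f : K) (z y : X).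

Lemma lieE D E f : lie_bracket D E f = D (E f) - E (D f).
Proof. by []. Qed.

Lemma lie_linear_l a D D' E f :
  lie_bracket (a *: D + D') E f =
  a * lie_bracket D E f + lie_bracket D' E f - E a * D f.
Proof. by rewrite !lieE !derivation_linear derD derM; ring. Qed.

Lemma tangent_lie z D E : tangent z D -> tangent z E -> tangent z (lie_bracket D E).
Proof.
move=> tD tE f Of; case: (stalk_subring z) => _ OB _.
by apply: OB; [apply/tD/tE|apply/tE/tD].
Qed.

Lemma fol_stalk_generic y z : (forall V, open V -> V y -> V z) ->
  stalk X z = setT -> F y `<=` F z.
Proof.
move=> gen Ez; have [U [oU Uy [m [e eF]]]] := fol_coherent F y.
move=> D; rewrite (eF y Uy) (eF z (gen U oU Uy)) => -[a [_ ->]].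
by exists a; split=> // i; rewrite Ez.
Qed.

Lemma fol_stalk_submodule z : submodule (stalk X z) (F z).
Proof.
have [U [oU Uz [m [e eF]]]] := fol_coherent F z; rewrite (eF z Uz).
have sO := stalk_subring z; split.
- exists (fun=> 0); split=> [i|]; first exact: subring0.
  by rewrite big1 // => i _; rewrite scale0r.
- move=> _ _ [a [Oa ->]] [b [Ob ->]]; exists (fun i => a i + b i).
  split=> [i|]; first exact: (subringD sO).
  by rewrite -big_split; apply: eq_bigr => i _; rewrite scalerDl.
- move=> c _ Oc [a [Oa ->]]; exists (fun i => c * a i).
  split=> [i|]; first exact: (subringM sO).
  by rewrite scaler_sumr; apply: eq_bigr => i _; rewrite scalerA.
Qed.

(** Coherence carries each stalk of [F] into the stalk at the generic point, where every denominator
    can be divided out. *)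
Lemma generic_fibreE eta : (forall V, open V -> V !=set0 -> V eta) ->
  stalk X eta = setT -> G = F eta.
Proof.
move=> gen Eeta; apply/seteqP; split=> [D [x [a [a0 FaD]]]|D FD]; last first.
  by exists eta, 1; rewrite scale1r oner_eq0.
have /(_ _ FaD) FaD' : F x `<=` F eta.
  by apply: fol_stalk_generic => // V oV Vx; apply: gen => //; exists x.
have [_ _ FZ] := fol_stalk_submodule eta.
have := FZ a^-1 _ _ FaD'; rewrite scalerA mulVf // scale1r; apply.
by rewrite Eeta.
Qed.

Lemma generic_fibre_submodule : submodule setT G.
Proof.
have [eta [gen Eeta]] := generic_point X.
by rewrite (generic_fibreE gen Eeta) -Eeta; apply: fol_stalk_submodule.
Qed.

Lemma generic_fibre_lie D E : G D -> G E -> G (lie_bracket D E).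
Proof.
have [eta [gen Eeta]] := generic_point X; rewrite (generic_fibreE gen Eeta).
exact: fol_lie.
Qed.

Lemma fol_generic_fibre z D : F z D -> G D.
Proof. by exists z, 1; rewrite scale1r oner_eq0. Qed.

Lemma generic_fibre_comb a D E : G D -> G E -> G (a *: D + E).
Proof.
have [_ GD GZ] := generic_fibre_submodule.
by move=> HD HE; apply: GD => //; apply: GZ.
Qed.

Definition frame m (e : 'I_m -> Der) (al : 'I_m -> Der -> K) : Prop :=
  [/\ forall i, linear_covector (al i),
      forall i j, al i (e j) = (i == j)%:R,
      forall i D, G D -> al i D = 0
    & forall D, G (D - \sum_i al i D *: e i)].

Definition regular_frame m (e : 'I_m -> Der) (al : 'I_m -> Der -> K) z : Prop :=
  [/\ forall i, tangent z (e i), forall i, regular_covector z (al i)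
    & forall D, tangent z D -> F z (D - \sum_i al i D *: e i)].

(** Coordinates modulo [G] at the generic point define the covectors. By uniqueness they agree with
    the coordinates at each point of [U], hence are regular there. *)
Lemma regular_point_frame y : quotient_locally_free_at F y ->
  exists (U : set X) m (e : 'I_m -> Der) (al : 'I_m -> Der -> K),
    [/\ open U, U y, frame e al & forall z, U z -> regular_frame e al z].
Proof.
move=> [U [oU Uy [m [e basis_e]]]]; exists U, m, e.
have [eta [gen Eeta]] := generic_point X.
have GE := generic_fibreE gen Eeta.
have Ueta : U eta by apply: gen => //; exists y.
have [_ be] := basis_e eta Ueta.
have teta D : tangent eta D by move=> f _; rewrite Eeta.
have /choice[al Hal] : forall D, exists a : 'I_m -> K,
    G (D - \sum_i a i *: e i) /\
    forall a' : 'I_m -> K, G (D - \sum_i a' i *: e i) -> a = a'.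
  move=> D; have [a [[_ Ga] ua]] := be D (teta D); exists a; rewrite GE.
  by split=> // a' Ga'; apply: ua; split=> // i; rewrite Eeta.
have [G0 GD GZ] := generic_fibre_submodule.
have uniq D (a : 'I_m -> K) i : G (D - \sum_i a i *: e i) -> al D i = a i.
  by move=> Ga; have [_ /(_ _ Ga)->] := Hal D.
exists (fun i D => al D i).
have lal i : linear_covector (fun D => al D i).
  move=> a D E; apply: (uniq _ (fun i => a * al D i + al E i)).
  have -> : a *: D + E - \sum_i0 (a * al D i0 + al E i0) *: e i0 =
      a *: (D - \sum_i0 al D i0 *: e i0) + (E - \sum_i0 al E i0 *: e i0).
    rewrite scalerBr addrACA -opprD; congr (_ - _).
    rewrite scaler_sumr -big_split; apply: eq_bigr => j _.
    by rewrite scalerDl scalerA.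
  by apply: generic_fibre_comb; case: (Hal D); case: (Hal E).
split=> // [|z Uz].
  split=> // [i j|i D HD|D]; last by case: (Hal D).
  - apply: (uniq _ (fun i => (i == j)%:R)).
    rewrite (bigD1 j) //= eqxx scale1r big1 ?addr0 ?subrr // => l /negPf->.
    by rewrite scale0r.
  - by apply: (uniq _ (fun=> 0)); rewrite big1 ?subr0 // => j _; rewrite scale0r.
have [te bz] := basis_e z Uz.
have alz D : tangent z D -> (forall i, stalk X z (al D i)) /\
    F z (D - \sum_i al D i *: e i).
  move=> tD; have [a [[Oa Fa] _]] := bz D tD.
  suff -> : al D = a by [].
  by have [_] := Hal D; apply; apply: fol_generic_fibre Fa.
split=> // [i|D /alz[]//].
by split=> // D /alz[].
Qed.

Lemma frame_span m (e : 'I_m -> Der) al (be : Der -> K) D : frame e al ->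
  linear_covector be -> (forall E, G E -> be E = 0) ->
  be D = \sum_i al i D * be (e i).
Proof.
move=> [_ _ _ Gr] lbe be0; apply/eqP; rewrite -subr_eq0.
by rewrite -linear_covector_sum // -linear_covectorB // be0.
Qed.

(** ** Alternating forms *)

Section AltForms.
Variable q : nat.
Implicit Types (w : alt_form F q) (v : 'I_q -> Der).

Lemma alt_linear w v i a E E' : alt_fun w (upd v i (a *: E + E')) =
  a * alt_fun w (upd v i E) + alt_fun w (upd v i E').
Proof. by have /asboolP[H _ _] := alt_funP w; apply: H. Qed.

Lemma alt_repeat w v i j : i != j -> v i = v j -> alt_fun w v = 0.
Proof. by have /asboolP[_ H _] := alt_funP w; apply: H. Qed.

Lemma alt_generic w v i : G (v i) -> alt_fun w v = 0.
Proof. by have /asboolP[_ _ H] := alt_funP w; apply: H. Qed.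

Lemma upd_id v i : upd v i (v i) = v.
Proof. by apply: funext => j; rewrite /upd; case: eqP => [->|]. Qed.

Lemma upd_at v i E : upd v i E i = E.
Proof. by rewrite /upd eqxx. Qed.

Lemma upd_ne v i j E : j != i -> upd v i E j = v j.
Proof. by rewrite /upd => /negPf->. Qed.

Lemma alt_comb w v i m (c : 'I_m -> K) (e : 'I_m -> Der) E : G E ->
  alt_fun w (upd v i (\sum_j c j *: e j + E)) =
  \sum_j c j * alt_fun w (upd v i (e j)).
Proof.
move=> GE; elim/big_rec2: _ => [|j x D _ <-].
  by rewrite add0r (@alt_generic _ _ i) ?upd_at.
by rewrite -addrA alt_linear.
Qed.

Lemma alt_independent w v (c : 'I_q -> K) : alt_fun w v != 0 ->
  G (\sum_j c j *: v j) -> forall j, c j = 0.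
Proof.
move=> wv Gs j; have := @alt_generic w (upd v j (\sum_j c j *: v j)) j.
rewrite upd_at => /(_ Gs); rewrite -[\sum_j _]addr0.
have [G0 _ _] := generic_fibre_submodule.
rewrite (alt_comb w v j c v G0) (bigD1 j) //= upd_id big1 ?addr0 => [/eqP|i ij].
  by rewrite mulf_eq0 (negPf wv) orbF => /eqP.
rewrite (@alt_repeat w _ i j) ?mulr0 // upd_at upd_ne //.
Qed.

(** The zero value with [v i + v j] in both places is expanded, which avoids division by two. *)
Lemma alt_swap w v i j : i != j ->
  alt_fun w (fun l => v (tperm i j l)) = - alt_fun w v.
Proof.
move=> ij; have ji : j != i by rewrite eq_sym.
pose V A B := upd (upd v i A) j B.
have V1 A A' B : alt_fun w (V (A + A') B) = alt_fun w (V A B) + alt_fun w (V A' B).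
  have comm C : V C B = upd (upd v j B) i C.
    apply: funext => l; rewrite /V /upd; case: (eqVneq l j) => // ->.
    by rewrite (negPf ji).
  by rewrite !comm -[A]scale1r alt_linear mul1r scale1r.
have V2 A B B' : alt_fun w (V A (B + B')) = alt_fun w (V A B) + alt_fun w (V A B').
  by rewrite /V -[B]scale1r alt_linear mul1r scale1r.
have V0 A : alt_fun w (V A A) = 0.
  by apply: (@alt_repeat _ _ i j) => //; rewrite /V upd_at upd_ne // upd_at.
have := V0 (v i + v j); rewrite V1 !V2 !V0 add0r addr0 => /eqP.
rewrite addrC addr_eq0 => /eqP H.
have -> : (fun l => v (tperm i j l)) = V (v j) (v i).
  apply: funext => l; rewrite /V /upd; case: tpermP => [->|->|/eqP li /eqP lj].
  - by rewrite (negPf ij) eqxx.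
  - by rewrite eqxx.
  - by rewrite (negPf li) (negPf lj).
rewrite H; congr (- alt_fun w _); apply: funext => l; rewrite /V /upd.
by case: (eqVneq l j) => [->|] //; case: (eqVneq l i) => [->|].
Qed.

(** The vanishing passes to permutations of the frame by transpositions, then to sequences of frame
    vectors with repetitions, then to all arguments by expanding entries modulo [G]. *)
Lemma alt_frame0 w (e : 'I_q -> Der) al : frame e al -> alt_fun w e = 0 ->
  forall v, alt_fun w v = 0.
Proof.
move=> [_ _ _ Gr] we.
have perm0 (p : 'S_q) : alt_fun w (fun i => e (p i)) = 0.
  have [ts -> _] := prod_tpermP p; elim: ts => [|[i j] ts IHts].
    by rewrite big_nil -[RHS]we; congr (alt_fun w _); apply: funext => i; rewrite perm1.
  rewrite big_cons /=; set p' := (\prod_(_ <- _) _)%g in IHts *.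
  have -> : (fun l => e ((tperm i j * p')%g l)) = (fun l => e (p' (tperm i j l))).
    by apply: funext => l; rewrite permM.
  case: (eqVneq i j) => [->|ij].
    by rewrite -[RHS]IHts; congr (alt_fun w _); apply: funext => l; rewrite tperm1 perm1.
  by rewrite (alt_swap _ (fun l => e (p' l)) ij) IHts oppr0.
have fun0 (f : 'I_q -> 'I_q) : alt_fun w (fun i => e (f i)) = 0.
  case: (pselect (injective f)) => [injf|].
    by rewrite -[RHS](perm0 (perm injf)); congr (alt_fun w _); apply: funext => i; rewrite permE.
  move=> Ninj; apply: contrapT => H; apply: Ninj => i j fij; apply: contrapT => /eqP ij.
  by apply: H; apply: (alt_repeat _ ij); rewrite fij.
(* [m] bounds the leading entries that are still arbitrary; from [m] on they are frame vectors. *)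
suff H m v : (forall j : 'I_q, (m <= j)%N -> exists l, v j = e l) -> alt_fun w v = 0.
  by move=> v; apply: (H q) => j; rewrite leqNgt ltn_ord.
elim: m v => [|m IHm] v Hv.
  have /choice[f Hf] : forall j, exists l, v j = e l by move=> j; apply: Hv.
  by rewrite -[RHS](fun0 f); congr (alt_fun w _); apply: funext.
case: (ltnP m q) => [lt_mq|le_qm]; last first.
  by apply: IHm => j le_mj; have := leq_trans le_qm le_mj; rewrite leqNgt ltn_ord.
pose i := Ordinal lt_mq.
rewrite -(upd_id v i) -(subrK (\sum_l al l (v i) *: e l) (v i)) addrC alt_comb //.
rewrite big1 // => l _; rewrite IHm ?mulr0 // => j le_mj.
rewrite /upd; case: eqP => [_|ji]; first by exists l.
by apply: Hv; rewrite ltn_neqAle le_mj andbT; apply/eqP => mj; apply: ji; apply: val_inj.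
Qed.

Lemma wedge_alt (al : 'I_q -> Der -> K) : (forall i, linear_covector (al i)) ->
  (forall i D, G D -> al i D = 0) -> wedge al \in @is_alt_form _ _ F q.
Proof.
move=> lal al0; apply/asboolP; split.
- move=> v i a E E'; rewrite -[RHS]/(a * wedge al _ + wedge al _ : K) /wedge.
  rewrite -!(det_tr (\matrix_(_, _) _)) -[X in _ = _ + X]mul1r.
  apply: (@determinant_multilinear _ _ _ _ _ i).
  + by apply/rowP => j; rewrite !mxE !upd_at lal mul1r.
  + by apply/matrixP => l j; rewrite !mxE !upd_ne // eq_sym neq_lift.
  + by apply/matrixP => l j; rewrite !mxE !upd_ne // eq_sym neq_lift.
- move=> v i j ij vij; rewrite /wedge -det_tr; apply: (determinant_alternate ij) => l.
  by rewrite !mxE vij.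
- move=> v i Gvi; rewrite /wedge (expand_det_col _ i) big1 // => l _.
  by rewrite mxE al0 // mul0r.
Qed.

Lemma alt_frameE w (e : 'I_q -> Der) al : frame e al ->
  forall v, alt_fun w v = alt_fun w e * wedge al v.
Proof.
move=> fr v; have [lal dual_al al0 _] := fr.
pose om := AltForm (wedge_alt lal al0); apply/eqP; rewrite -subr_eq0; apply/eqP.
have ome : wedge al e = 1.
  rewrite -(det1 K q) /wedge; congr (\det _); apply/matrixP => i j.
  by rewrite !mxE dual_al.
apply: (@alt_frame0 (w - alt_fun w e *: om) e al fr).
by rewrite -[LHS]/(alt_fun w e - alt_fun w e * wedge al e : K) ome mulr1 subrr.
Qed.

End AltForms.

(** ** The Bott connection on the determinant *)

Lemma der_prod D (I : finType) (f : I -> K) :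
  D (\prod_i f i) = \sum_i D (f i) * \prod_(j | j != i) f j.
Proof.
suff H (r : seq I) : uniq r -> D (\prod_(i <- r) f i) =
    \sum_(i <- r) D (f i) * \prod_(j <- r | j != i) f j.
  by rewrite -big_enum H ?enum_uniq // big_enum; apply: eq_bigr => i _; rewrite big_enum_cond.
elim: r => [|i r IHr] /=; first by rewrite !big_nil der1.
case/andP=> ir /IHr {}IHr; rewrite !big_cons derM IHr eqxx /= addrC; congr (_ + _).
  rewrite mulrC; congr (_ * _); rewrite big_seq [RHS]big_seq_cond; apply: eq_bigl => j.
  by case: (boolP (j \in r)) => //= jr; apply/esym; apply: contraNneq ir => <-.
rewrite mulr_sumr big_seq [RHS]big_seq; apply: eq_bigr => j jr.
rewrite big_cons mulrCA; case: eqP => [ij|//].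
by rewrite ij jr in ir.
Qed.

(** Jacobi's formula: the determinant of [A] with row [i] differentiated is expanded along that
    row. *)
Lemma der_det D m (A : 'M[K]_m) : D (\det A) = \tr (\adj A *m map_mx D A).
Proof.
rewrite /determinant der_sum.
transitivity (\sum_i \sum_(p : 'S_m) (-1) ^+ p * (D (A i (p i)) * \prod_(j | j != i) A j (p j))).
  rewrite exchange_big; apply: eq_bigr => p _ /=.
  have Dsign : D ((-1) ^+ p) = 0.
    case: (odd_perm p); rewrite ?expr0 ?expr1 ?der1 //.
    by rewrite -[- 1]sub0r derB der0 der1 subr0.
  by rewrite derM Dsign mulr0 addr0 der_prod mulr_sumr.
rewrite mxtrace_mulC /mxtrace; apply: eq_bigr => i _; rewrite mxE.
under [RHS]eq_bigr => j _ do rewrite mxE [in X in _ * X]mxE.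
pose B := \matrix_(l, j) (if l == i then D (A i j) else A l j).
transitivity (\det B).
  rewrite /determinant; apply: eq_bigr => p _; congr (_ * _).
  rewrite [RHS](bigD1 i) //= mxE eqxx; congr (_ * _).
  by apply: eq_bigr => j /negPf ji; rewrite mxE ji.
rewrite (expand_det_row B i); apply: eq_bigr => j _; rewrite mxE eqxx.
congr (_ * (_ * \det _)); apply/matrixP => l l'; rewrite !mxE.
by rewrite eq_sym (negPf (neq_lift i l)).
Qed.

Definition partial_trace m (e : 'I_m -> Der) (al : 'I_m -> Der -> K) D : K :=
  \sum_j al j (lie_bracket D (e j)).

(** For [D] in [G] and a top-degree form on [Der / G] with value [h] on the frame,
    [dlog h D - partial_trace e al D] is the factor by which the Lie derivative along [D] multiplies
    that form; so it depends on the form and not on the frame. Projection to [G] along the frame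
    extends it to all of [Der]. *)
Definition bott_form m (e : 'I_m -> Der) (al : 'I_m -> Der -> K) (h : K) : Der -> K :=
  fun D => let D' := D - \sum_i al i D *: e i in dlog h D' - partial_trace e al D'.

Section Bott.
Variables (m : nat) (e : 'I_m -> Der) (al : 'I_m -> Der -> K).
Hypothesis fr : frame e al.

Lemma bott_formE h D : G D -> bott_form e al h D = dlog h D - partial_trace e al D.
Proof.
move=> GD; have [_ _ al0 _] := fr; rewrite /bott_form /= big1 ?subr0 // => i _.
by rewrite al0 // scale0r.
Qed.

(** The failure of the bracket to be linear in [D] is a multiple of [D], which lies in [G] and is
    killed by every [al j]. *)
Lemma partial_trace_linear a D E : G D ->
  partial_trace e al (a *: D + E) = a * partial_trace e al D + partial_trace e al E.
Proof.
move=> GD; have [lal _ al0 _] := fr; rewrite /partial_trace mulr_sumr -big_split.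
apply: eq_bigr => j _; rewrite /= -(lal j a (lie_bracket D (e j))).
have -> : lie_bracket (a *: D + E) (e j) =
    (- e j a : K) *: D + (a *: lie_bracket D (e j) + lie_bracket E (e j)).
  apply: derivation_ext => f; rewrite lie_linear_l !derAE !derZE; ring.
by rewrite lal al0 // mulr0 add0r.
Qed.

Lemma linear_bott_form h : linear_covector (bott_form e al h).
Proof.
move=> a D E; have [lal _ _ Gr] := fr; rewrite /bott_form.
have -> : a *: D + E - \sum_i al i (a *: D + E) *: e i =
    a *: (D - \sum_i al i D *: e i) + (E - \sum_i al i E *: e i).
  rewrite scalerBr addrACA -opprD; congr (_ - _).
  rewrite scaler_sumr -big_split; apply: eq_bigr => j _.
  by rewrite lal scalerDl scalerA.
rewrite partial_trace_linear // /dlog derivation_linear; ring.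
Qed.

Lemma regular_bott_form h z : regular_frame e al z -> unit_in (stalk X z) h ->
  regular_covector z (bott_form e al h).
Proof.
move=> [te ral FD] [Oh h0 Ohi]; split; first exact: linear_bott_form.
move=> D tD; have sO := stalk_subring z; have [_ OB _] := sO.
have tD' := fol_tangent (FD D tD).
apply: OB; first by apply: (subringM sO) => //; apply: tD'.
apply: (subring_sum _ sO) => j _; have [_ H] := ral j; apply: H.
exact: tangent_lie.
Qed.

End Bott.

(** With [M] the matrix of [e'] in the frame [e], bracketing with [D] sends [e'] to [D M + B M].
    Multiplied by [N = M^-1], its trace is that of [B] plus the logarithmic derivative of
    [\det M]. *)
Lemma partial_trace_frame m (e e' : 'I_m -> Der) (al al' : 'I_m -> Der -> K) D :
  frame e al -> frame e' al' -> G D ->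
  wedge al e' != 0 /\
  partial_trace e' al' D = partial_trace e al D + dlog (wedge al e') D.
Proof.
move=> fr fr' GD; have [lal dual_al al0 Gr] := fr; have [lal' dual_al' al'0 Gr'] := fr'.
pose M := \matrix_(i, j) al i (e' j); pose N := \matrix_(i, j) al' i (e j).
have MN : M *m N = 1%:M.
  apply/matrixP => i j; rewrite !mxE -dual_al (frame_span (e j) fr' (lal i) (al0 i)).
  by apply: eq_bigr => l _; rewrite !mxE mulrC.
have [NM detM] : N *m M = 1%:M /\ \det M != 0.
  split; first exact: mulmx1C.
  have := congr1 determinant MN; rewrite det_mulmx det1 => e1.
  by apply/eqP => e0; move: e1; rewrite e0 mul0r => /esym/eqP; rewrite oner_eq0.
split; first exact: detM.
pose B := \matrix_(i, j) al i (lie_bracket D (e j)).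
have lieM i j : al i (lie_bracket D (e' j)) = (map_mx D M + B *m M) i j.
  have [G0 GDD GZ] := generic_fibre_submodule.
  (* [e' j] minus its frame expansion lies in [G], and the bracket with [D] keeps it there because
     [G] is involutive. *)
  have De' : G (lie_bracket D (e' j) -
      \sum_l ((D (M l j) : K) *: e l + M l j *: lie_bracket D (e l))).
    have -> : lie_bracket D (e' j) -
        \sum_l ((D (M l j) : K) *: e l + M l j *: lie_bracket D (e l)) =
        lie_bracket D (e' j - \sum_l al l (e' j) *: e l).
      apply: derivation_ext => f; rewrite !(lieE, derBE, derivation_sum) derB der_sum.
      rewrite [RHS](_ : _ = D (e' j f) - e' j (D f) -
        (\sum_l D ((al l (e' j) *: e l) f) - \sum_l (al l (e' j) *: e l) (D f))).
        rewrite -sumrB; congr (_ - _); apply: eq_bigr => l _.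
        by rewrite !(derAE, derZE) lieE derM mxE; ring.
      by ring.
    by apply: generic_fibre_lie.
  have /eqP := al0 i _ De'; rewrite linear_covectorB // subr_eq0 => /eqP ->.
  rewrite big_split /= -[\sum_l (D (M l j) : K) *: e l]scale1r lal // !linear_covector_sum // mul1r.
  rewrite !mxE; congr (_ + _).
    rewrite (bigD1 i) //= dual_al eqxx mulr1 big1 ?addr0 ?mxE // => l li.
    by rewrite dual_al eq_sym (negPf li) mulr0.
  by apply: eq_bigr => l _; rewrite mulrC !mxE.
have tr' : partial_trace e' al' D = \tr (N *m (map_mx D M + B *m M)).
  apply: eq_bigr => j _; rewrite mxE (frame_span _ fr (lal' j) (al'0 j)).
  by apply: eq_bigr => l _; rewrite lieM mulrC [N j l]mxE.
have tr0 : partial_trace e al D = \tr B.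
  by apply: eq_bigr => j _; rewrite mxE.
rewrite tr' tr0 mulmxDr mxtraceD addrC mulmxA mxtrace_mulC mulmxA MN mul1mx; congr (_ + _).
rewrite /dlog -[wedge al e']/(\det M) der_det.
have -> : \adj M = \det M *: N.
  by rewrite -[LHS]mulmx1 -MN mulmxA mul_adj_mx mul_scalar_mx.
by rewrite -scalemxAl linearZ /= mulrAC divff // mul1r.
Qed.

End FoliationTheory.

(** * The Chern class of the normal sheaf *)

Section Dlog.
Variables (k : closedFieldType) (X : variety k).
Notation K := (function_field X).
Notation Der := (derivation (scalars X)).

Lemma dlog_mul (a b : K) (D : Der) : a != 0 -> b != 0 ->
  dlog (a * b) D = dlog a D + dlog b D.
Proof. exact: dlogM. Qed.

Lemma regular_dlog (z : X) (g : K) : unit_in (stalk X z) g ->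
  regular_covector z (dlog (X := X) g).
Proof.
move=> [Og g0 Ogi]; split=> [a D E|D tD]; rewrite /dlog.
  by rewrite derivation_linear mulrDl mulrA.
by apply: (subringM (stalk_subring z)) => //; apply: tD.
Qed.

End Dlog.

Section ListCochains.
Variables (K : fieldType) (T : eqType) (E : lmodType K).

Lemma cobound_ord s (c : seq T -> E) (i : 'I_s.+1 -> T) :
  cobound c [seq i a | a <- enum 'I_s.+1] =
  \sum_(a < s.+1) (-1) ^+ a *: c [seq i (lift a b) | b <- enum 'I_s].
Proof.
elim: s c i => [|s IHs] c i; rewrite enum_ordSl big_ord_recl /= expr0 scale1r.
  rewrite big_ord0 addr0 -map_comp (_ : enum 'I_0 = [::]) //= ?subr0 //.
  by apply: size0nil; rewrite size_enum_ord.
rewrite (_ : [seq i a | a <- _] = [seq i (lift ord0 a) | a <- enum 'I_s.+1]).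
  2: by rewrite -map_comp.
congr (_ + _); rewrite (IHs _ (fun a => i (lift ord0 a))) -sumrN; apply: eq_bigr => a _.
rewrite /= exprS mulN1r scaleNr; congr (- (_ *: c _)).
rewrite (enum_ordSl s) /=; congr (i _ :: _); first exact: val_inj.
rewrite -!map_comp; apply: eq_map => b /=; congr i; apply: val_inj; rewrite /= /bump /=.
by rewrite leq_add2l addnCA.
Qed.

End ListCochains.

Lemma nth_steps (T : eqType) (V : zmodType) (eta : T -> V) (x0 : T) (v0 : V) l a :
  (a.+1 < size l)%N ->
  nth v0 (steps eta l) a = eta (nth x0 l a.+1) - eta (nth x0 l a).
Proof.
case: l => // x l; rewrite ltnS /=; elim: l x a => // y l IHl x [|a] //= lta.
by rewrite IHl.
Qed.

Lemma det_mul_lt (K : fieldType) m (A : 'M[K]_(m.+1, m)) (B : 'M[K]_(m, m.+1)) :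
  \det (A *m B) = 0.
Proof.
apply/eqP; rewrite -[_ == 0]negbK -unitfE -unitmxE -row_free_unit; apply/negP.
by move/eqP => rk; have := mulmx_max_rank A B; rewrite rk ltnn.
Qed.

Section NormalSheaf.
Variables (k : closedFieldType) (X : variety k) (F : foliation X) (q : nat).
Notation K := (function_field X).
Notation Der := (derivation (scalars X)).
Notation G := (generic_fibre F).
Implicit Types (phi : alt_form F q -> K^o) (w : alt_form F q) (z : X) (U : set X).

Lemma generator_linear U phi : U !=set0 -> local_generator (det_normal F q) U phi ->
  linear phi.
Proof.
move=> [x Ux] [_ /(_ x Ux) e]; have : det_normal F q x phi; last by case.
by rewrite e; exists 1; rewrite ?scale1r //; case: (stalk_subring x).
Qed.

Lemma generator_dual U phi : U !=set0 -> local_generator (det_normal F q) U phi ->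
  exists w, phi w = 1.
Proof.
move=> U0 gen; have lphi := generator_linear U0 gen.
have [w w0] : exists w, phi w != 0.
  apply: contrapT => H; have [/eqP[]] := gen; apply: funext => w.
  by apply/eqP/negPn/negP => w0; apply: H; exists w.
have phi0 : phi 0 = 0.
  have := lphi (-1) 0 0; rewrite scaler0 addr0 => /eqP.
  by rewrite scaleN1r addNr => /eqP.
exists ((phi w)^-1 *: w); rewrite -[_ *: w]addr0 lphi phi0 addr0.
by rewrite -[LHS]/(_ * _ : K) mulVf.
Qed.

Lemma generator_nonzero phi w : linear phi -> phi w = 1 ->
  exists v, alt_fun w v != 0.
Proof.
move=> lphi phiw; apply: contrapT => H.
have w0 : w = 0.
  apply: val_inj; apply: funext => v; apply/eqP/negPn/negP => wv.
  by apply: H; exists v.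
have := lphi (-1) 0 0; rewrite scaler0 addr0 scaleN1r addNr -w0 phiw => /eqP.
by rewrite oner_eq0.
Qed.

Lemma generator_ratio U U' phi phi' (g : K) z : U z -> U' z ->
  local_generator (det_normal F q) U phi -> local_generator (det_normal F q) U' phi' ->
  g != 0 -> phi' = g *: phi -> unit_in (stalk X z) g.
Proof.
move=> Uz U'z gen gen' g0 e.
have sO := stalk_subring z; have [O1 _ _] := sO.
have [phi0 /(_ z Uz) L] := gen; have [phi'0 /(_ z U'z) L'] := gen'.
have inj (psi : alt_form F q -> K^o) (a b : K) : psi != 0 -> a *: psi = b *: psi -> a = b.
  move=> psi0 /eqP; rewrite -subr_eq0 -scalerBl scaler_eq0 (negPf psi0) orbF.
  by rewrite subr_eq0 => /eqP.
split=> //.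
  have : det_normal F q z phi' by rewrite L'; exists 1; rewrite ?scale1r.
  by rewrite L => -[a Oa]; rewrite e => /(inj _ _ _ phi0)->.
have : det_normal F q z phi by rewrite L; exists 1; rewrite ?scale1r.
rewrite L' => -[a Oa ea]; suff -> : g^-1 = a by [].
by apply: (inj _ _ _ phi'0); rewrite -ea e scalerA mulVf // scale1r.
Qed.

(** For a frame of [T_X / T_F] at [z], evaluation on the frame generates
    [det_normal]; the form dual to any generator thus takes a unit value. *)
Lemma generator_frame_unit U phi w z (e : 'I_q -> Der) al : U z ->
  local_generator (det_normal F q) U phi -> phi w = 1 -> frame F e al ->
  regular_frame F e al z -> unit_in (stalk X z) (alt_fun w e).
Proof.
move=> Uz gen phiw fr [te ral _]; have sO := stalk_subring z; have [O1 _ _] := sO.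
have [phi0 /(_ z Uz) L] := gen; have [lal dual_al al0 _] := fr.
have lphi : linear phi by apply: generator_linear gen; exists z.
have conal i : conormal F z (al i).
  split; last by move=> D /fol_generic_fibre; apply: al0.
  split; last by case: (ral i).
  by move=> a D E; rewrite lal.
have we0 : alt_fun w e != 0.
  have [v wv] := generator_nonzero lphi phiw; apply: contraNneq wv => we.
  by rewrite (alt_frame0 fr we).
pose om := (alt_fun w e)^-1 *: w.
have omE v : alt_fun om v = wedge al v.
  rewrite -[LHS]/((alt_fun w e)^-1 * alt_fun w v : K) (alt_frameE w fr v).
  by rewrite mulKf.
have phiom : phi om = (alt_fun w e)^-1.
  have phi00 : phi 0 = 0.
    have := lphi (-1) 0 0; rewrite scaler0 addr0 => /eqP.
    by rewrite scaleN1r addNr => /eqP.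
  by rewrite /om -[_ *: w]addr0 lphi phi00 addr0 phiw -[LHS]/(_ * _ : K) mulr1.
split=> //; last first.
  (* The rescaled form [om] is [wedge al], regular on the stalk of [N_F] because each [al i] is
     conormal; [phi] therefore takes it to a regular value, the inverse of [alt_fun w e]. *)
  rewrite -phiom; have [_] : det_normal F q z phi.
    by rewrite L; exists 1; rewrite ?scale1r.
  apply=> D ND; rewrite omE; apply: stalk_det => i j; rewrite mxE.
  exact: ND.
pose ev : alt_form F q -> K^o := fun w' => alt_fun w' e.
have : det_normal F q z ev.
  split=> [a w1 w2|w' Nw']; first by [].
  by apply: Nw' => j al' [[_ H] _]; apply: H.
rewrite L => -[a Oa ea].
have -> : alt_fun w e = a by rewrite -[LHS]/(ev w) ea -[LHS]/(a * phi w : K) phiw mulr1.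
exact: Oa.
Qed.

(** The determinant of the frame change enters the value of the form and the trace with the same
    [dlog], so it cancels; only the factor [c] between the forms remains. *)
Lemma bott_form_compare (e e' : 'I_q -> Der) al al' w w' (c : K) D :
  frame F e al -> frame F e' al' -> G D -> alt_fun w e != 0 -> c != 0 ->
  w' = c *: w ->
  bott_form e' al' (alt_fun w' e') D = bott_form e al (alt_fun w e) D + dlog c D.
Proof.
move=> fr fr' GD we c0 ->; rewrite (bott_formE fr') // (bott_formE fr) //.
have [u0 ->] := partial_trace_frame fr fr' GD.
rewrite -[alt_fun (c *: w) e']/(c * alt_fun w e' : K) (alt_frameE w fr e').
by rewrite !dlog_mul ?mulf_neq0 //; ring.
Qed.

(** The covectors live on the [q]-dimensional quotient by [G], so the matrix of their values factors
    through dimension [q]. *)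
Lemma wedge_generic_fibre0 (e : 'I_q -> Der) al (be : 'I_q.+1 -> Der -> K) :
  frame F e al -> (forall i, linear_covector (be i)) ->
  (forall i D, G D -> be i D = 0) -> wedge be = 0.
Proof.
move=> fr lbe be0; apply: funext => D; rewrite /wedge -[RHS]/(0 : K).
have -> : \matrix_(i, j) be i (D j) =
    (\matrix_(i < q.+1, l < q) be i (e l)) *m (\matrix_(l < q, j < q.+1) al l (D j)).
  apply/matrixP => i j; rewrite !mxE (frame_span (D j) fr (lbe i) (be0 i)).
  by apply: eq_bigr => l _; rewrite !mxE mulrC.
exact: det_mul_lt.
Qed.

(** Local freeness does not fix the rank [m]. A nonzero value of [w] makes [v] independent modulo
    [G], so [q <= m]; [g] and [e] give [r + m] independent derivations, and [r + q] coordinates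
    allow no more than [r + q]. *)
Lemma frame_size r (g : 'I_r -> Der) (v : 'I_q -> Der) w m (e : 'I_m -> Der) al
    (t : 'I_(r + q) -> K) : basis_mod setT G [set 0] g -> alt_fun w v != 0 ->
  (forall f, diff_span setT t f) -> frame F e al -> m = q.
Proof.
move=> [Gg basis_g] wv tspan fr; have [lal dual_al al0 Gr] := fr.
have [G0 GD GZ] := generic_fibre_submodule F.
have le_qm : (q <= m)%N.
  pose A := \matrix_(j < q, l < m) al l (v j).
  suff freeA : row_free A by rewrite -{1}(eqP freeA) rank_leq_col.
  rewrite -kermx_eq0; apply/eqP/row_matrixP => i.
  rewrite row0; set u := row i _.
  have uA : u *m A = 0 by apply/sub_kermxP; apply: row_sub.
  apply/rowP => j; rewrite [RHS]mxE.
  apply: (alt_independent (c := fun j => u 0 j) wv).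
  have := Gr (\sum_j (u 0 j : K) *: v j); rewrite [X in _ - X]big1 ?subr0 // => l _.
  rewrite linear_covector_sum //.
  have /rowP/(_ l) := uA; rewrite !mxE => e0.
  rewrite (_ : \sum_i0 _ = 0) ?scale0r // -[RHS]e0.
  by apply: eq_bigr => j' _; rewrite [A j' l]mxE.
pose ge (i : 'I_(r + m)) := match fintype.split i with inl a => g a | inr b => e b end.
have ige : independent ge.
  move=> c; rewrite big_split_ord /=.
  under eq_bigr => i _ do rewrite /ge (unsplitK (inl i)).
  under [X in _ + X]eq_bigr => i _ do rewrite /ge (unsplitK (inr i)).
  move=> s0.
  have cr i : c (rshift r i) = 0.
    have := congr1 (al i) s0; rewrite -[X in X + _]scale1r lal mul1r.
    rewrite linear_covector0 // !linear_covector_sum // big1 ?add0r; last first.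
      by move=> j _; rewrite al0 ?mulr0.
    rewrite (bigD1 i) //= dual_al eqxx mulr1 big1 ?addr0 // => j ji.
    by rewrite dual_al eq_sym (negPf ji) mulr0.
  have cl : forall i, c (lshift m i) = 0.
    have [a [_ ua]] := basis_g 0 G0.
    have e1 : a = fun=> 0.
      apply: ua; split=> //; rewrite big1 ?subr0 // => i _; by rewrite scale0r.
    have e2 : a = fun i => c (lshift m i).
      apply: ua; split=> //; move: s0; rewrite [X in _ + X]big1 ?addr0 => [->|i _].
        by rewrite subrr.
      by rewrite cr scale0r.
    by move=> i; rewrite -[LHS]/((fun i => c (lshift m i)) i) -e2 e1.
  by move=> i; rewrite -(splitK i); case: fintype.split => j /=; [apply: cl|apply: cr].
have [|_ [/eqP + _]] := independent_dual ige tspan; first by rewrite leq_add2l.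
by rewrite eqn_add2l => /eqP.
Qed.

(** Supplies the independent derivations from which [coordinates_exist] starts; that there are
    enough of them is read off from a nonzero value of a [q]-form. *)
Lemma generic_basis_independent r (g : 'I_r -> Der) (v : 'I_q -> Der) w :
  basis_mod setT G [set 0] g -> alt_fun w v != 0 ->
  independent (fun i : 'I_(r + q) =>
    match fintype.split i with inl a => g a | inr b => v b end).
Proof.
move=> [Gg basis_g] wv c; rewrite big_split_ord /=.
under eq_bigr => i _ do rewrite (unsplitK (inl i)).
under [X in _ + X]eq_bigr => i _ do rewrite (unsplitK (inr i)).
have [G0 GD GZ] := generic_fibre_submodule F.
move=> s0; have cr i : c (rshift r i) = 0.
  apply: (alt_independent (c := fun i => c (rshift r i)) wv).
  have -> : \sum_j c (rshift r j) *: v j = \sum_i ((-1) * c (lshift q i)) *: g i.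
    move/eqP: s0; rewrite addrC addr_eq0 => /eqP ->; rewrite -sumrN.
    by apply: eq_bigr => i' _; rewrite mulN1r scaleNr.
  by apply: (submodule_sum _ (generic_fibre_submodule F)).
have cl : forall i, c (lshift q i) = 0.
  have [a [_ ua]] := basis_g 0 G0.
  have e1 : a = fun=> 0.
    apply: ua; split=> //; rewrite big1 ?subr0 // => i _; by rewrite scale0r.
  have e2 : a = fun i => c (lshift q i).
    apply: ua; split=> //; move: s0; rewrite [X in _ + X]big1 ?addr0 => [->|i _].
      by rewrite subrr.
    by rewrite cr scale0r.
  by move=> i; rewrite -[LHS]/((fun i => c (lshift q i)) i) -e2 e1.
by move=> i; rewrite -(splitK i); case: fintype.split => j /=; [apply: cl|apply: cr].
Qed.

End NormalSheaf.

Lemma projective_over_sub (k : closedFieldType) (X : variety k)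
    (E : lmodType (function_field X)) (M : X -> set E) (W W' : set X) :
  W' `<=` W -> projective_over M W -> projective_over M W'.
Proof.
move=> sub [N [P [R [HPR [MP RM RP]]]]]; exists N, P, R; split=> //.
by split=> z ? /sub; [apply: MP|apply: RM|apply: RP].
Qed.

Lemma regular_locus_open (k : closedFieldType) (X : variety k) (F : foliation X) :
  open (~` singular_set F).
Proof.
have -> : ~` singular_set F = [set x | quotient_locally_free_at F x].
  by apply/seteqP; split=> x; [apply: contrapT|move=> Hx; apply].
rewrite openE => x [U [oU Ux HU]]; rewrite /interior nbhsE; exists U => //.
by move=> y Uy; exists U; split.
Qed.

(** * Local coordinates, frames and Bott forms around a point *)

Section LocalData.
Variables (k : closedFieldType) (X : variety k) (F : foliation X) (q r : nat).
Notation K := (function_field X).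
Notation Der := (derivation (scalars X)).
Notation G := (generic_fibre F).
Hypotheses (smX : smooth X) (dimX : dimension X (r + q)).
Variables (g : 'I_r -> Der) (w : alt_form F q) (v : 'I_q -> Der).
Hypotheses (basis_g : basis_mod setT G [set 0] g) (wv : alt_fun w v != 0).

Lemma local_coordinates y : exists (t : 'I_(r + q) -> K) (delta : 'I_(r + q) -> Der) W,
  [/\ affine (stalk X) (scalars X) W, W y & coordinates W t delta].
Proof.
have [|n [t [delta [W [en aW Wy co]]]]] := coordinates_exist y smX
    (generic_basis_independent basis_g wv).
  by move=> x d; apply: dimension_bound.
by subst n; exists t, delta, W.
Qed.

Lemma local_frame y : ~ singular_set F y ->
  exists (U : set X) (e : 'I_q -> Der) (al : 'I_q -> Der -> K),
    [/\ open U, U y, frame F e al & forall z, U z -> regular_frame F e al z].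
Proof.
move=> /contrapT/regular_point_frame[U [m [e [al [oU Uy fr reg]]]]].
have [t [delta [W [_ _ [_ Hdelta _ _]]]]] := local_coordinates y.
have tspan f : diff_span setT t f by exists (fun i => delta i f).
have em := frame_size basis_g wv tspan fr; subst m.
by exists U, e, al.
Qed.

(** What a member of the refined cover has to carry. At a regular centre the Bott form is normalized
    by the form dual to the generator, whose value on a regular frame is a unit; this makes it
    regular. *)
Lemma local_data (V : set X) (phi : alt_form F q -> K^o) (c : K) y :
  open V -> V y -> local_generator (det_normal F q) V phi -> phi (c *: w) = 1 ->
  exists N (th : Der -> K),
    [/\ affine (stalk X) (scalars X) N, N y, N `<=` V,
        projective_over (@Omega_stalk _ X q.+1) N
      & ~ singular_set F y -> exists (e : 'I_q -> Der) al,
          [/\ frame F e al, th = bott_form e al (alt_fun (c *: w) e)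
            & forall z, N z -> regular_covector z th]].
Proof.
move=> oV Vy gen phiw.
have [t [delta [W [aW Wy co]]]] := local_coordinates y.
have oW := affine_open aW.
case: (pselect (singular_set F y)) => Sy.
  have [|N [aN Ny NVW]] := @affine_nbhd _ X y (V `&` W) _ (conj Vy Wy).
    exact: openI.
  (* At a singular centre the zero covector is a placeholder, since the last clause concerns regular
     centres. *)
  exists N, (fun=> 0); split=> // [z /NVW[]//|].
  by apply: projective_over_sub (projective_Omega co q.+1) => z /NVW[].
have [U [e [al [oU Uy fr reg]]]] := local_frame Sy.
have [|N [aN Ny NVW]] := @affine_nbhd _ X y (V `&` W `&` U) _ (conj (conj Vy Wy) Uy).
  by apply: openI => //; apply: openI.
exists N, (bott_form e al (alt_fun (c *: w) e)); split=> // [z /NVW[[]]//||_].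
  by apply: projective_over_sub (projective_Omega co q.+1) => z /NVW[[]].
exists e, al; split=> // z /NVW[[Vz _] Uz].
apply: (regular_bott_form fr (reg z Uz)).
exact: (generator_frame_unit Vz gen phiw fr (reg z Uz)).
Qed.

End LocalData.

Theorem theorem4p3 (k : closedFieldType) (X : variety k) (n q : nat)
    (F : foliation X) (hX : smooth X) (hn : dimension X n) (n_gt1 : (1 < n)%N)
    (hq : fol_codim F q) (hS : codim_ge (singular_set F) (q + 2))
    (I : Type) (U : I -> set X) (hU : open_cover U) (c1 : cochain X I 1 1)
    (hc1 : represents_c1 (det_normal F q) U c1) :
  zero_in_cohomology U (cup_power c1 q.+1).
Proof.
have [Uo Ucov] := hU; have [phi [gen cE]] := hc1.
have [[x0 _] _] := variety_irreducible X; have [i0 Ux0] := Ucov x0.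
(* The rational reference form; divided by [gam j] it is dual to the generator [phi j]. *)
have [w phiw] := generator_dual (Uo i0).2 (gen i0).
have lphi i := generator_linear (Uo i).2 (gen i).
have [v wv] := generator_nonzero (lphi i0) phiw.
have [n' [r [dimX [g basis_g] en']]] := hq; subst n'.
(* The transition functions from the fixed index [i0], read off from the cocycle at the pair
   [(i0, j)]. *)
have /choice[gam Hgam] : forall j, exists a, a != 0 /\ phi j = a *: phi i0.
  move=> j; have [a [a0 + _]] := cE (fun l => if l == 0 then i0 else j).
  by exists a.
have gam0 j : gam j != 0 by case: (Hgam j).
have phiE j : phi j = gam j *: phi i0 by case: (Hgam j).
have phiwj j : phi j ((gam j)^-1 *: w) = 1.
  have Z0 : phi j 0 = 0.
    have := lphi j (-1) 0 0; rewrite scaler0 addr0 => /eqP.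
    by rewrite scaleN1r addNr => /eqP.
  rewrite -[_ *: w]addr0 lphi Z0 addr0 phiE -[LHS]/(_ * (_ * phi i0 w)).
  by rewrite phiw mulr1 mulVf.
have ratio i j (a : function_field X) : phi j = a *: phi i -> gam j = a * gam i.
  rewrite (phiE j) (phiE i) scalerA => /eqP; rewrite -subr_eq0 -scalerBl scaler_eq0.
  by have [/negPf-> _] := gen i0; rewrite orbF subr_eq0 => /eqP.
have c1E (i : 'I_2 -> I) :
    c1 i = fun D => dlog (gam (i 1)) (D 0) - dlog (gam (i 0)) (D 0).
  have [a [a0 /ratio ea ->]] := cE i; apply: funext => D.
  by rewrite ea dlog_mul // addrK.
have /choice[tau Utau] : forall x : X, exists i, U i x by move=> x; apply: Ucov.
have data x := local_data hX dimX basis_g wv (Uo (tau x)).1 (Utau x)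
  (gen (tau x)) (phiwj (tau x)).
have /choice[Nth HNth] : forall x, exists p : set X * (derivation (scalars X) -> function_field X),
    [/\ affine (stalk X) (scalars X) p.1, p.1 x, p.1 `<=` U (tau x),
        projective_over (@Omega_stalk _ X q.+1) p.1
      & ~ singular_set F x -> exists (e : 'I_q -> derivation (scalars X)) al,
          [/\ frame F e al, p.2 = bott_form e al (alt_fun ((gam (tau x))^-1 *: w) e)
            & forall z, p.1 z -> regular_covector z p.2]].
  by move=> x; have [N [th H]] := data x; exists (N, th).
pose N x := (Nth x).1; pose th x := (Nth x).2.
have aN x : affine (stalk X) (scalars X) (N x) by case: (HNth x).
have Nx x : N x x by case: (HNth x).
have NU x : N x `<=` U (tau x) by case: (HNth x).
have projN x : projective_over (@Omega_stalk _ X q.+1) (N x) by case: (HNth x).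
have thP x : ~ singular_set F x -> exists (e : 'I_q -> derivation (scalars X)) al,
    [/\ frame F e al, th x = bott_form e al (alt_fun ((gam (tau x))^-1 *: w) e)
      & forall z, N x z -> regular_covector z (th x)] by case: (HNth x).
have oR := regular_locus_open F.
have NB x : open (N x) /\ N x x by split=> //; apply: affine_open.
(* Two finite lists of centres: [s1] consists of regular points and covers the regular locus, [s2]
   covers [X]. Together they index the refinement, and [Q] selects the regular centres. *)
have [s1 [s1R s1cov]] := quasi_compact oR (fun x _ => NB x).
have [s2 [_ s2cov]] := quasi_compact (@openT X) (fun x _ => NB x).
pose T := 'I_(size (s1 ++ s2)); pose pnt (j : T) := nth x0 (s1 ++ s2) j.
have pntE x : x \in s1 ++ s2 -> exists j, pnt j = x.
  move=> xs; have ltx : (index x (s1 ++ s2) < size (s1 ++ s2))%N by rewrite index_mem.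
  by exists (Ordinal ltx); rewrite /pnt nth_index.
pose V (j : T) := N (pnt j).
pose Q : pred T := fun j => `[< ~ singular_set F (pnt j) >].
have Vcov y : exists j, V j y.
  have [x xs Nxy] := s2cov y Logic.I; have [|j ej] := pntE x; first by rewrite mem_cat xs orbT.
  by exists j; rewrite /V ej.
have Qcov y : ~ singular_set F y -> exists2 j, Q j & V j y.
  move=> Ry; have [x xs Nxy] := s1cov y Ry.
  have [|j ej] := pntE x; first by rewrite mem_cat xs.
  by exists j; [apply/asboolP; rewrite ej; apply: s1R|rewrite /V ej].
pose eta (j : T) : derivation (scalars X) -> function_field X := dlog (gam (tau (pnt j))).
pose mu j := eta j + th (pnt j).
pose Phi := @wedge_seq _ X q.+1.
pose c l := Phi (steps eta l).
have MA : multi_additive q.+1 Phi by apply: wedge_seq_multi_additive.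
(* Each [eta j] is only rational; the difference is the [dlog] of the ratio of two generators, a
   unit where both generate. *)
have eta_reg i j z : V i z -> V j z -> regular_covector z (eta j - eta i).
  move=> Vi Vj; pose a := gam (tau (pnt j)) / gam (tau (pnt i)).
  have a0 : a != 0 by rewrite mulf_neq0 ?invr_eq0.
  have ea : gam (tau (pnt j)) = a * gam (tau (pnt i)) by rewrite divfK.
  have -> : eta j - eta i = dlog a.
    apply: funext => D; rewrite -[LHS]/(eta j D - eta i D) /eta ea dlog_mul //.
    by rewrite addrK.
  apply: regular_dlog; apply: (generator_ratio (NU _ _ Vi) (NU _ _ Vj) (gen _) (gen _) a0).
  by rewrite [phi (tau (pnt j))]phiE [phi (tau (pnt i))]phiE scalerA -ea.
have th_reg j z : Q j -> V j z -> regular_covector z (th (pnt j)).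
  by move=> /asboolP/thP[e [al [_ _ H]]] Vj; apply: H.
have mu_reg i j z : Q i -> Q j -> V i z -> V j z -> regular_covector z (mu j - mu i).
  move=> Qi Qj Vi Vj; have -> : mu j - mu i = (eta j - eta i) - (th (pnt i) - th (pnt j)).
    by rewrite /mu opprD addrACA opprB.
  by apply: regular_covectorB; [apply: eta_reg|apply: regular_covectorB; apply: th_reg].
have Phi_reg z l : (forall al, al \in l -> regular_covector z al) -> Omega_stalk z (Phi l).
  move=> Hl; have [t [delta [W [_ Wz co]]]] := local_coordinates hX dimX basis_g wv z.
  apply: (wedge_Omega co Wz) => i.
  case: (ltnP i (size l)) => [lti|lei]; first by apply/Hl/mem_nth.
  rewrite nth_default //; split=> [a D D'|D _]; first by rewrite mulr0 addr0.
  exact: subring0 (stalk_subring z).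
have steps_reg z (f : T -> derivation (scalars X) -> function_field X) l :
    {in l &, forall i j, regular_covector z (f j - f i)} ->
    forall al, al \in steps f l -> regular_covector z al.
  case: l => // i l Hl al; elim: l i Hl => //= j l IHl i Hl.
  rewrite inE => /predU1P[->|]; first by apply: Hl; rewrite !inE eqxx ?orbT.
  by apply: IHl => a b la lb; apply: Hl; rewrite inE ?la ?lb orbT.
have c_reg : regular_over (@Omega_stalk _ X q.+1) V setT xpredT q.+2 c.
  move=> l _ sl z [_ Vz]; apply: Phi_reg; apply: steps_reg => i j il jl.
  by apply: eta_reg; apply: Vz.
have dc l : size l = q.+3 -> cobound c l = 0 by move=> sl; apply: cobound_steps MA sl.
have mu_generic i j D : Q i -> Q j -> generic_fibre F D -> mu j D = mu i D.
  (* On [G] the term [dlog gam] of [eta] cancels the factor [gam^-1] of the form used in [th], so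
     every [mu l] restricts to the Bott form of [w] itself. *)
  have muE l : Q l -> exists (e : 'I_q -> derivation (scalars X)) al, [/\ frame F e al,
      alt_fun w e != 0 & forall D, generic_fibre F D -> mu l D = bott_form e al (alt_fun w e) D].
    move=> /asboolP/thP[e [al [fr eth _]]].
    have we : alt_fun w e != 0 by apply: contraNneq wv => we; rewrite (alt_frame0 fr we).
    exists e, al; split=> // D' GD'.
    rewrite -[LHS]/(eta l D' + th (pnt l) D') eth.
    rewrite (bott_form_compare fr fr GD' we _ (erefl (_ *: w))) ?invr_eq0 // addrCA.
    rewrite -dlog_mul ?invr_eq0 // divff // /dlog der1 mul0r addr0 //.
  move=> /muE[e [al [fr we muiE]]] /muE[e' [al' [fr' we' mujE]]] GD.
  rewrite muiE // mujE //.
  rewrite (bott_form_compare fr fr' GD we (oner_neq0 _)) ?scale1r //.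
  by rewrite /dlog der1 mul0r addr0.
have Phi_mu l : all Q l -> size l = q.+2 -> Phi (steps mu l) = 0.
  case: l => // i l Ql [sl]; have Qi : Q i by case/andP: Ql.
  have /asboolP/thP[e [al [fr _ _]]] := Qi.
  (* Linearity of the differences of [mu] is extracted from their regularity at the generic point,
     which lies in every [V j]. *)
  have [eta_pt [eta_gen _]] := generic_point X.
  have Veta j : V j eta_pt.
    by apply: eta_gen; [apply: affine_open (aN _)|exists (pnt j); apply: Nx].
  have memP a : (a < q.+1)%N -> nth (fun=> 0) (steps mu (i :: l)) a =
      mu (nth i (i :: l) a.+1) - mu (nth i (i :: l) a).
    by move=> lta; apply: nth_steps; rewrite /= sl ltnS.
  have Qn a : (a < q.+2)%N -> Q (nth i (i :: l) a).
    by move=> lta; apply: (allP Ql); apply: mem_nth; rewrite /= sl.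
  apply: (wedge_generic_fibre0 fr) => [a|a D GD]; rewrite memP //.
    have [] // := mu_reg (nth i (i :: l) a) (nth i (i :: l) a.+1) eta_pt.
    - exact: Qn (leqW (ltn_ord a)).
    - exact: (Qn a.+1 (ltn_ord a)).
  rewrite -[LHS]/(mu _ D - mu _ D).
  by rewrite (mu_generic (nth i (i :: l) a) _ D) ?subrr //;
    [exact: Qn (leqW (ltn_ord a))|exact: (Qn a.+1 (ltn_ord a))].
pose b := homotopy eta mu (fun j => - th (pnt j)) Phi.
have thE j : - th (pnt j) = eta j - mu j by rewrite /mu opprD addNKr.
have b_reg : regular_over (@Omega_stalk _ X q.+1) V setT Q q.+1 b.
  move=> l Ql _ z [_ Vz].
  apply: (@homotopy_ind _ _ _ eta mu _ (Omega_stalk z) (regular_covector z)).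
  - exact: Omega_stalk0.
  - exact: Omega_stalkB.
  - exact: Phi_reg.
  - move=> j jl; rewrite -sub0r; apply: regular_covectorB.
      rewrite -(subrr (eta j)); apply: eta_reg; exact: Vz.
    by apply: th_reg; [apply: (allP Ql)|apply: Vz].
  - move=> i j il jl; split; first by apply: eta_reg; apply: Vz.
    by apply: mu_reg; [apply: (allP Ql)|apply: (allP Ql)|apply: Vz|apply: Vz].
have db l : all Q l -> size l = q.+2 -> cobound b l = c l.
  by move=> Ql sl; rewrite (cobound_homotopy thE MA sl) Phi_mu // subr0.
(* A point outside the members with regular centre is singular, so the codimension hypothesis bounds
   the dimension of its local ring from below. *)
have dimV y : (forall j, Q j -> ~ V j y) -> prime_chain (stalk X y) (q + 2).
  move=> Vy; apply: (codim_primes _ _ hS).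
    by rewrite -openC.
  by apply: contrapT => /Qcov[j /Vy].
(* Here [s] is [q.+1] and [e] is [q + 2]: the required [s < e] is exactly what codimension [q + 2]
   affords. *)
have [|b' [b'_reg db']] := glue_cochain_all hX (@Omega_stalk0 _ X q.+1)
  (@Omega_stalkB _ X q.+1) (fun j => aN (pnt j)) (fun j => projN (pnt j)) dimV _
  c_reg dc b_reg db.
  by rewrite addn2.
exists T, V, (fun j => tau (pnt j)); split=> [|j|].
- split=> // j; split; first exact: affine_open (aN _).
  by exists (pnt j); apply: Nx.
- exact: NU.
(* The primitive is read on the list of values of [i]; [cobound_ord] identifies its list coboundary
   with [cech_d]. *)
exists (fun i => b' [seq i a | a <- enum 'I_q.+1]); split.
  move=> i z Vz; apply: b'_reg; [exact: all_predT|by rewrite size_map size_enum_ord|].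
  by split=> // j /mapP[a _ ->]; apply: Vz.
apply: funext => i; rewrite /cech_d.
have sz : size [seq i a | a <- enum 'I_q.+2] = q.+2 by rewrite size_map size_enum_ord.
have := cobound_ord b' i; rewrite (db' _ sz) => <-.
rewrite /cup_power /c /Phi /wedge_seq; congr (wedge _); apply: funext => a.
rewrite (nth_steps _ (i ord0)); last by rewrite sz ltnS.
apply: funext => D.
rewrite c1E -[RHS]/(eta _ D - eta _ D).
have nthE (m : nat) : (m < q.+2)%N ->
    nth (i ord0) [seq i a | a <- enum 'I_q.+2] m = i (inord m).
  move=> ltm; rewrite (nth_map ord0) ?size_enum_ord //; congr i.
  by apply: val_inj; rewrite /= nth_enum_ord // inordK.
have e1 : (nat_of_ord a + nat_of_ord (1%R : 'I_2))%N = (nat_of_ord a).+1 := addn1 _.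
have e0 : (nat_of_ord a + nat_of_ord (0%R : 'I_2))%N = nat_of_ord a := addn0 _.
by rewrite (nthE _ (ltn_ord a : (a.+1 < q.+2)%N)) (nthE _ (leqW (ltn_ord a))) e1 e0.
Qed.
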